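(* For every integer $g\ge 2$ there exists a domain $\Omega\subset\mathbb{C}$ of connectivity $g+1$ with the following two properties. (A) For some $0<s_2<s_1$ and $\zeta_0\in\Omega$, the ball $B_{c_\Omega}(\zeta_0;s_1)$ is disconnected and relatively compact in $\Omega$, and $\overline{B_{c_{\Omega}}(\zeta_{0};s_{2})} \subsetneq \overline{B}_{c_{\Omega}}(\zeta_{0};s_{2})$. (B) For every integer $n\ge 2$, $M=\Omega\times\mathbb{D}^{n-1}$ is a bounded pseudoconvex domain in $\mathbb{C}^n$ such that for some $0<r_{2}<r_{1}$ and $z_0\in M$: (i) $B_{c_{M}}(z_{0};r_{1})$ is disconnected and relatively compact in $M$; (ii) $\overline{B_{c_{M}}(z_{0};r_{2})} \subsetneq \overline{B}_{c_{M}}(z_{0};r_{2})$.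
   Context: A domain in $\mathbb{C}$ has connectivity $g+1$ if its complement in the extended complex plane has exactly $g+1$ connected components. $\mathbb{D}$ is the open unit disk. For a domain $G$ in $\mathbb{C}^m$ ($m\ge1$, $G\ne\mathbb{C}^m$) let $\mathcal{H}(G)$ be the set of holomorphic maps of $G$ into $\mathbb{D}$. The Möbius pseudodistance is $c^{*}_{G}(z,z_0)=\sup\{|f(z)|: f\in\mathcal{H}(G), f(z_0)=0\}$ and the Carathéodory pseudodistance is $c_{G}(z,z_0)=\tanh^{-1}(c^{*}_{G}(z,z_0))$. For $a\in G$ and $r>0$, $B_{c_{G}}(a;r)=\{z\in G: c_{G}(z,a)<r\}$ is the open ball and $\overline{B}_{c_{G}}(a;r)=\{z\in G: c_{G}(z,a)\le r\}$ is the closed ball, while $\overline{B_{c_{G}}(a;r)}$ denotes the closure of the open ball in $G$ with respect to the Euclidean topology of $G$. *)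

(* Defs.v *)
From HB Require Import structures.
From mathcomp Require Import all_boot all_order all_algebra.
From mathcomp Require Import complex.
From mathcomp Require Import all_classical all_reals all_analysis.
From mathcomp Require Import lra.

Set Implicit Arguments.
Unset Strict Implicit.
Unset Printing Implicit Defensive.

Import Order.TTheory GRing.Theory Num.Theory.
Import numFieldNormedType.Exports.

Local Open Scope complex_scope.
Local Open Scope classical_set_scope.
Local Open Scope ring_scope.

(* The complex plane is [R[i]], as a normed module over itself; its norm is
   [R[i]]-valued, so moduli are taken with [Normc.normc : R[i] -> R].
   C^n is ['rV[R[i]]_n]; its norm is the sup norm. *)
HB.instance Definition _ (R : realType) := NormedModule.copy R[i] R[i]^o.

Section Domains.
Context {R : realType} {V : normedModType R[i]}.
Implicit Types (G A : set V).

Definition is_domain G := [/\ open G, connected G & G !=set0].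

Definition closure_in G A : set V := closure A `&` G.

Definition relatively_compact_in G A := A `<=` G /\ compact (closure_in G A).

(* Only the values of [f] on [G] matter when [G] is open: [differentiable] is
   complex Frechet differentiability, which is local. *)
Definition holomorphic_on G (f : V -> R[i]) :=
  forall z, G z -> differentiable f z.

End Domains.

Section Caratheodory.
Context {R : realType} {V : normedModType R[i]}.
Implicit Types (G : set V) (z a : V) (r : R).

Definition holomorphic_to_disk G : set (V -> R[i]) :=
  [set f | holomorphic_on G f /\ forall z, G z -> Normc.normc (f z) < 1].

Definition mobius_pdist G z z0 : R :=
  sup [set Normc.normc (f z) | f in
        [set f | holomorphic_to_disk G f /\ f z0 = 0]].

Definition tanh (x : R) : R :=
  (expR x - expR (- x)) / (expR x + expR (- x)).

Definition artanh (x : R) : R := ln ((1 + x) / (1 - x)) / 2.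

(* On a domain [mobius_pdist] takes values in [0, 1[, so only the values of
   [artanh] on that interval are used. *)
Definition caratheodory_pdist G z z0 : R := artanh (mobius_pdist G z z0).

Definition open_cball G a r : set V :=
  [set z | G z /\ caratheodory_pdist G z a < r].

Definition closed_cball G a r : set V :=
  [set z | G z /\ caratheodory_pdist G z a <= r].

End Caratheodory.

Lemma artanhK (R : realType) (x : R) : -1 < x < 1 -> tanh (artanh x) = x.
Proof.
move=> /andP[x1 x2]; have d0 : 0 < 1 - x by rewrite subr_gt0.
have n0 : 0 < 1 + x by rewrite -(subrr 1) ltrD2l.
have q0 : 0 < (1 + x) / (1 - x) by rewrite divr_gt0.
have e0 := expR_gt0 (artanh x).
have e2 : expR (artanh x) ^+ 2 = (1 + x) / (1 - x).
  by rewrite -expRM_natl /artanh -mulr_natl mulrC divfK // lnK.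
have : expR (artanh x) ^+ 2 * (1 - x) = 1 + x by rewrite e2 divfK // gt_eqF.
rewrite /tanh expRN; set y := expR _ in e0 *; move=> E.
have y0 : y != 0 by rewrite gt_eqF.
have s0 : y + y^-1 != 0 by rewrite gt_eqF// addr_gt0// invr_gt0.
apply: (mulIf s0); rewrite divfK //.
apply: (mulIf y0); rewrite -mulrA !mulrDl mulNr mulVf // -expr2.
move: E; set w := y ^+ 2; lra.
Qed.

Section Connectivity.
Context {R : realType}.

Definition extended_complement (G : set R[i]) :
    set (one_point_compactification R[i]) := ~` (Some @` G).

Definition has_connectivity (G : set R[i]) (k : nat) :=
  ([set connected_component (extended_complement G) x
      | x in extended_complement G] #= `I_k)%card.

Definition unit_disk : set R[i] := [set z | Normc.normc z < 1].

(* G x D^(n-1) as a subset of C^n, for [0 < n]. *)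
Definition prod_polydisk (G : set R[i]) (n : nat) : set 'rV[R[i]]_n :=
  [set z | forall i : 'I_n,
     if i == 0%N :> nat then G (z ord0 i) else unit_disk (z ord0 i)].

End Connectivity.

Arguments prod_polydisk {R} G n _.

Section Pseudoconvexity.
Context {R : realType} {V : normedModType R[i]}.
Implicit Types (G : set V).

Definition upper_semicontinuous_on G (u : V -> \bar R) :=
  forall z, G z -> forall c : R, (u z < c%:E)%E ->
    \forall w \near z, (u w < c%:E)%E.

Definition circle_mean (u : V -> \bar R) (a b : V) : \bar R :=
  ((2 * pi)^-1%:E *
   \int[@lebesgue_measure R]_(t in `[0%R, (2 * pi)%R])
      u (a + (cos t +i* sin t)%C *: b)%R)%E.

Definition plurisubharmonic G (u : V -> \bar R) :=
  [/\ forall z, G z -> (u z < +oo)%E,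
      upper_semicontinuous_on G u &
      forall a b : V,
        (forall l : R[i], Normc.normc l <= 1 -> G (a + l *: b)) ->
        (u a <= circle_mean u a b)%E].

Definition pseudoconvex G :=
  exists u : V -> R,
    [/\ {within G, continuous u},
        plurisubharmonic G (EFin \o u) &
        forall c : R, relatively_compact_in G [set z | G z /\ u z < c]].

End Pseudoconvexity.

(* Main.v *)
Require Import Defs.
From mathcomp Require Import all_boot all_order all_algebra.
From mathcomp Require Import complex.
From mathcomp Require Import all_classical all_reals all_analysis.
From mathcomp Require Import ring lra.
Set Implicit Arguments.
Unset Strict Implicit.
Unset Printing Implicit Defensive.
Import Order.TTheory GRing.Theory Num.Theory.
Import numFieldNormedType.Exports.
Local Open Scope complex_scope.
Local Open Scope classical_set_scope.
Local Open Scope ring_scope.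

(** Why the theorem holds. The domain is a disc about the base point [0], of radius of the
    order of [1 / sigma] for a small [sigma], from which [g] small round holes are removed.
    For such a domain the Moebius pseudodistance to [0] is very nearly explicit: it is
    [sigma] times the potential
      [nc w * (21 / 2 + 1 / nc (w - a0) + 1 / nc (w - a1))],
    where [a0] and [a1], equal to [16 + i] and [16 - i], are the centres of the two main
    holes; the other [g - 2] holes are so small that their effect is negligible. For the
    upper bound, a competing function is a sum of Cauchy integrals over the outer circle
    and over circles around the holes ([cauchy_holes]); subtracting the values at [0]
    bounds each of them by the radius divided by two distances ([bounded_holo_estimate]).
    For the lower bound, one multiplies [z] by a sum of simple fractions whose phases are
    adapted to [w] ([mobius_potential]).

    The potential has a well at [17], just to the right of the two main holes: to the left
    both holes are closer, upwards and downwards one of them is, and to the right the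
    factor [nc w] makes it increase again. At [17] the pseudodistance is less than
    [202.57 * sigma] ([mobius_centre]) while on the rim of a unit square around [17] it is
    at least a level of about [202.64 * sigma] ([mobius_rim]). So the ball whose radius
    corresponds to the rim has a part inside the square and a part around [0], with nothing
    between. If [m] is the minimum over the square, a minimum point lies in the closed ball
    of level [m], but the open ball of level [m] does not meet the square; this is the gap
    between the closed ball and the closure of the open one ([well_balls]). Both balls stay
    in a compact subset, by testing with [z / Rout] and with the inverses of [z - a].

    For the product with a polydisc, projecting to a coordinate shows that the
    pseudodistance to [0] dominates that of the first coordinate and the moduli of the
    others, and restricting functions to the slice through [0] gives the reverse inequality
    there. Hence the same two levels work ([polydisk_balls]). The product is pseudoconvex
    because finitely many holomorphic functions [g_k] describe it by [nc (g_k z) < 1], and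
    the sum of the [1 / (1 - nc (g_k z))] is a continuous plurisubharmonic exhaustion
    ([exhaustion_pseudoconvex]).

    Two general facts underlie this. Cauchy's formula for merely differentiable functions
    comes from Goursat's bisection, carried out in polar coordinates, where an annulus is a
    rectangle ([circle_int_eq]). And the pseudodistance is less than [1] on every domain
    ([mobius_lt1]), so that balls for the hyperbolic arctangent of it are its sublevel
    sets. *)

(** * Moduli and continuity of complex-valued maps *)

Notation nc := Normc.normc.

Section Modulus.
Context {R : realType}.
Implicit Types (z w : R[i]) (x y e : R).

Lemma normr_nc z : `|z| = (nc z)%:C. Proof. by []. Qed.

Lemma nc_ge0 z : 0 <= nc z.
Proof. by case: z => x y; rewrite /Normc.normc sqrtr_ge0. Qed.

Lemma ncD z w : nc (z + w) <= nc z + nc w.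
Proof. exact: le_normcD. Qed.

Lemma ncB z w : nc (z - w) <= nc z + nc w.
Proof. by rewrite -(normcN w) ncD. Qed.

Lemma ncBC z w : nc (z - w) = nc (w - z).
Proof. by rewrite -normcN opprB. Qed.

Lemma nc_distD c z w : nc (z - w) <= nc (z - c) + nc (c - w).
Proof. by have := ncD (z - c) (c - w); rewrite addrA subrK. Qed.

Lemma nc_sub_le z w : nc z - nc w <= nc (z - w).
Proof. by rewrite lerBlDr; have := ncD (z - w) w; rewrite subrK. Qed.

Lemma nc_gt0 z : (0 < nc z) = (z != 0).
Proof.
rewrite lt_neqAle nc_ge0 andbT eq_sym; apply/idP/idP; apply: contra => /eqP.
  by move=> ->; rewrite Normc.normc0.
by move/Normc.eq0_normc => ->.
Qed.

Lemma nc_real x : nc x%:C = `|x|.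
Proof. by rewrite /Normc.normc /= expr0n /= addr0 sqrtr_sqr. Qed.

Lemma ncX z n : nc (z ^+ n) = nc z ^+ n.
Proof. by elim: n => [|n ih]; rewrite ?Normc.normc1 // !exprS Normc.normcM ih. Qed.

Lemma nc_sqr z : nc z ^+ 2 = complex.Re z ^+ 2 + complex.Im z ^+ 2.
Proof. by case: z => x y; rewrite /= sqr_sqrtr // addr_ge0 ?sqr_ge0. Qed.

Lemma Re_le_nc z : `|complex.Re z| <= nc z.
Proof.
rewrite -(ger0_norm (nc_ge0 z)) -ler_sqr ?nnegrE // !real_normK ?num_real //.
by rewrite nc_sqr lerDl sqr_ge0.
Qed.

Lemma Im_le_nc z : `|complex.Im z| <= nc z.
Proof.
rewrite -(ger0_norm (nc_ge0 z)) -ler_sqr ?nnegrE // !real_normK ?num_real //.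
by rewrite nc_sqr lerDr sqr_ge0.
Qed.

Lemma nc_le_ReIm z : nc z <= `|complex.Re z| + `|complex.Im z|.
Proof.
rewrite -ler_sqr ?nnegrE ?nc_ge0 ?addr_ge0 // nc_sqr sqrrD.
rewrite !real_normK ?num_real // addrAC lerDl mulrn_wge0 // mulr_ge0 //.
Qed.

Lemma nc_sum (I : Type) (r : seq I) (P : pred I) (F : I -> R[i]) :
  nc (\sum_(i <- r | P i) F i) <= \sum_(i <- r | P i) nc (F i).
Proof.
elim/big_ind2 : _ => //; first by rewrite Normc.normc0.
by move=> x1 x2 y1 y2 h h'; apply: le_trans (ncD _ _) (lerD h h').
Qed.

(** The norm of the plane is complex-valued, so its neighbourhoods come with complex
    radii; all the estimates below use real ones. *)
Lemma nbhs_ncP z (A : set R[i]) :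
  nbhs z A <-> exists2 e, 0 < e & forall w, nc (w - z) < e -> A w.
Proof.
split.
  move=> /nbhs_normP [e /= e0 eA].
  have [re ie] : 0 < complex.Re e /\ e = (complex.Re e)%:C.
    by move: e0; rewrite ltcE /= => /andP[/eqP i r]; split => //;
      case: e i {eA r} => a b /= ->.
  exists (complex.Re e) => // w wz; apply: eA => /=.
  by rewrite /ball_ /= distrC ie normr_nc ltcR.
move=> [e e0 eA]; apply/nbhs_normP; exists e%:C; first by rewrite /= ltcR.
move=> w /=; rewrite /ball_ /= distrC normr_nc ltcR; exact: eA.
Qed.

Lemma cvg_ncP (T : Type) (F : set_system T) {FF : Filter F} (f : T -> R[i]) z :
  f @ F --> z <-> forall e, 0 < e -> \forall t \near F, nc (f t - z) < e.
Proof.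
split=> [fz e e0|h A /nbhs_ncP[e e0 eA]].
  by apply: (fz [set w | nc (w - z) < e]); apply/nbhs_ncP; exists e.
by near=> t; apply: eA; near: t; exact: h.
Unshelve. all: by end_near. Qed.

Lemma nbhs_realP (P : R -> Prop) x :
  (\forall y \near x, P y) <-> exists2 e, 0 < e & forall y, `|y - x| < e -> P y.
Proof.
split.
  by move=> /nbhs_normP [e e0 h]; exists e => // y yx; apply: h => /=;
    rewrite /ball_ /= distrC.
move=> [e e0 h]; apply/nbhs_normP; exists e => // y; rewrite /ball_ /= distrC.
exact: h.
Qed.

Lemma continuous_Re : continuous (@complex.Re R).
Proof.
move=> z; apply/(@cvgrPdist_lt _ _ _ (nbhs z) (nbhs_filter z)) => e e0; near=> w.
have: nc (w - z) < e by near: w; apply/nbhs_ncP; exists e.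
apply: le_lt_trans; rewrite ncBC; apply: le_trans (Re_le_nc _).
by rewrite raddfB.
Unshelve. all: by end_near. Qed.

Lemma continuous_Im : continuous (@complex.Im R).
Proof.
move=> z; apply/(@cvgrPdist_lt _ _ _ (nbhs z) (nbhs_filter z)) => e e0; near=> w.
have: nc (w - z) < e by near: w; apply/nbhs_ncP; exists e.
apply: le_lt_trans; rewrite ncBC; apply: le_trans (Im_le_nc _).
by rewrite raddfB.
Unshelve. all: by end_near. Qed.

Lemma continuous_nc : continuous (@Normc.normc R).
Proof.
move=> z; apply/(@cvgrPdist_lt _ _ _ (nbhs z) (nbhs_filter z)) => e e0; near=> w.
have: nc (w - z) < e by near: w; apply/nbhs_ncP; exists e.
apply: le_lt_trans; rewrite ler_norml lerBlDr.
have := nc_sub_le w z; have := nc_sub_le z w; rewrite (ncBC z w); lra.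
Unshelve. all: by end_near. Qed.

Lemma cvg_complex (T : Type) (F : set_system T) {FF : Filter F}
    (f g : T -> R) x y :
  f @ F --> x -> g @ F --> y -> (fun t => f t +i* g t) @ F --> x +i* y.
Proof.
move=> /cvgrPdist_lt fx /cvgrPdist_lt gy; apply/cvg_ncP => e e0.
have e2 : 0 < e / 2 by rewrite divr_gt0.
near=> t; apply: le_lt_trans (nc_le_ReIm _) _ => /=.
rewrite (splitr e) ltrD // distrC; near: t; [exact: fx|exact: gy].
Unshelve. all: by end_near. Qed.

End Modulus.

(** Convergence of [F y] to [F x], in the form in which the estimates on real moduli
    produce and consume it; see [ccont_atP]. *)
Definition ccont_at (R : realType) (T : topologicalType) (F : T -> R[i]) (x : T) :=
  forall e, 0 < e -> \forall y \near x, nc (F y - F x) < e.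

Definition ccont (R : realType) (T : topologicalType) (F : T -> R[i]) :=
  forall x, ccont_at F x.

Section ComplexContinuity.
Context {R : realType} {T : topologicalType}.
Implicit Types (F G : T -> R[i]) (x : T).

Lemma ccont_atP F x : ccont_at F x <-> F @ x --> F x.
Proof. by split=> h; apply/cvg_ncP. Qed.

Lemma ccont_at_cst (k : R[i]) x : ccont_at (fun=> k) x.
Proof. by move=> e e0; near=> y; rewrite subrr Normc.normc0.
Unshelve. all: by end_near. Qed.

Lemma ccont_atD F G x : ccont_at F x -> ccont_at G x -> ccont_at (fun y => F y + G y) x.
Proof.
move=> cF cG e e0; have e2 : 0 < e / 2 by rewrite divr_gt0.
near=> y; rewrite opprD addrACA; apply: le_lt_trans (ncD _ _) _.
rewrite (splitr e) ltrD //; near: y; [exact: cF|exact: cG].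
Unshelve. all: by end_near. Qed.

Lemma ccont_atN F x : ccont_at F x -> ccont_at (fun y => - F y) x.
Proof.
move=> cF e e0; near=> y; rewrite -opprD normcN; near: y; exact: cF.
Unshelve. all: by end_near. Qed.

Lemma ccont_atM F G x : ccont_at F x -> ccont_at G x -> ccont_at (fun y => F y * G y) x.
Proof.
move=> cF cG e e0; set c := 1 + nc (F x) + nc (G x).
have c1 : 1 <= c by rewrite /c -addrA lerDl addr_ge0 ?nc_ge0.
have c0 : 0 < c by apply: lt_le_trans c1.
pose d := Num.min 1 (e / c).
have d0 : 0 < d by rewrite lt_min ltr01 divr_gt0.
have d1 : d <= 1 by rewrite ge_min lexx.
have de : d * c <= e by rewrite -ler_pdivlMr // ge_min lexx orbT.
near=> y; have Fy : nc (F y - F x) < d by near: y; exact: cF.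
have Gy : nc (G y - G x) < d by near: y; exact: cG.
have -> : F y * G y - F x * G x =
  (F y - F x) * (G y - G x) + (F y - F x) * G x + F x * (G y - G x) by ring.
apply: le_lt_trans (ncD _ _) _; apply: le_lt_trans (lerD (ncD _ _) (lexx _)) _.
rewrite !Normc.normcM; apply: lt_le_trans de.
have := nc_ge0 (F y - F x); have := nc_ge0 (G y - G x).
have := nc_ge0 (F x); have := nc_ge0 (G x); rewrite /c.
move=> b0 a0 w0 u0.
have -> : d * (1 + nc (F x) + nc (G x)) = d + d * nc (G x) + nc (F x) * d by ring.
rewrite ltr_leD ?ler_wpM2l ?(ltW Gy) // ltr_leD ?ler_wpM2r ?(ltW Fy) //.
by apply: le_lt_trans Fy; rewrite ler_piMr // (le_trans (ltW Gy)).
Unshelve. all: by end_near. Qed.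

Lemma ccont_atV F x : F x != 0 -> ccont_at F x -> ccont_at (fun y => (F y)^-1) x.
Proof.
move=> Fx cF e e0; have m0 : 0 < nc (F x) by rewrite nc_gt0.
set m := nc (F x) in m0 *.
pose d := Num.min (m / 2) (e * m ^+ 2 / 2).
have d0 : 0 < d by rewrite lt_min !divr_gt0 // mulr_gt0 // exprn_gt0.
near=> y; have: nc (F y - F x) < d by near: y; exact: cF.
rewrite lt_min => /andP[Fy1 Fy2].
have Fym : m / 2 < nc (F y).
  by have := nc_sub_le (F x) (F y); rewrite ncBC -/m; move: Fy1; lra.
have Fy0 : F y != 0 by rewrite -nc_gt0 (lt_trans _ Fym) // divr_gt0.
have -> : (F y)^-1 - (F x)^-1 = (F x - F y) * (F x)^-1 * (F y)^-1 by field; rewrite Fx Fy0.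
rewrite !Normc.normcM !Normc.normcV ncBC -/m ltr_pdivrMr ?nc_gt0 // ltr_pdivrMr //.
apply: lt_le_trans Fy2 _; move: (nc (F y)) Fym => u Fym.
have -> : e * m ^+ 2 / 2 = e * (m / 2) * m by ring.
by rewrite ler_pM2r // ler_pM2l // ltW.
Unshelve. all: by end_near. Qed.

Lemma ccont_at_complex (f g : T -> R) x : {for x, continuous f} -> {for x, continuous g} ->
  ccont_at (fun y => f y +i* g y) x.
Proof. by move=> cf cg; apply/ccont_atP; exact: cvg_complex. Qed.

Lemma ccont_at_Re F x : ccont_at F x -> {for x, continuous (fun y => complex.Re (F y))}.
Proof. move=> /ccont_atP cF; apply: continuous_comp => //; exact: continuous_Re. Qed.

Lemma ccont_at_Im F x : ccont_at F x -> {for x, continuous (fun y => complex.Im (F y))}.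
Proof. move=> /ccont_atP cF; apply: continuous_comp => //; exact: continuous_Im. Qed.

Lemma ccont_at_nc F x : ccont_at F x -> {for x, continuous (fun y => nc (F y))}.
Proof. move=> /ccont_atP cF; apply: continuous_comp => //; exact: continuous_nc. Qed.

End ComplexContinuity.

Lemma ccont_at_comp (R : realType) (S T : topologicalType) (h : S -> T) (F : T -> R[i]) x :
  {for x, continuous h} -> ccont_at F (h x) -> ccont_at (fun y => F (h y)) x.
Proof. by move=> ch /ccont_atP cF; apply/ccont_atP; exact: (continuous_comp ch cF). Qed.

Lemma ccont_at_ccomp (R : realType) (S : topologicalType) (h : S -> R[i]) (F : R[i] -> R[i]) x :
  ccont_at h x -> ccont_at F (h x) -> ccont_at (fun y => F (h y)) x.
Proof. by move=> /ccont_atP ch /ccont_atP cF; apply/ccont_atP; exact: (continuous_comp ch cF). Qed.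

(** * Integrals of complex-valued functions of a real variable *)

Section ComplexIntegral.
Context {R : realType}.
Implicit Types (F G : R -> R[i]) (a b t : R).
Local Notation mu := (@lebesgue_measure R).

Definition cint a b F : R[i] :=
  (\int[mu]_(t in `[a, b]) complex.Re (F t))%R +i*
  (\int[mu]_(t in `[a, b]) complex.Im (F t))%R.

Lemma continuous_int (f : R -> R) a b : continuous f ->
  mu.-integrable `[a, b] (EFin \o f).
Proof.
move=> cf; apply: continuous_compact_integrable; first exact: segment_compact.
exact: continuous_subspaceT.
Qed.

Lemma ccont_Re F : ccont F -> continuous (fun t => complex.Re (F t)).
Proof. by move=> cF t; apply: ccont_at_Re. Qed.

Lemma ccont_Im F : ccont F -> continuous (fun t => complex.Im (F t)).
Proof. by move=> cF t; apply: ccont_at_Im. Qed.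

Lemma eq_cint a b F G : (forall t, a <= t <= b -> F t = G t) -> cint a b F = cint a b G.
Proof.
move=> FG; rewrite /cint; congr Complex; apply: eq_Rintegral => t;
  by rewrite inE /= in_itv /= => h; rewrite FG.
Qed.

Lemma cint_cat b a c F : a <= b <= c -> ccont F ->
  cint a c F = cint a b F + cint b c F.
Proof.
move=> /andP[ab bc] cF; rewrite /cint [RHS]/GRing.add /=.
have h (f : R -> R) : continuous f ->
   \int[mu]_(t in `[a, c]) f t =
   \int[mu]_(t in `[a, b]) f t + \int[mu]_(t in `[b, c]) f t.
  move=> cf; rewrite -[X in _ = _ + X]Rintegral_itv_obnd_cbnd; last first.
    apply: integrableS (@continuous_int f b c cf) => //.
    by apply: subset_itvr; rewrite bnd_simp.
  rewrite -(Rintegral_itvB (x := b) (@continuous_int f a c cf)) ?bnd_simp //.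
  by rewrite addrC subrK.
by congr Complex; apply: h; [exact: ccont_Re|exact: ccont_Im].
Qed.

Lemma cintD a b F G : ccont F -> ccont G ->
  cint a b (fun t => F t + G t) = cint a b F + cint a b G.
Proof.
move=> cF cG; rewrite /cint /= [in RHS]/GRing.add /=.
congr Complex; (rewrite -RintegralD; last 3 first).
- by apply: measurable_itv.
- by apply: (@continuous_int (fun t => complex.Re (F t))); exact: ccont_Re.
- by apply: (@continuous_int (fun t => complex.Re (G t))); exact: ccont_Re.
- by apply: eq_Rintegral => t _; rewrite raddfD.
- by apply: measurable_itv.
- by apply: (@continuous_int (fun t => complex.Im (F t))); exact: ccont_Im.
- by apply: (@continuous_int (fun t => complex.Im (G t))); exact: ccont_Im.
- by apply: eq_Rintegral => t _; rewrite raddfD.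
Qed.

Lemma Rint_lin a b (f g : R -> R) (x y : R) : continuous f -> continuous g ->
  \int[mu]_(t in `[a, b]) (x * f t + y * g t) =
  x * \int[mu]_(t in `[a, b]) f t + y * \int[mu]_(t in `[a, b]) g t.
Proof.
move=> cf cg.
have cZ z (h : R -> R) : continuous h -> mu.-integrable `[a, b] (EFin \o (fun t => z * h t)).
  move=> ch; apply: continuous_int => t.
  by apply: cvgM; [exact: cvg_cst|exact: ch].
rewrite RintegralD; [|by apply: measurable_itv|exact: cZ|exact: cZ].
by rewrite !RintegralZl //; apply: continuous_int.
Qed.

Lemma cintZ a b k F : ccont F ->
  cint a b (fun t => k * F t) = k * cint a b F.
Proof.
move=> cF; rewrite /cint [in RHS]/GRing.mul /=; case: k => x y /=.
have cR := ccont_Re cF; have cI := ccont_Im cF.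
congr Complex.
  rewrite -mulNr -Rint_lin //.
  by apply: eq_Rintegral => t _; case: (F t) => u v /=; rewrite mulNr.
rewrite -Rint_lin //.
by apply: eq_Rintegral => t _; case: (F t).
Qed.

Lemma cintN a b F : ccont F -> cint a b (fun t => - F t) = - cint a b F.
Proof.
move=> cF; rewrite -mulN1r -cintZ //; apply: eq_cint => t _; by rewrite mulN1r.
Qed.

Lemma cintB a b F G : ccont F -> ccont G ->
  cint a b (fun t => F t - G t) = cint a b F - cint a b G.
Proof. move=> cF cG; rewrite cintD; [by rewrite cintN|exact: cF|move=> t; exact: ccont_atN (cG t)]. Qed.

Lemma rotate_to_real (c : R[i]) : exists2 e : R[i], nc e = 1 & e * c = (nc c)%:C.
Proof.
have [->|c0] := eqVneq c 0; first by exists 1; rewrite ?Normc.normc1 // mulr0 Normc.normc0.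
have n0 : 0 < nc c by rewrite nc_gt0.
exists (c^*%C / (nc c)%:C).
  rewrite Normc.normcM Normc.normcV nc_real ger0_norm ?nc_ge0 //.
  have -> : nc c^*%C = nc c by case: (c) => x y /=; rewrite sqrrN.
  by rewrite divff // gt_eqF.
have cc : c^*%C * c = (nc c ^+ 2)%:C.
  by rewrite nc_sqr; case: c {c0 n0} => x y /=; rewrite /GRing.mul /=; congr Complex; ring.
by rewrite mulrAC cc -fmorphV -rmorphM /= expr2 mulfK // gt_eqF.
Qed.

(** Rotating the integral onto the positive half-line turns its modulus into the
    real part of an integral, so the sharp constant survives. *)
Lemma nc_cint_le a b F M : a <= b -> ccont F ->
  (forall t, a <= t <= b -> nc (F t) <= M) -> nc (cint a b F) <= M * (b - a).
Proof.
move=> ab cF FM; have [k nk kz] := rotate_to_real (cint a b F).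
have -> : nc (cint a b F) = complex.Re (cint a b (fun t => k * F t)) by rewrite cintZ // kz.
rewrite /cint /=.
have -> : M * (b - a) = \int[mu]_(t in `[a, b]) M.
  rewrite Rintegral_cst //= lebesgue_measure_itv /= lte_fin.
  by case: ltP => [_ //|ba]; rewrite (@le_anti _ _ a b) ?ab ?subrr ?mulr0.
have ckF : ccont (fun t => k * F t).
  by move=> t; apply: ccont_atM; [exact: ccont_at_cst|exact: cF].
apply: le_Rintegral; [by apply: measurable_itv| | |].
  by apply: (@continuous_int (fun t => complex.Re (k * F t))); exact: ccont_Re.
  by apply: continuous_int => t; exact: cvg_cst.
move=> t /=; rewrite in_itv /= => tab; apply: le_trans (FM _ tab).
by apply: le_trans (ler_norm _) _; rewrite -[leRHS]mul1r -nk -Normc.normcM Re_le_nc.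
Qed.

Definition cder F t (d : R[i]) :=
  is_derive t 1 (fun s => complex.Re (F s)) (complex.Re d) /\
  is_derive t 1 (fun s => complex.Im (F s)) (complex.Im d).

Lemma cder_cst (k : R[i]) t : cder (fun=> k) t 0.
Proof. by split; apply: is_derive_cst. Qed.

Lemma cderD F G t d e : cder F t d -> cder G t e -> cder (fun s => F s + G s) t (d + e).
Proof.
move=> [F1 F2] [G1 G2]; split; rewrite raddfD /=.
  rewrite (_ : (fun s => _) = (fun s => complex.Re (F s)) \+ (fun s => complex.Re (G s))).
    exact: is_deriveD.
  by apply/funext => s; rewrite raddfD.
rewrite (_ : (fun s => _) = (fun s => complex.Im (F s)) \+ (fun s => complex.Im (G s))).
  exact: is_deriveD.
by apply/funext => s; rewrite raddfD.
Qed.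

Lemma Re_mul (z w : R[i]) : complex.Re (z * w) = complex.Re z * complex.Re w - complex.Im z * complex.Im w.
Proof. by case: z; case: w. Qed.

Lemma Im_mul (z w : R[i]) : complex.Im (z * w) = complex.Re z * complex.Im w + complex.Im z * complex.Re w.
Proof. by case: z; case: w. Qed.

Lemma cderM F G t d e : cder F t d -> cder G t e ->
  cder (fun s => F s * G s) t (d * G t + F t * e).
Proof.
move=> [F1 F2] [G1 G2]; split.
  under eq_fun do rewrite Re_mul; rewrite raddfD /= !Re_mul.
  apply: is_derive_eq; rewrite /GRing.scale /=; ring.
under eq_fun do rewrite Im_mul; rewrite raddfD /= !Im_mul.
apply: is_derive_eq; rewrite /GRing.scale /=; ring.
Qed.

Lemma cFTC F f a b : a <= b -> (forall t, cder F t (f t)) -> ccont f ->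
  cint a b f = F b - F a.
Proof.
rewrite le_eqVlt => /predU1P[<- _ _|ab dF cf].
  rewrite subrr /cint !set_itv1 !Rintegral_set1 //.
rewrite /cint; case EFb : (F b) => [xb yb]; case EFa : (F a) => [xa ya].
rewrite /GRing.add /=.
have h (p q : R -> R) : (forall t, is_derive t 1 q (p t)) -> continuous p ->
    \int[mu]_(t in `[a, b]) p t = q b - q a.
  move=> dq cp; rewrite /Rintegral (@continuous_FTC2 _ _ q) //.
  - exact: continuous_subspaceT.
  - have cq t : {for t, continuous q}.
      by apply/differentiable_continuous/derivable1_diffP; case: (dq t).
    split; first by move=> t _; case: (dq t).
      by apply: cvg_at_right_filter; exact: cq.
    by apply: cvg_at_left_filter; exact: cq.
  - by move=> t _; rewrite derive1E; case: (dq t).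
congr Complex.
  by rewrite (h _ _ (fun t => proj1 (dF t)) (ccont_Re cf)) EFb EFa.
by rewrite (h _ _ (fun t => proj2 (dF t)) (ccont_Im cf)) EFb EFa.
Qed.

End ComplexIntegral.

(** * Goursat's bisection *)

Section Bisection.
Context {R : realType}.
Implicit Types (u v x y : R).

Let rect := ((R * R) * (R * R))%type.
Let good (p q a b : R) (s : rect) :=
  [/\ p <= s.1.1, s.1.1 <= s.1.2, s.1.2 <= q &
   [/\ a <= s.2.1, s.2.1 <= s.2.2 & s.2.2 <= b]].
Let half (s s' : rect) :=
  [/\ s.1.1 <= s'.1.1, s'.1.2 <= s.1.2, s.2.1 <= s'.2.1, s'.2.2 <= s.2.2 &
   s'.1.2 - s'.1.1 = (s.1.2 - s.1.1) / 2 /\ s'.2.2 - s'.2.1 = (s.2.2 - s.2.1) / 2].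

Lemma nested_point (lo hi : nat -> R) :
  (forall n, lo n <= lo n.+1) -> (forall n, hi n.+1 <= hi n) ->
  (forall n, lo n <= hi n) -> exists x, forall n, lo n <= x <= hi n.
Proof.
move=> lo1 hi1 lohi.
have lom := homo_leq (@lexx _ _) (@le_trans _ _) lo1.
have him m n : (m <= n)%N -> hi n <= hi m.
  by elim: n => [|n ih]; [rewrite leqn0 => /eqP ->|rewrite leq_eqVlt => /predU1P[->//|/ih];
    exact: le_trans].
have lh m n : lo m <= hi n.
  apply: le_trans (lom _ _ (leq_maxl m n)) _.
  exact: le_trans (lohi _) (him _ _ (leq_maxr m n)).
exists (sup (range lo)) => n; apply/andP; split.
  apply: ub_le_sup; last by exists n.
  by exists (hi 0%N) => _ [m _ <-].
apply: ge_sup; first by exists (lo 0%N); exists 0%N.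
by move=> _ [m _ <-].
Qed.

(** Goursat's subdivision argument, separated from complex analysis: an additive
    function of rectangles that is small to second order around each point is zero. *)
Lemma additive_rect_eq0 (I : R -> R -> R -> R -> R[i]) (p q a b : R) :
  p <= q -> a <= b ->
  (forall u m u' v v', p <= u <= m -> m <= u' <= q -> a <= v <= v' -> v' <= b ->
     I u u' v v' = I u m v v' + I m u' v v') ->
  (forall u u' v m v', p <= u <= u' -> u' <= q -> a <= v <= m -> m <= v' <= b ->
     I u u' v v' = I u u' v m + I u u' m v') ->
  (forall x y e, p <= x <= q -> a <= y <= b -> 0 < e ->
     exists2 d, 0 < d & forall u u' v v', p <= u <= x -> x <= u' <= q ->
       a <= v <= y -> y <= v' <= b -> u' - u < d -> v' - v < d ->
       nc (I u u' v v') <= e * ((u' - u) + (v' - v)) ^+ 2) ->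
  I p q a b = 0.
Proof.
move=> pq ab addu addv small; apply: Normc.eq0_normc; apply/eqP.
rewrite eq_le nc_ge0 andbT leNgt; apply/negP => I0.
pose J (s : rect) := nc (I s.1.1 s.1.2 s.2.1 s.2.2).
pose step (s s' : rect) := good p q a b s ->
  [/\ good p q a b s', half s s' & J s / 4 <= J s'].
have stepP (s : rect) : {s' | step s s'}.
  apply: cid; case: (pselect (good p q a b s)) => [g|]; last by exists s.
  case: s g => [[u u'] [v v']] [/= pu uu' u'q [av vv' v'b]].
  pose m := (u + u') / 2; pose n := (v + v') / 2.
  have [um mu'] : u <= m /\ m <= u' by rewrite /m; split; lra.
  have [vn nv'] : v <= n /\ n <= v' by rewrite /n; split; lra.
  have hu1 : m - u = (u' - u) / 2 by rewrite /m; lra.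
  have hu2 : u' - m = (u' - u) / 2 by rewrite /m; lra.
  have hv1 : n - v = (v' - v) / 2 by rewrite /n; lra.
  have hv2 : v' - n = (v' - v) / 2 by rewrite /n; lra.
  have am : a <= n by lra. have nb : n <= b by lra.
  have pm : p <= m by lra. have mq : m <= q by lra.
  have E : I u u' v v' = I u m v n + I u m n v' + (I m u' v n + I m u' n v').
    rewrite (addu u m u') ?pu ?um ?mu' ?av //.
    by rewrite (addv u m v n v') ?(addv m u' v n v') ?pu ?um ?mu' ?pm ?mq ?av ?vn ?nv' ?u'q ?v'b.
  have [h|h1] := leP (nc (I u u' v v') / 4) (nc (I u m v n)).
    exists ((u, m), (v, n)) => _; split => //=; by repeat split => /=; lra.
  have [h|h2] := leP (nc (I u u' v v') / 4) (nc (I u m n v')).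
    exists ((u, m), (n, v')) => _; split => //=; by repeat split => /=; lra.
  have [h|h3] := leP (nc (I u u' v v') / 4) (nc (I m u' v n)).
    exists ((m, u'), (v, n)) => _; split => //=; by repeat split => /=; lra.
  have [h|h4] := leP (nc (I u u' v v') / 4) (nc (I m u' n v')).
    exists ((m, u'), (n, v')) => _; split => //=; by repeat split => /=; lra.
  exfalso; have : nc (I u u' v v') <= nc (I u m v n) + nc (I u m n v') +
      (nc (I m u' v n) + nc (I m u' n v')).
    rewrite E; apply: le_trans (ncD _ _) _.
    by rewrite lerD // ncD.
  move: h1 h2 h3 h4; lra.
pose S n := iter n (fun s => sval (stepP s)) ((p, q), (a, b)).
have S0 : S 0%N = ((p, q), (a, b)) by [].
have SS n : step (S n) (S n.+1) by rewrite /S iterS; case: (stepP _).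
have Sg n : good p q a b (S n).
  elim: n => [|n ih]; last by have [] := SS n ih.
  by rewrite S0; do !split.
have Sh n : half (S n) (S n.+1) by have [] := SS n (Sg n).
have SJ n : J (S 0%N) / 4 ^+ n <= J (S n).
  elim: n => [|n ih]; first by rewrite expr0 divr1.
  have [_ _] := SS n (Sg n); apply: le_trans.
  rewrite exprSr invfM mulrA ler_pM2r // invr_gt0 //; exact: ltr0n.
have Sw n : (S n).1.2 - (S n).1.1 = (q - p) / 2 ^+ n /\
            (S n).2.2 - (S n).2.1 = (b - a) / 2 ^+ n.
  elim: n => [|n [ih1 ih2]]; first by rewrite S0 /= expr0 !divr1.
  have [_ _ _ _ [-> ->]] := Sh n; rewrite ih1 ih2 exprSr invfM !mulrA; split=> //.
have [x hx] := @nested_point (fun n => (S n).1.1) (fun n => (S n).1.2)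
  (fun n => let: And5 h _ _ _ _ := Sh n in h) (fun n => let: And5 _ h _ _ _ := Sh n in h)
  (fun n => let: And4 _ h _ _ := Sg n in h).
have [y hy] := @nested_point (fun n => (S n).2.1) (fun n => (S n).2.2)
  (fun n => let: And5 _ _ h _ _ := Sh n in h) (fun n => let: And5 _ _ _ h _ := Sh n in h)
  (fun n => let: And4 _ _ _ (And3 _ h _) := Sg n in h).
(* A nonzero value would leave at least [nc (I p q a b) / 4 ^ n] on a rectangle of size
   [w / 2 ^ n]; this [e] is too small for that. *)
pose w := (q - p) + (b - a); have w0 : 0 <= w by rewrite /w; lra.
pose e := nc (I p q a b) / (2 * (w ^+ 2 + 1)).
have w1 : 0 < w ^+ 2 + 1 by rewrite ltr_wpDl ?sqr_ge0.
have e0 : 0 < e by rewrite divr_gt0 // mulr_gt0.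
have [||d d0 hd] := small x y e _ _ e0.
- by have := hx 0%N; rewrite S0.
- by have := hy 0%N; rewrite S0.
have [n wn] : exists n, w / 2 ^+ n < d.
  have : (fun n => w / 2 ^+ n) @ \oo --> (0 : R).
    by have := @cvg_geometric R w 2^-1; rewrite /geometric /=;
      under eq_fun do rewrite exprVn; apply; rewrite ger0_norm ?invf_lt1 ?ltr1n.
  move=> /cvgrPdist_lt /(_ d d0) [N _ /(_ N (leqnn N))] /=.
  by rewrite sub0r normrN ger0_norm ?divr_ge0 ?exprn_ge0 // => h; exists N.
have [w1n w2n] := Sw n; have [/= g1 g2 g3 [g4 g5 g6]] := Sg n.
have /andP[hx1 hx2] := hx n; have /andP[hy1 hy2] := hy n.
have p2 : 0 < 2 ^+ n :> R by rewrite exprn_gt0.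
have wu : (q - p) / 2 ^+ n < d by apply: le_lt_trans wn; rewrite ler_pM2r ?invr_gt0 // /w; lra.
have wv : (b - a) / 2 ^+ n < d by apply: le_lt_trans wn; rewrite ler_pM2r ?invr_gt0 // /w; lra.
have := hd (S n).1.1 (S n).1.2 (S n).2.1 (S n).2.2.
rewrite g1 hx1 hx2 g3 g4 hy1 hy2 g6 w1n w2n => /(_ isT isT isT isT wu wv).
rewrite -mulrDl -/w -/(J (S n)) => hJ.
have := le_trans (SJ n) hJ; rewrite S0 /J /= expr_div_n -exprM mulnC exprM.
have -> : 2 ^+ 2 = 4 :> R by ring.
rewrite mulrA ler_pM2r ?invr_gt0 ?exprn_gt0 //; apply/negP; rewrite -ltNge.
rewrite /e mulrAC ltr_pdivrMr ?mulr_gt0 // ltr_pM2l //.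
by have := sqr_ge0 w; lra.
Qed.

End Bisection.

(** * Cauchy's theorem on annuli *)

(** Only pointwise differentiability, as in the Frechet derivative: continuity of the
    derivative has to come out of Cauchy's theorem, not go into it. *)
Definition holo_at (R : realType) (f : R[i] -> R[i]) (z : R[i]) :=
  exists D, forall e, 0 < e -> exists2 d, 0 < d &
    forall w, nc (w - z) < d -> nc (f w - f z - D * (w - z)) <= e * nc (w - z).

Section Polar.
Context {R : realType}.
Implicit Types (c z : R[i]) (r s t : R).

Lemma holo_at_ccont (f : R[i] -> R[i]) z : holo_at f z -> ccont_at f z.
Proof.
move=> [D hD] e e0; have [d d0 hd] := hD 1 ltr01.
pose k := nc D + 1; have k0 : 0 < k by rewrite ltr_wpDl ?nc_ge0.
apply/nbhs_ncP; exists (Num.min d (e / k)); first by rewrite lt_min d0 divr_gt0.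
move=> w; rewrite lt_min => /andP[/hd h]; rewrite ltr_pdivlMr // => wz.
rewrite -(subrK (D * (w - z)) (f w - f z)); apply: le_lt_trans (ncD _ _) _.
have E : nc (w - z) * k = nc (w - z) + nc D * nc (w - z) by rewrite /k; ring.
by apply: le_lt_trans wz; rewrite E Normc.normcM lerD2r -[leRHS]mul1r.
Qed.

Definition cis t : R[i] := cos t +i* sin t.

Definition circ c r t : R[i] := c + r%:C * cis t.

Lemma nc_cis t : nc (cis t) = 1.
Proof. by rewrite /Normc.normc /cis cos2Dsin2 sqrtr1. Qed.

Lemma cis0 : cis 0 = 1.
Proof. by rewrite /cis cos0 sin0. Qed.

Lemma cis2pi : cis (2 * pi) = 1.
Proof. have -> : 2 * pi = pi *+ 2 :> R by rewrite mulr_natl.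
by rewrite /cis cos2pi sin2pi. Qed.

Lemma ccont_cis : ccont cis.
Proof. by move=> t; apply: ccont_at_complex; [exact: continuous_cos|exact: continuous_sin]. Qed.

Lemma cder_cis t : cder cis t ('i * cis t).
Proof.
split => /=; rewrite ?mul0r ?mul1r ?add0r ?sub0r ?addr0; [exact: is_derive_cos|exact: is_derive_sin].
Qed.

Lemma cis_dist s t : nc (cis s - cis t) <= `|s - t|.
Proof.
wlog ts : s t / t <= s => [h|].
  by have [/h//|/ltW/h] := leP t s; rewrite ncBC distrC.
have ci : ccont (fun u => 'i * cis u).
  by move=> u; apply: ccont_atM; [exact: ccont_at_cst|exact: ccont_cis].
rewrite -(@cFTC _ cis (fun u => 'i * cis u)) //; last exact: cder_cis.
rewrite (ger0_norm (x := s - t)) ?subr_ge0 // -[leRHS]mul1r; apply: nc_cint_le => // u _.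
by rewrite Normc.normcM nc_cis mulr1 /Normc.normc /= expr0n expr1n add0r sqrtr1.
Qed.

Lemma nc_circ c r t : 0 <= r -> nc (circ c r t - c) = r.
Proof. by move=> r0; rewrite /circ addrAC subrr add0r Normc.normcM nc_cis nc_real mulr1 ger0_norm. Qed.

Lemma circ_dist c r s t u : 0 <= s -> nc (circ c r t - circ c s u) <= `|r - s| + s * `|t - u|.
Proof.
move=> s0; have -> : circ c r t - circ c s u = (r - s)%:C * cis t + s%:C * (cis t - cis u).
  by rewrite /circ rmorphB /=; ring.
apply: le_trans (ncD _ _) _; rewrite !Normc.normcM nc_cis !nc_real mulr1 (ger0_norm s0).
by rewrite lerD2l ler_wpM2l // cis_dist.
Qed.

Lemma ccont_circ c r : ccont (circ c r).
Proof.
move=> t; apply: ccont_atD; first exact: ccont_at_cst.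
by apply: ccont_atM; [exact: ccont_at_cst|exact: ccont_cis].
Qed.

Lemma continuous_id_R : continuous (@id R). Proof. by move=> x. Qed.

Lemma ccont_real : ccont (fun r : R => r%:C).
Proof.
move=> r; apply: (@ccont_at_complex _ _ id (fun=> 0)); first exact: continuous_id_R.
exact: cvg_cst.
Qed.

Lemma ccont_circ_r c t : ccont (fun r => circ c r t).
Proof.
move=> r; apply: ccont_atD; first exact: ccont_at_cst.
by apply: ccont_atM; [exact: ccont_real|exact: ccont_at_cst].
Qed.

(** Integral of [Gam] dz along the boundary of a polar rectangle, where
    [Gam r t] stands for the value at radius [r] and angle [t]. *)
Definition polar_int (Gam : R -> R -> R[i]) u u' v v' : R[i] :=
  cint v v' (fun t => Gam u' t * (u'%:C * ('i * cis t))) -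
  cint v v' (fun t => Gam u t * (u%:C * ('i * cis t))) -
  cint u u' (fun r => Gam r v' * cis v') + cint u u' (fun r => Gam r v * cis v).

(** Separate continuity is enough for the integrals along the four sides. *)
Definition sep_cont (Gam : R -> R -> R[i]) :=
  (forall r, ccont (Gam r)) /\ (forall t, ccont (Gam^~ t)).

Lemma ccont_ang Gam u : sep_cont Gam -> ccont (fun t => Gam u t * (u%:C * ('i * cis t))).
Proof.
move=> [h _] t; apply: ccont_atM; first exact: h.
do 2!(apply: ccont_atM; first exact: ccont_at_cst); exact: ccont_cis.
Qed.

Lemma ccont_rad Gam v : sep_cont Gam -> ccont (fun r => Gam r v * cis v).
Proof. by move=> [_ h] t; apply: ccont_atM; [exact: h|exact: ccont_at_cst]. Qed.

Lemma polar_int_catu Gam u m u' v v' : sep_cont Gam -> u <= m <= u' ->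
  polar_int Gam u u' v v' = polar_int Gam u m v v' + polar_int Gam m u' v v'.
Proof.
move=> cG um; rewrite /polar_int !(cint_cat um); [ring| |]; exact: ccont_rad.
Qed.

Lemma polar_int_catv Gam u u' v m v' : sep_cont Gam -> v <= m <= v' ->
  polar_int Gam u u' v v' = polar_int Gam u u' v m + polar_int Gam u u' m v'.
Proof.
move=> cG um; rewrite /polar_int !(cint_cat um); [ring| |]; exact: ccont_ang.
Qed.

Lemma polar_intB Gam Del u u' v v' : sep_cont Gam -> sep_cont Del ->
  polar_int (fun r t => Gam r t - Del r t) u u' v v' =
  polar_int Gam u u' v v' - polar_int Del u u' v v'.
Proof.
move=> cG cD; rewrite /polar_int.
have E (F G K : R -> R[i]) a b : ccont (fun t => F t * K t) -> ccont (fun t => G t * K t) ->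
    cint a b (fun t => (F t - G t) * K t) =
    cint a b (fun t => F t * K t) - cint a b (fun t => G t * K t).
  move=> cF cGG; rewrite -cintB //; apply: eq_cint => t _; ring.
have /= -> := E _ _ _ v v' (ccont_ang u' cG) (ccont_ang u' cD).
have /= -> := E _ _ _ v v' (ccont_ang u cG) (ccont_ang u cD).
have /= -> := E (Gam^~ v) (Del^~ v) (fun=> cis v) u u' (ccont_rad v cG) (ccont_rad v cD).
have /= -> := E (Gam^~ v') (Del^~ v') (fun=> cis v') u u' (ccont_rad v' cG) (ccont_rad v' cD).
by ring.
Qed.

Lemma nc_i : nc ('i : R[i]) = 1.
Proof. by rewrite /Normc.normc /= expr0n expr1n add0r sqrtr1. Qed.

Lemma polar_int_bound Gam u u' v v' q M : sep_cont Gam -> 0 <= u <= u' -> u' <= q -> v <= v' ->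
  (forall r t, u <= r <= u' -> v <= t <= v' -> nc (Gam r t) <= M) ->
  nc (polar_int Gam u u' v v') <= M * (1 + q) * 2 * ((u' - u) + (v' - v)).
Proof.
move=> cG /andP[u0 uu'] u'q vv' GM; have M0 : 0 <= M.
  by apply: le_trans (GM u v _ _); rewrite ?nc_ge0 ?lexx ?uu' ?vv'.
have q0 : 0 <= q by lra.
have hang x : u <= x <= u' -> nc (cint v v' (fun t => Gam x t * (x%:C * ('i * cis t)))) <= M * q * (v' - v).
  move=> hx; apply: nc_cint_le => //; first exact: ccont_ang.
  move=> t ht; rewrite !Normc.normcM nc_i nc_cis !mulr1 nc_real.
  by apply: ler_pM; rewrite ?nc_ge0 ?GM // ger0_norm; lra.
have hole_rad x : v <= x <= v' -> nc (cint u u' (fun r => Gam r x * cis x)) <= M * (u' - u).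
  move=> hx; apply: nc_cint_le => //; first exact: ccont_rad.
  by move=> t ht; rewrite !Normc.normcM nc_cis !mulr1 GM.
have h1 : nc (polar_int Gam u u' v v') <= M * q * (v' - v) + M * q * (v' - v) + M * (u' - u) + M * (u' - u).
  apply: le_trans (ncD _ _) _; apply: lerD; last by rewrite hole_rad // lexx vv'.
  apply: le_trans (ncB _ _) _; apply: lerD; last by rewrite hole_rad // lexx vv'.
  apply: le_trans (ncB _ _) _; apply: lerD; by rewrite hang // lexx uu'.
apply: le_trans h1 _.
have : 0 <= M * (v' - v) by rewrite mulr_ge0 // subr_ge0.
have : 0 <= M * q * (u' - u) by rewrite !mulr_ge0 // subr_ge0.
lra.
Qed.

Lemma cder_real r : cder (fun r : R => r%:C) r 1.
Proof. by split; [apply: is_derive_id|apply: is_derive_cst]. Qed.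

Lemma cder_eq (F : R -> R[i]) t d e : cder F t d -> d = e -> cder F t e.
Proof. by move=> h <-. Qed.

(** An affine function has a primitive, so the boundary terms telescope. *)
Lemma polar_int_affine c (al be : R[i]) u u' v v' : u <= u' -> v <= v' ->
  polar_int (fun r t => al + be * circ c r t) u u' v v' = 0.
Proof.
move=> uu' vv'; pose P z := z * (al + be * (z * 2^-1%:C)) : R[i].
have two : (2^-1%:C + 2^-1%:C) = 1 :> R[i].
  have h : 2^-1 + 2^-1 = 1 :> R by lra.
  by rewrite -rmorphD /= h.
have dP (F : R -> R[i]) t d : cder F t d -> cder (fun s => P (F s)) t ((al + be * F t) * d).
  move=> dF; have dF2 : cder (fun s => al + be * (F s * 2^-1%:C)) t (be * (d * 2^-1%:C)).
    apply: cder_eq; first apply: cderD (cder_cst _ _) (cderM (cder_cst _ _) (cderM dF (cder_cst _ _))).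
    by rewrite /=; ring.
  apply: cder_eq (cderM dF dF2) _ => /=.
  rewrite -[X in _ = (al + be * X) * d]mulr1 -two; ring.
have dang u0 t : cder (circ c u0) t (u0%:C * ('i * cis t)).
  apply: cder_eq; first apply: cderD (cder_cst _ _) (cderM (cder_cst _ _) (cder_cis t)); rewrite /=; ring.
have drad t0 r : cder (fun r => circ c r t0) r (cis t0).
  apply: cder_eq; first apply: cderD (cder_cst _ _) (cderM (cder_real r) (cder_cst _ _)); rewrite /=; ring.
have sc : sep_cont (fun r t => al + be * circ c r t).
  split=> x y; (apply: ccont_atD; first exact: ccont_at_cst);
    (apply: ccont_atM; first exact: ccont_at_cst); [exact: ccont_circ|exact: ccont_circ_r].
rewrite /polar_int.
have EA x : cint v v' (fun t => (al + be * circ c x t) * (x%:C * ('i * cis t))) =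
    P (circ c x v') - P (circ c x v).
  rewrite (@cFTC _ (fun t => P (circ c x t))) // => [t|]; first exact: dP.
  exact: (ccont_ang x sc).
have EB x : cint u u' (fun r => (al + be * circ c r x) * cis x) =
    P (circ c u' x) - P (circ c u x).
  rewrite (@cFTC _ (fun r => P (circ c r x))) // => [t|].
    by apply: (dP (fun r => circ c r x)).
  exact: (ccont_rad x sc).
by rewrite !EA !EB; ring.
Qed.

(** Clamping the radius extends an integrand on an annulus to all radii, keeping it continuous. *)
Definition clamp p q r := Num.max p (Num.min q r).

Lemma clamp_id p q r : p <= r <= q -> clamp p q r = r.
Proof. by move=> /andP[pr rq]; rewrite /clamp min_r // max_r. Qed.

Lemma clamp_itv p q r : p <= q -> p <= clamp p q r <= q.
Proof. by move=> pq; rewrite /clamp le_max lexx ge_max pq ge_min lexx. Qed.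

Lemma clamp_continuous p q : continuous (clamp p q).
Proof.
move=> r; apply: (@continuous_comp _ _ _ (Num.min q) (Num.max p)).
  by apply: continuous_min; [exact: cvg_cst|exact: continuous_id_R].
by apply: continuous_max; [exact: cvg_cst|exact: continuous_id_R].
Qed.

(** Up to the factor [i], the contour integral of [G] over the circle. *)
Definition circle_int (G : R[i] -> R[i]) c r : R[i] :=
  cint 0 (2 * pi) (fun t => G (circ c r t) * (r%:C * cis t)).

Lemma pi2_ge0 : 0 <= 2 * pi :> R.
Proof. by rewrite mulr_ge0 // pi_ge0. Qed.

(** Cauchy's theorem. In polar coordinates the annulus is a rectangle whose two radial
    sides cancel by periodicity. Near a point [G] is affine up to an error small
    compared with the size of the rectangle, and the affine part integrates to zero; so
    the boundary integral is small to second order, and the bisection argument applies. *)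
Lemma circle_int_eq (G : R[i] -> R[i]) c p q : 0 <= p <= q ->
  (forall z, p <= nc (z - c) <= q -> holo_at G z) ->
  circle_int G c p = circle_int G c q.
Proof.
move=> /andP[p0 pq] hG; have q0 : 0 <= q by lra.
pose Gam r t := G (circ c (clamp p q r) t).
have inA r t : p <= nc (circ c (clamp p q r) t - c) <= q.
  have := clamp_itv r pq => /andP[h1 h2]; rewrite nc_circ ?h1 ?h2 //; lra.
have scG : sep_cont Gam.
  split=> [r t|t r].
    by apply: (ccont_at_ccomp (h := circ c _)); [exact: ccont_circ|exact/holo_at_ccont/hG].
  apply: (ccont_at_ccomp (h := fun r => circ c (clamp p q r) t)); last exact/holo_at_ccont/hG.
  apply: (ccont_at_comp (h := clamp p q) (F := fun r => circ c r t)); first exact: clamp_continuous.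
  exact: ccont_circ_r.
have I0 : polar_int Gam p q 0 (2 * pi) = 0.
  apply: (@additive_rect_eq0 _ (polar_int Gam)); rewrite ?pi2_ge0 //.
  - move=> u m u' v v' /andP[_ um] /andP[mu' _] _ _; apply: polar_int_catu => //.
    by rewrite um mu'.
  - move=> u u' v m v' _ _ /andP[_ um] /andP[mu' _]; apply: polar_int_catv => //.
    by rewrite um mu'.
  move=> x y e xpq yab e0.
  pose zs := circ c x y; have [D hD] : holo_at G zs.
    by have := inA x y; rewrite clamp_id // => /hG.
  pose k := 1 + q; have k0 : 0 < k by rewrite ltr_wpDr.
  have e'0 : 0 < e / (k ^+ 2 * 2) by rewrite divr_gt0 // mulr_gt0 // exprn_gt0.
  have [d d0 hd] := hD _ e'0.
  exists (d / (2 * k)); first by rewrite divr_gt0 // mulr_gt0.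
  move=> u u' v v' /andP[pu ux] /andP[xu' u'q] /andP[av vy] /andP[yv' v'b] du dv.
  have uu' : u <= u' by lra. have vv' : v <= v' by lra.
  pose w := (u' - u) + (v' - v).
  have wd : k * w < d.
    have : w < d / (2 * k) + d / (2 * k) by rewrite /w; lra.
    have -> : d / (2 * k) + d / (2 * k) = d / k by field; rewrite gt_eqF.
    by rewrite ltr_pdivlMr // mulrC.
  pose Aff r t := (G zs - D * zs) + D * circ c r t.
  have scA : sep_cont Aff.
    split=> s t; (apply: ccont_atD; first exact: ccont_at_cst);
    (apply: ccont_atM; first exact: ccont_at_cst); [exact: ccont_circ|exact: ccont_circ_r].
  have -> : polar_int Gam u u' v v' = polar_int (fun r t => Gam r t - Aff r t) u u' v v'.
    by rewrite polar_intB // (polar_int_affine c (G zs - D * zs) D uu' vv') subr0.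
  pose M := e / (k ^+ 2 * 2) * (k * w).
  have -> : e * w ^+ 2 = M * (1 + q) * 2 * ((u' - u) + (v' - v)).
    by rewrite /M -/w -/k; field; rewrite gt_eqF.
  apply: polar_int_bound => //; rewrite ?uu' ?(le_trans p0 pu) //.
    case: scG scA => [a1 a2] [b1 b2]; split=> s t.
      by apply: ccont_atD; [exact: (a1 s t)|apply: ccont_atN; exact: (b1 s t)].
    by apply: ccont_atD; [exact: (a2 s t)|apply: ccont_atN; exact: (b2 s t)].
  move=> r t /andP[ur ru'] /andP[vt tv'].
  have rpq : p <= r <= q by rewrite (le_trans pu ur) (le_trans ru' u'q).
  rewrite /Gam clamp_id // /Aff.
  have -> : G (circ c r t) - (G zs - D * zs + D * circ c r t) = G (circ c r t) - G zs - D * (circ c r t - zs) by ring.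
  have dz : nc (circ c r t - zs) <= k * w.
    apply: le_trans (circ_dist _ _ _ _ _) _; first by lra.
    have h1 : `|r - x| <= u' - u by rewrite ler_norml; lra.
    have h2 : `|t - y| <= v' - v by rewrite ler_norml; lra.
    have h3 : x * `|t - y| <= q * (v' - v) by apply: ler_pM; rewrite ?normr_ge0; lra.
    have : 0 <= q * (u' - u) by rewrite mulr_ge0 // subr_ge0.
    rewrite /k /w; lra.
  apply: le_trans (hd _ (le_lt_trans dz wd)) _.
  by rewrite /M ler_wpM2l // ltW.
move: I0; rewrite /polar_int cis2pi cis0.
have -> : cint p q (fun r => Gam r (2 * pi) * 1) = cint p q (fun r => Gam r 0 * 1).
  by apply: eq_cint => r _; rewrite /Gam /circ cis2pi cis0.
rewrite addrNK -!cintB; try exact: ccont_ang.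
have E x : p <= x <= q ->
    cint 0 (2 * pi) (fun t => Gam x t * (x%:C * ('i * cis t))) = 'i * circle_int G c x.
  move=> xpq; rewrite -cintZ.
    by apply: eq_cint => t _; rewrite /Gam clamp_id //; ring.
  have := ccont_ang x scG => h t; have h' := h t.
  have : ccont_at (fun t => (- 'i) * (Gam x t * (x%:C * ('i * cis t)))) t.
    by apply: ccont_atM => //; exact: ccont_at_cst.
  rewrite (_ : (fun t => _) = (fun t => G (circ c x t) * (x%:C * cis t))) //.
  apply/funext => s; rewrite /Gam clamp_id //.
  have ii : 'i * 'i = -1 :> R[i] by rewrite -expr2 sqr_i.
  have -> : - 'i * (G (circ c x s) * (x%:C * ('i * cis s))) =
     - ('i * 'i) * (G (circ c x s) * (x%:C * cis s)) :> R[i] by ring.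
  by rewrite ii opprK mul1r.
rewrite cintB; try exact: ccont_ang.
rewrite !E ?lexx ?pq // -mulrBr => /eqP; rewrite mulf_eq0 subr_eq0 => /orP[/eqP i0|/eqP ->//].
by have := nc_i; rewrite i0 Normc.normc0 => /eqP; rewrite eq_sym oner_eq0.
Qed.

End Polar.

(** * Holomorphic functions and Cauchy's formula *)

Section HoloCalculus.
Context {R : realType}.
Implicit Types (f g : R[i] -> R[i]) (z w : R[i]).

(** Caratheodory's form of differentiability: the difference quotient extends
    continuously. It turns the calculus rules into continuity rules. *)
Lemma holo_atP f z : holo_at f z <->
  exists2 phi, ccont_at phi z & \forall w \near z, f w = f z + phi w * (w - z).
Proof.
split=> [[D hD]|[phi cphi /nbhs_ncP[d0 d00 hphi]]].
  pose phi w := if w == z then D else (f w - f z) / (w - z).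
  exists phi.
    move=> e e0; have e2 : 0 < e / 2 by rewrite divr_gt0.
    have [d d0 hd] := hD _ e2; apply/nbhs_ncP; exists d => // w wd.
    rewrite /phi eqxx; case: eqVneq => [_|wz]; first by rewrite subrr Normc.normc0.
    have wz0 : w - z != 0 by rewrite subr_eq0.
    have -> : (f w - f z) / (w - z) - D = (f w - f z - D * (w - z)) / (w - z) by field.
    rewrite Normc.normcM Normc.normcV ltr_pdivrMr ?nc_gt0 //.
    by apply: le_lt_trans (hd _ wd) _; rewrite ltr_pM2r ?nc_gt0 // ; lra.
  apply/nbhs_ncP; exists 1 => // w _; rewrite /phi.
  case: eqVneq => [->|wz]; first by rewrite subrr mulr0 addr0.
  by rewrite divfK ?subr_eq0 // addrC subrK.
exists (phi z) => e e0; have /nbhs_ncP[d d1 hd] := cphi _ e0.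
exists (Num.min d0 d); first by rewrite lt_min d00.
move=> w; rewrite lt_min => /andP[/hphi E /hd h].
have -> : f w - f z - phi z * (w - z) = (phi w - phi z) * (w - z) by rewrite E; ring.
by rewrite Normc.normcM ler_wpM2r ?nc_ge0 // ltW.
Qed.

Lemma holo_at_near f g z : (\forall w \near z, f w = g w) -> holo_at f z -> holo_at g z.
Proof.
move=> fg /holo_atP[phi cphi hphi]; apply/holo_atP; exists phi => //.
near=> w; have <- : f w = g w by near: w.
by have <- : f z = g z; [exact: (nbhs_singleton fg)|near: w].
Unshelve. all: by end_near. Qed.

Lemma holo_at_cst k z : holo_at (fun=> k) z.
Proof.
apply/holo_atP; exists (fun=> 0); first exact: ccont_at_cst.
by near=> w; rewrite mul0r addr0.
Unshelve. all: by end_near. Qed.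

Lemma holo_at_id z : holo_at id z.
Proof.
apply/holo_atP; exists (fun=> 1); first exact: ccont_at_cst.
by near=> w; rewrite mul1r addrC subrK.
Unshelve. all: by end_near. Qed.

Lemma holo_atD f g z : holo_at f z -> holo_at g z -> holo_at (fun w => f w + g w) z.
Proof.
move=> /holo_atP[p cp hp] /holo_atP[q cq hq]; apply/holo_atP.
exists (fun w => p w + q w); first exact: ccont_atD.
near=> w; have -> : f w = f z + p w * (w - z) by near: w.
have -> : g w = g z + q w * (w - z) by near: w.
ring.
Unshelve. all: by end_near. Qed.

Lemma holo_atM f g z : holo_at f z -> holo_at g z -> holo_at (fun w => f w * g w) z.
Proof.
move=> hf hg; have cg := holo_at_ccont hg.
move: hf hg => /holo_atP[p cp hp] /holo_atP[q cq hq]; apply/holo_atP.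
exists (fun w => p w * g w + f z * q w).
  by apply: ccont_atD; apply: ccont_atM => //; exact: ccont_at_cst.
near=> w; have -> : f w = f z + p w * (w - z) by near: w.
have E : g w = g z + q w * (w - z) by near: w.
rewrite [in LHS]mulrDl {1}E; ring.
Unshelve. all: by end_near. Qed.

Lemma holo_atN f z : holo_at f z -> holo_at (fun w => - f w) z.
Proof.
move=> hf; have := holo_atM (holo_at_cst (-1) z) hf; apply: holo_at_near.
by near=> w; rewrite mulN1r.
Unshelve. all: by end_near. Qed.

Lemma ccont_near_neq0 f z : ccont_at f z -> f z != 0 -> \forall w \near z, f w != 0.
Proof.
move=> cf; rewrite -nc_gt0 => fz; have /nbhs_ncP[d d0 hd] := cf _ fz.
apply/nbhs_ncP; exists d => // w /hd h; rewrite -nc_gt0.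
by have := nc_sub_le (f z) (f w); rewrite ncBC; lra.
Qed.

Lemma holo_atV f z : f z != 0 -> holo_at f z -> holo_at (fun w => (f w)^-1) z.
Proof.
move=> fz hf; have cf := holo_at_ccont hf; move: hf => /holo_atP[p cp hp].
apply/holo_atP; exists (fun w => - (p w * (f z)^-1 * (f w)^-1)).
  apply: ccont_atN; apply: ccont_atM; last exact: ccont_atV.
  by apply: ccont_atM => //; exact: ccont_at_cst.
near=> w; have fw : f w != 0 by near: w; exact: ccont_near_neq0.
have E : f w - f z = p w * (w - z).
  have -> : f w = f z + p w * (w - z) by near: w.
  ring.
have {1}-> : (f w)^-1 = (f z)^-1 - (f w - f z) * ((f z)^-1 * (f w)^-1) by field; rewrite fz fw.
rewrite E; ring.
Unshelve. all: by end_near. Qed.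

Lemma holo_at_pole f z w : holo_at f z -> z != w -> holo_at (fun x => f x * (x - w)^-1) z.
Proof.
move=> hf zw; apply: holo_atM => //; apply: holo_atV; first by rewrite subr_eq0.
by apply: holo_atD; [exact: holo_at_id|exact: holo_at_cst].
Qed.

End HoloCalculus.

Section CauchyFormula.
Context {R : realType}.
Implicit Types (f G : R[i] -> R[i]) (c z w : R[i]) (p q r e : R).

Lemma ccont_circle_fun G c r : 0 <= r -> (forall z, nc (z - c) = r -> ccont_at G z) ->
  ccont (fun t => G (circ c r t)).
Proof.
move=> r0 hG t; apply: (ccont_at_ccomp (h := circ c r)); first exact: ccont_circ.
by apply: hG; rewrite nc_circ.
Qed.

Lemma ccont_circle_int G c r : 0 <= r -> (forall z, nc (z - c) = r -> ccont_at G z) ->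
  ccont (fun t => G (circ c r t) * (r%:C * cis t)).
Proof.
move=> r0 hG t; apply: ccont_atM; first exact: ccont_circle_fun.
by apply: ccont_atM; [exact: ccont_at_cst|exact: ccont_cis].
Qed.

Lemma circle_int_bound G c r M : 0 <= r -> (forall z, nc (z - c) = r -> ccont_at G z) ->
  (forall t, 0 <= t <= 2 * pi -> nc (G (circ c r t)) <= M) ->
  nc (circle_int G c r) <= 2 * pi * (M * r).
Proof.
move=> r0 cG hM; rewrite mulrC -[X in _ * X]subr0; apply: nc_cint_le; first exact: pi2_ge0.
  exact: ccont_circle_int.
move=> t ht; rewrite !Normc.normcM nc_cis nc_real mulr1 (ger0_norm r0).
by rewrite ler_wpM2r // hM.
Qed.

Lemma circle_bounded G c r : 0 <= r -> (forall z, nc (z - c) = r -> ccont_at G z) ->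
  exists2 M, 0 <= M & forall t, 0 <= t <= 2 * pi -> nc (G (circ c r t)) <= M.
Proof.
move=> r0 cG; have cF : ccont (fun t => G (circ c r t)) by exact: ccont_circle_fun.
have cn : {within `[0, 2 * pi], continuous (fun t : R => nc (G (circ c r t)))}.
  by apply: continuous_subspaceT => t; apply: ccont_at_nc; exact: cF.
have [tm _ htm] := EVT_max (@pi2_ge0 R) cn.
by exists (nc (G (circ c r tm))) => [|t ht]; [exact: nc_ge0|apply: htm; rewrite in_itv].
Qed.

Lemma circle_int0 G c : circle_int G c 0 = 0.
Proof.
rewrite /circle_int (@eq_cint _ _ _ _ (fun=> 0 * 0)).
  by rewrite cintZ ?mul0r // => t; exact: ccont_at_cst.
by move=> t _; rewrite mul0r mulr0 mul0r.
Qed.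

Lemma circle_intD G F c r : 0 <= r -> (forall z, nc (z - c) = r -> ccont_at G z) ->
  (forall z, nc (z - c) = r -> ccont_at F z) ->
  circle_int (fun z => G z + F z) c r = circle_int G c r + circle_int F c r.
Proof.
move=> r0 cG cF; rewrite /circle_int -cintD; try exact: ccont_circle_int.
by apply: eq_cint => t _; rewrite mulrDl.
Qed.

Lemma circle_intZ k G c r : 0 <= r -> (forall z, nc (z - c) = r -> ccont_at G z) ->
  circle_int (fun z => k * G z) c r = k * circle_int G c r.
Proof.
move=> r0 cG; rewrite /circle_int -cintZ; last exact: ccont_circle_int.
by apply: eq_cint => t _; rewrite [in RHS]mulrA.
Qed.

Lemma eq_circle_int G F c r : 0 <= r -> (forall z, nc (z - c) = r -> G z = F z) ->
  circle_int G c r = circle_int F c r.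
Proof. by move=> r0 E; apply: eq_cint => t _; rewrite E // nc_circ. Qed.

Lemma ccont_joint G c r t : 0 <= r -> ccont_at G (circ c r t) -> forall e, 0 < e ->
  \forall t' \near t & r' \near r,
    nc (G (circ c r' t') * (r'%:C * cis t') - G (circ c r t') * (r%:C * cis t')) < e.
Proof.
move=> r0 cG e e0.
pose H z := G z * (z - c).
have cH : ccont_at H (circ c r t).
  apply: ccont_atM => //; apply: ccont_atD; last exact: ccont_at_cst.
  by apply: holo_at_ccont; exact: holo_at_id.
have HE r' t' : G (circ c r' t') * (r'%:C * cis t') = H (circ c r' t').
  by rewrite /H /circ addrAC subrr add0r.
have e2 : 0 < e / 2 by rewrite divr_gt0.
have /nbhs_ncP[d d0 hd] := cH _ e2.
exists ([set t' | r * `|t' - t| < d / 2], [set r' | `|r' - r| < d / 2]) => /=.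
  split; apply/nbhs_realP.
    exists (d / 2 / (r + 1)); first by rewrite !divr_gt0 // ltr_wpDl.
    move=> t'; rewrite ltr_pdivlMr ?ltr_wpDl // => h; apply: le_lt_trans h.
    by rewrite mulrC ler_wpM2l // lerDl.
  by exists (d / 2) => //; rewrite divr_gt0.
move=> [t' r'] /= [h1 h2]; rewrite !HE.
apply: le_lt_trans (nc_distD (H (circ c r t)) _ _) _.
rewrite (splitr e) ltrD //; last rewrite ncBC; apply: hd.
  by apply: le_lt_trans (circ_dist _ _ _ _ r0) _; lra.
apply: le_lt_trans (circ_dist _ _ _ _ r0) _; rewrite subrr normr0 add0r; lra.
Qed.

(** Uniform continuity in the radius, from compactness of the interval of angles. *)
Lemma circle_int_cont G c r : 0 <= r ->
  (forall z, nc (z - c) = r -> ccont_at G z) -> forall e, 0 < e ->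
  exists2 d, 0 < d & forall r', 0 <= r' -> `|r' - r| < d ->
    (forall z, nc (z - c) = r' -> ccont_at G z) ->
    nc (circle_int G c r' - circle_int G c r) <= e.
Proof.
move=> r0 cG e e0.
pose e' := e / (2 * pi); have e'0 : 0 < e' by rewrite divr_gt0 // mulr_gt0 // pi_gt0.
have /compact_near_coveringP ncov := @segment_compact R 0 (2 * pi).
have := ncov R (nbhs r) (fun r' t' =>
  nc (G (circ c r' t') * (r'%:C * cis t') - G (circ c r t') * (r%:C * cis t')) < e') _.
move=> /(_ (nbhs_filter r) (fun t _ => ccont_joint r0 (cG _ (nc_circ c t r0)) e'0)) /nbhs_realP [d d0 hd].
exists d => // r' r'0 /hd h cG'.
rewrite /circle_int -cintB; try exact: ccont_circle_int.
have -> : e = e' * (2 * pi - 0).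
  by rewrite subr0 divfK // mulf_neq0 // gt_eqF // pi_gt0.
apply: nc_cint_le; first exact: pi2_ge0.
  move=> t; apply: ccont_atD; first exact: ccont_circle_int.
  by apply: ccont_atN; exact: ccont_circle_int.
by move=> t tab; apply/ltW/h; rewrite /= in_itv.
Qed.

(** Cauchy's theorem survives one exceptional point where the integrand is merely
    continuous: circles on either side of it approximate the circle through it. *)
Lemma circle_int_eq_except G c p q w : 0 <= p <= q ->
  (forall z, p <= nc (z - c) <= q -> ccont_at G z) ->
  (forall z, p <= nc (z - c) <= q -> z != w -> holo_at G z) ->
  circle_int G c p = circle_int G c q.
Proof.
move=> /andP[p0 pq] cG hG; set s := nc (w - c).
have side x y : p <= x -> y <= q -> x <= y -> (forall r, x <= r <= y -> r != s) ->
    circle_int G c x = circle_int G c y.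
  move=> px yq xy ns; apply: circle_int_eq; first by rewrite xy (le_trans p0 px).
  move=> z /andP[xz zy]; apply: hG; first by rewrite (le_trans px xz) (le_trans zy yq).
  by apply/negP => /eqP zw; have := ns (nc (z - c)); rewrite xz zy zw eqxx => /(_ isT).
have cGr r z : p <= r <= q -> nc (z - c) = r -> ccont_at G z by move=> h zr; apply: cG; rewrite zr.
have [sp|ps] := ltP s p.
  by apply: side => // r /andP[pr _]; rewrite gt_eqF // (lt_le_trans sp).
have [qs|sq] := ltP q s.
  by apply: side => // r /andP[_ rq]; rewrite lt_eqF // (le_lt_trans rq).
have s0 : 0 <= s by exact: nc_ge0.
have ends x : p <= x <= q -> circle_int G c x = circle_int G c s.
  move=> /andP[px xq]; apply/eqP; rewrite -subr_eq0 -[_ == 0]negbK -nc_gt0 -leNgt.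
  apply/ler_addgt0Pl => e e0; rewrite addr0.
  have [d d0 hd] := circle_int_cont s0 (fun z => cGr s z (introT andP (conj ps sq))) e0.
  have [xs|sx|->] := ltgtP x s; last by rewrite subrr Normc.normc0 ltW.
    pose y := Num.max x (s - d / 2).
    have ys : y < s by rewrite gt_max xs; lra.
    have xy : x <= y by rewrite le_max lexx.
    have sy : s - d / 2 <= y by rewrite le_max lexx orbT.
    rewrite (side x y) //; last by move=> r /andP[_ ry]; rewrite lt_eqF // (le_lt_trans ry).
      apply: hd; first exact: le_trans p0 (le_trans px xy).
        by rewrite ltr_norml; lra.
      by move=> z; apply: cGr; rewrite (le_trans px xy) (le_trans (ltW ys) sq).
    exact: le_trans (ltW ys) sq.
  pose y := Num.min x (s + d / 2).
  have ys : s < y by rewrite lt_min sx; lra.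
  have xy : y <= x by rewrite ge_min lexx.
  have sy : y <= s + d / 2 by rewrite ge_min lexx orbT.
  rewrite -(side y x) //; last by move=> r /andP[ry _]; rewrite gt_eqF // (lt_le_trans ys).
    apply: hd; first exact: le_trans s0 (ltW ys).
      by rewrite ltr_norml; lra.
    by move=> z; apply: cGr; rewrite (le_trans ps (ltW ys)) (le_trans xy xq).
  exact: le_trans ps (ltW ys).
by rewrite (ends p) ?lexx ?pq // (ends q) ?lexx ?pq.
Qed.

Lemma nc_dist_gt c z w q : nc (z - c) = q -> q - nc (w - c) <= nc (z - w).
Proof. by move=> <-; have := nc_distD w z c; lra. Qed.

Lemma nc_dist_gt_inner c z w q : nc (z - c) = q -> nc (w - c) - q <= nc (z - w).
Proof. by move=> <-; have := nc_distD z w c; rewrite (ncBC w z); lra. Qed.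

Lemma neq_of_dist c z w : nc (z - c) != nc (w - c) -> z != w.
Proof. by apply: contraNneq => ->. Qed.

Lemma kernel_outside c w q : 0 <= q < nc (w - c) ->
  circle_int (fun z => 1 * (z - w)^-1) c q = 0.
Proof.
move=> /andP[q0 qw]; rewrite -(circle_int_eq (p := 0)) ?lexx ?q0 ?circle_int0 //.
move=> z /andP[_ zq]; apply: holo_at_pole; first exact: holo_at_cst.
by apply: (@neq_of_dist c); rewrite lt_eqF // (le_lt_trans zq).
Qed.

Lemma cint_cst1 : cint 0 (2 * pi) (fun=> 1) = (2 * pi)%:C :> R[i].
Proof.
rewrite (@cFTC _ (fun t => t%:C)); [|exact: pi2_ge0| |].
- by rewrite -rmorphB /= subr0.
- by move=> t; exact: cder_real.
- by move=> t; exact: ccont_at_cst.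
Qed.

(** The integral does not change when the circle grows, and on a large circle the
    integrand is close to [1]. *)
Lemma kernel_inside c w q : nc (w - c) < q ->
  circle_int (fun z => 1 * (z - w)^-1) c q = (2 * pi)%:C.
Proof.
move=> wq; set s := nc (w - c) in wq *; have s0 : 0 <= s by exact: nc_ge0.
have q0 : 0 < q by exact: le_lt_trans wq.
have hK z r : nc (z - c) = r -> s < r -> ccont_at (fun z => 1 * (z - w)^-1) z.
  move=> zr sr; apply/holo_at_ccont/holo_at_pole; first exact: holo_at_cst.
  by apply: (@neq_of_dist c); rewrite zr gt_eqF.
apply/eqP; rewrite -subr_eq0 -[_ == 0]negbK -nc_gt0 -leNgt.
apply/ler_addgt0Pl => e e0; rewrite addr0.
(* Large enough for the error [s / (Q - s)] to be at most [e / (2 * pi)]. *)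
pose Q := q + 2 * pi * s / e.
have Qq : q <= Q by rewrite lerDl divr_ge0 ?mulr_ge0 ?pi_ge0 // ltW.
have sQ : s < Q by exact: lt_le_trans wq Qq.
have Q0 : 0 <= Q by exact: le_trans s0 (ltW sQ).
rewrite (circle_int_eq (q := Q)) ?(ltW q0) //; last first.
  move=> z /andP[qz _]; apply: holo_at_pole; first exact: holo_at_cst.
  by apply: (@neq_of_dist c); rewrite gt_eqF // (lt_le_trans wq).
rewrite -cint_cst1 /circle_int -cintB; last 2 first.
- by apply: (ccont_circle_int (G := fun z => 1 * (z - w)^-1)) => // z zQ; exact: hK zQ sQ.
- by move=> t; exact: ccont_at_cst.
have -> : e = e / (2 * pi) * (2 * pi - 0).
  by rewrite subr0 divfK // mulf_neq0 // gt_eqF // pi_gt0.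
apply: nc_cint_le; first exact: pi2_ge0.
  move=> t; apply: ccont_atD; last exact: ccont_at_cst.
  by apply: (ccont_circle_int (G := fun z => 1 * (z - w)^-1)) => // z zQ; exact: hK zQ sQ.
move=> t _; have zQ := nc_circ c t Q0; set z := circ c Q t in zQ *.
have zw : z - w != 0 by rewrite subr_eq0; apply: (@neq_of_dist c); rewrite zQ gt_eqF.
have -> : 1 * (z - w)^-1 * (Q%:C * cis t) - 1 = (w - c) * (z - w)^-1.
  have -> : Q%:C * cis t = z - c by rewrite /z /circ addrAC subrr add0r.
  by field.
rewrite Normc.normcM Normc.normcV -/s ler_pdivrMr ?nc_gt0 //.
have h : Q - s <= nc (z - w) by exact: nc_dist_gt.
have p0 : 0 < 2 * pi :> R by rewrite mulr_gt0 // pi_gt0.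
apply: (@le_trans _ _ (e / (2 * pi) * (Q - s))); last by rewrite ler_wpM2l // divr_ge0 // ltW.
have -> : e / (2 * pi) * (Q - s) = s + e / (2 * pi) * (q - s).
  by move: p0; rewrite /Q; move: (2 * pi) => T p0; field; rewrite (gt_eqF e0) (gt_eqF p0).
by rewrite lerDl mulr_ge0 ?divr_ge0 ?(ltW e0) ?(ltW p0) // subr_ge0 ltW.
Qed.

(** The Cauchy integral of [f], as a function of the pole [w] on either side of the
    circle. *)
Definition cauchy_tr f c r w : R[i] :=
  (2 * pi)^-1%:C * circle_int (fun z => f z * (z - w)^-1) c r.

Lemma pi2C_neq0 : (2 * pi)%:C != 0 :> R[i].
Proof. by rewrite -nc_gt0 nc_real ger0_norm ?pi2_ge0 // mulr_gt0 // pi_gt0. Qed.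

(** The difference quotient of [f] at [w] extends continuously over [w]. *)
Lemma cauchy_quotient f c p q w : 0 <= p -> p <= nc (w - c) <= q ->
  (forall z, p <= nc (z - c) <= q -> holo_at f z) ->
  exists2 G, circle_int G c p = circle_int G c q &
    forall r, p <= r <= q -> nc (w - c) != r ->
    circle_int G c r = circle_int (fun z => f z * (z - w)^-1) c r -
      f w * circle_int (fun z => 1 * (z - w)^-1) c r.
Proof.
move=> p0 /andP[pw wq] hf.
have q0 : 0 <= q by exact: le_trans (nc_ge0 _) wq.
have pq : p <= q by exact: le_trans wq.
have /holo_atP[phi cphi /nbhs_ncP[d d0 hphi]] : holo_at f w by apply: hf; rewrite pw.
pose G z := if z == w then phi w else (f z - f w) * (z - w)^-1.
have hG z : p <= nc (z - c) <= q -> z != w -> holo_at G z.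
  move=> zpq zw.
  have : holo_at (fun z => (f z - f w) * (z - w)^-1) z.
    by apply: holo_at_pole => //; apply: holo_atD; [exact: hf|exact: holo_at_cst].
  apply: holo_at_near; have zw0 : 0 < nc (z - w) by rewrite nc_gt0 subr_eq0.
  apply/nbhs_ncP; exists (nc (z - w)) => // y; rewrite /G; case: eqVneq => // ->.
  by rewrite ncBC ltxx.
have cG z : p <= nc (z - c) <= q -> ccont_at G z.
  move=> zpq; have [->|zw] := eqVneq z w; last exact/holo_at_ccont/hG.
  move=> e e0; have /nbhs_ncP[d' d'0 hd'] := cphi _ e0.
  apply/nbhs_ncP; exists (Num.min d d'); first by rewrite lt_min d0.
  move=> y; rewrite lt_min => /andP[/hphi yE /hd'].
  rewrite /G eqxx; case: eqVneq => [->//|yw].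
  by rewrite yE [f w + _ - _]addrAC subrr add0r mulfK // subr_eq0.
exists G; first by apply: (circle_int_eq_except (w := w)) => //; rewrite p0.
move=> r rpq wr; have r0 : 0 <= r by case/andP: rpq => pr _; exact: le_trans pr.
have hzw z : nc (z - c) = r -> z != w.
  by move=> zr; apply: (@neq_of_dist c); rewrite zr eq_sym.
have h1 z : nc (z - c) = r -> ccont_at (fun z => f z * (z - w)^-1) z.
  move=> zr; apply/holo_at_ccont/holo_at_pole; last exact: hzw.
  by apply: hf; rewrite zr.
have h2 k z : nc (z - c) = r -> ccont_at (fun z => k * (1 * (z - w)^-1)) z.
  move=> zr; apply: ccont_atM; first exact: ccont_at_cst.
  by apply/holo_at_ccont/holo_at_pole; [exact: holo_at_cst|exact: hzw].
have h3 z : nc (z - c) = r -> ccont_at (fun z => 1 * (z - w)^-1) z.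
  by move=> zr; apply/holo_at_ccont/holo_at_pole; [exact: holo_at_cst|exact: hzw].
rewrite -mulNr -circle_intZ // -circle_intD //; last exact: h2.
apply: eq_circle_int => // z zr; rewrite /G (negbTE (hzw z zr)); ring.
Qed.

(** The difference quotient at [w] integrates to the same value over both circles, and
    the kernel to [2 pi] over the outer one and to [0] over the inner one. *)
Lemma cauchy_annulus f c p q w : 0 <= p -> p < nc (w - c) < q ->
  (forall z, p <= nc (z - c) <= q -> holo_at f z) ->
  cauchy_tr f c q w - cauchy_tr f c p w = f w.
Proof.
move=> p0 /andP[pw wq] hf; have pq : p <= q by exact: le_trans (ltW pw) (ltW wq).
have [|G JG split] := cauchy_quotient p0 _ hf (w := w); first by rewrite !ltW.
move: JG; rewrite split ?lexx ?pq ?gt_eqF // split ?lexx ?pq ?lt_eqF //.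
rewrite kernel_outside ?p0 // kernel_inside // mulr0 subr0 /cauchy_tr => ->.
rewrite -mulrBr opprD opprK addrA subrr add0r mulrCA.
by rewrite -rmorphM /= mulVf ?mulr1 // -(inj_eq (@complexI R)) pi2C_neq0.
Qed.

(** The annulus formula with an inner circle of radius zero, whose integrals vanish. *)
Lemma cauchy_disc f c q w : nc (w - c) < q ->
  (forall z, nc (z - c) <= q -> holo_at f z) -> cauchy_tr f c q w = f w.
Proof.
move=> wq hf.
have hf' z : 0 <= nc (z - c) <= q -> holo_at f z by move=> /andP[_]; exact: hf.
have q0 : 0 <= q by exact: le_trans (nc_ge0 _) (ltW wq).
have [|G JG split] := cauchy_quotient (lexx 0) _ hf' (w := w); first by rewrite nc_ge0 ltW.
move: JG; rewrite circle_int0 split ?lexx ?q0 ?lt_eqF // kernel_inside //.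
move=> /esym/eqP; rewrite subr_eq0 /cauchy_tr => /eqP ->.
by rewrite mulrCA -rmorphM /= mulVf ?mulr1 // -(inj_eq (@complexI R)) pi2C_neq0.
Qed.

(** The Cauchy transform is holomorphic off its circle: expand the kernel to
    second order. *)
Lemma cauchy_tr_holo f c r w : 0 <= r -> (forall z, nc (z - c) = r -> ccont_at f z) ->
  nc (w - c) != r -> holo_at (cauchy_tr f c r) w.
Proof.
move=> r0 cf wr.
pose d := `|nc (w - c) - r|; have d0 : 0 < d by rewrite normr_gt0 subr_eq0.
have far z : nc (z - c) = r -> d <= nc (z - w).
  move=> zr; rewrite /d; have h1 := nc_dist_gt w zr; have h2 := nc_dist_gt_inner w zr.
  by rewrite ler_norml; apply/andP; split; lra.
have ck y n : nc (y - w) < d -> forall z, nc (z - c) = r -> ccont_at (fun z => ((z - y)^-1) ^+ n) z.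
  move=> yd z zr; have zy : z - y != 0.
    by rewrite -nc_gt0; have := far z zr; have := nc_distD y z w; lra.
  elim: n => [|n ih]; first by exact: ccont_at_cst.
  under eq_fun do rewrite exprS; apply: ccont_atM => //; apply: ccont_atV => //.
  by apply: ccont_atD; [exact/holo_at_ccont/holo_at_id|exact: ccont_at_cst].
have [M M0 hM] := circle_bounded r0 cf.
pose D := (2 * pi)^-1%:C * circle_int (fun z => f z * ((z - w)^-1) ^+ 2) c r.
pose K := 2 * M * r / d ^+ 3.
have K0 : 0 <= K by rewrite divr_ge0 ?mulr_ge0 ?exprn_ge0 ?(ltW d0) //.
exists D => e e0; exists (Num.min (d / 2) (e / (K + 1))).
  by rewrite lt_min !divr_gt0 // ltr_wpDl.
move=> y; rewrite lt_min => /andP[yd ye]; set h := y - w.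
have yd' : nc (y - w) < d by lra.
have far2 z : nc (z - c) = r -> d / 2 <= nc (z - y).
  by move=> zr; have := far z zr; have := nc_distD y z w; lra.
have cq z : nc (z - c) = r -> ccont_at (fun z => f z * ((z - w)^-1 ^+ 2 * (z - y)^-1)) z.
  move=> zr; apply: ccont_atM; first exact: cf.
  by apply: ccont_atM; [apply: ck; rewrite ?subrr ?Normc.normc0|exact: (ck y 1%N)].
have c2 z : nc (z - c) = r -> ccont_at (fun z => f z * (z - w)^-1 ^+ 2) z.
  by move=> zr; apply: ccont_atM; [exact: cf|apply: ck; rewrite ?subrr ?Normc.normc0].
have c1 z : nc (z - c) = r -> ccont_at (fun z => f z * (z - w)^-1) z.
  by move=> zr; apply: ccont_atM; [exact: cf|apply: (ck w 1%N); rewrite ?subrr ?Normc.normc0].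
have cZ (k : R[i]) (F : R[i] -> R[i]) z : ccont_at F z -> ccont_at (fun z => k * F z) z.
  by move=> cF; apply: ccont_atM => //; exact: ccont_at_cst.
have E : circle_int (fun z => f z * (z - y)^-1) c r =
   circle_int (fun z => f z * (z - w)^-1) c r +
   (h * circle_int (fun z => f z * (z - w)^-1 ^+ 2) c r +
    h ^+ 2 * circle_int (fun z => f z * ((z - w)^-1 ^+ 2 * (z - y)^-1)) c r).
  pose F1 z := f z * (z - w)^-1; pose F2 z := f z * (z - w)^-1 ^+ 2.
  pose F3 z := f z * ((z - w)^-1 ^+ 2 * (z - y)^-1).
  rewrite -/F1 -/F2 -/F3 -(circle_intZ h r0 c2) -(circle_intZ (h ^+ 2) r0 cq).
  have k2 z (zr : nc (z - c) = r) := cZ h F2 z (c2 z zr).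
  have k3 z (zr : nc (z - c) = r) := cZ (h ^+ 2) F3 z (cq z zr).
  rewrite -(circle_intD r0 k2 k3).
  rewrite -(circle_intD r0 c1 (fun z zr => ccont_atD (k2 z zr) (k3 z zr))).
  apply: eq_circle_int => // z zr; rewrite /F1 /F2 /F3 /h; field.
  by rewrite !subr_eq0; apply/andP; split; apply/negP => /eqP zE;
    have := far z zr; have := far2 z zr; rewrite zE subrr Normc.normc0; lra.
have -> : cauchy_tr f c r y - cauchy_tr f c r w - D * h =
    (2 * pi)^-1%:C * (h ^+ 2 * circle_int (fun z => f z * ((z - w)^-1 ^+ 2 * (z - y)^-1)) c r).
  by rewrite /cauchy_tr E /D; ring.
have p0 : 0 < 2 * pi :> R by rewrite mulr_gt0 // pi_gt0.
have d30 : 0 < d ^+ 3 by rewrite exprn_gt0.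
have B : nc (circle_int (fun z => f z * ((z - w)^-1 ^+ 2 * (z - y)^-1)) c r) <= K * (2 * pi - 0).
  apply: nc_cint_le; [exact: pi2_ge0|exact: (ccont_circle_int r0 cq)|move=> t ht].
  have zr := nc_circ c t r0; set z := circ c r t in zr *.
  rewrite (Normc.normcM (f z * _)) (Normc.normcM (f z)) (Normc.normcM (_ ^+ 2)) ncX !Normc.normcV.
  rewrite (Normc.normcM r%:C) nc_cis nc_real mulr1 (ger0_norm r0).
  have -> : K = M * (d^-1 ^+ 2 * (d / 2)^-1) * r by rewrite /K; field; rewrite gt_eqF.
  have d2 : 0 < d / 2 by rewrite divr_gt0.
  apply: ler_wpM2r => //; apply: ler_pM; rewrite ?nc_ge0 ?mulr_ge0 ?exprn_ge0 ?invr_ge0 ?nc_ge0 ?hM //.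
  apply: ler_pM; rewrite ?exprn_ge0 ?invr_ge0 ?nc_ge0 //.
    by rewrite lerXn2r ?nnegrE ?invr_ge0 ?nc_ge0 ?(ltW d0) // lef_pV2 ?posrE ?far // (lt_le_trans d0 (far z zr)).
  by rewrite lef_pV2 ?posrE ?far2 // (lt_le_trans d2 (far2 z zr)).
rewrite (Normc.normcM _%:C) (Normc.normcM (h ^+ 2)) ncX nc_real ger0_norm ?invr_ge0 ?(ltW p0) //.
rewrite subr0 in B.
have hK : nc h * (K + 1) < e by rewrite -ltr_pdivlMr // ltr_wpDl.
have h0 : 0 <= nc h by exact: nc_ge0.
rewrite mulrCA; apply: (@le_trans _ _ (nc h ^+ 2 * ((2 * pi)^-1 * (K * (2 * pi))))).
  by rewrite ler_wpM2l ?exprn_ge0 // ler_wpM2l // invr_ge0 ltW.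
have -> : (2 * pi)^-1 * (K * (2 * pi)) = K by rewrite mulrC mulfK // gt_eqF.
rewrite expr2 -mulrA mulrC; apply: ler_wpM2r => //.
by apply: le_trans (ltW hK); rewrite ler_wpM2l // lerDl.
Qed.

Lemma cauchy_tr_bound f c r w M : 0 <= r -> r < nc (w - c) ->
  (forall z, nc (z - c) = r -> ccont_at f z) ->
  (forall t, 0 <= t <= 2 * pi -> nc (f (circ c r t)) <= M) ->
  nc (cauchy_tr f c r w) <= M * r / (nc (w - c) - r).
Proof.
move=> r0 rw cf hM; have d0 : 0 < nc (w - c) - r by rewrite subr_gt0.
have p0 : 0 < 2 * pi :> R by rewrite mulr_gt0 // pi_gt0.
have M0 : 0 <= M by apply: le_trans (hM 0 _); rewrite ?nc_ge0 ?lexx ?(ltW p0).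
have far z : nc (z - c) = r -> nc (w - c) - r <= nc (z - w) by exact: nc_dist_gt_inner.
rewrite /cauchy_tr Normc.normcM nc_real ger0_norm ?invr_ge0 ?(ltW p0) //.
rewrite ler_pdivrMl //; have -> : M * r / (nc (w - c) - r) = M / (nc (w - c) - r) * r by ring.
apply: circle_int_bound => // [z zr|t ht].
  apply: ccont_atM; first exact: cf.
  apply: ccont_atV; first by rewrite -nc_gt0 (lt_le_trans d0 (far z zr)).
  by apply: ccont_atD; [exact/holo_at_ccont/holo_at_id|exact: ccont_at_cst].
have zr := nc_circ c t r0.
rewrite Normc.normcM Normc.normcV; apply: ler_pM; rewrite ?nc_ge0 ?invr_ge0 ?nc_ge0 ?hM //.
by rewrite lef_pV2 ?posrE ?far // (lt_le_trans d0 (far _ zr)).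
Qed.

End CauchyFormula.

(** * Laurent decomposition in a disc with holes *)

Section Laurent.
Context {R : realType}.
Implicit Types (f h : R[i] -> R[i]) (a c z w : R[i]) (p q r M : R).

Lemma near_nc_lt c z q : nc (z - c) < q -> \forall w \near z, nc (w - c) < q.
Proof.
move=> zq; apply/nbhs_ncP; exists (q - nc (z - c)); first by rewrite subr_gt0.
by move=> w; have := nc_distD z w c; lra.
Qed.

Lemma near_nc_gt c z q : q < nc (z - c) -> \forall w \near z, q < nc (w - c).
Proof.
move=> zq; apply/nbhs_ncP; exists (nc (z - c) - q); first by rewrite subr_gt0.
by move=> w; have := nc_distD w z c; rewrite (ncBC z w); lra.
Qed.

(** Subtracting the principal part at a hole extends a holomorphic function over
    that hole. *)
Lemma fill_hole (U : set R[i]) f a r p q : 0 <= r -> r < p < q ->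
  (forall z, nc (z - a) <= q -> U z) ->
  (forall z, U z -> r < nc (z - a) -> holo_at f z) ->
  exists2 h, (forall z, U z -> holo_at h z) &
    forall z, p < nc (z - a) -> h z = f z + cauchy_tr f a p z.
Proof.
move=> r0 /andP[rp pq] qU hf.
have p0 : 0 <= p by exact: le_trans (ltW rp).
have q0 : 0 <= q by exact: le_trans (ltW pq).
have hf' z : p <= nc (z - a) <= q -> holo_at f z.
  by move=> /andP[pz zq]; apply: hf; [exact: qU|exact: lt_le_trans pz].
have cf s z : p <= s <= q -> nc (z - a) = s -> ccont_at f z.
  by move=> psq zs; apply/holo_at_ccont/hf'; rewrite zs.
have glue z : p < nc (z - a) < q -> f z + cauchy_tr f a p z = cauchy_tr f a q z.
  by move=> zpq; rewrite -{1}(cauchy_annulus p0 zpq hf') subrK.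
pose m := (p + q) / 2; have [pm mq] : p < m /\ m < q by rewrite /m; split; lra.
(* Inside the collar the annulus formula identifies the two definitions. *)
pose h z := if nc (z - a) <= m then cauchy_tr f a q z else f z + cauchy_tr f a p z.
exists h => [z Uz|z pz]; last by rewrite /h; case: leP => // zm; rewrite glue // pz (le_lt_trans zm).
have [zq|qz] := ltP (nc (z - a)) q.
  have : holo_at (cauchy_tr f a q) z.
    apply: cauchy_tr_holo; rewrite ?lt_eqF // => y; apply: cf; by rewrite lexx ltW.
  apply: holo_at_near; near=> y; rewrite /h; case: leP => // my.
  rewrite glue // (lt_trans pm my) /=; near: y; exact: near_nc_lt.
have : holo_at (fun y => f y + cauchy_tr f a p y) z.
  apply: holo_atD; first by apply: hf => //; exact: lt_le_trans (lt_trans rp pq) qz.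
  apply: cauchy_tr_holo => //; last by rewrite gt_eqF // (lt_le_trans pq).
  by move=> y; apply: cf; rewrite lexx ltW.
apply: holo_at_near; near=> y; rewrite /h; case: leP => // ym; exfalso; move: ym.
by apply/negP; rewrite -ltNge; near: y; apply: near_nc_gt; exact: lt_le_trans mq qz.
Unshelve. all: by end_near. Qed.

Lemma ccont_at_pole f z w : ccont_at f z -> z != w -> ccont_at (fun x => f x * (x - w)^-1) z.
Proof.
move=> cf zw; apply: ccont_atM => //; apply: ccont_atV; first by rewrite subr_eq0.
by apply: ccont_atD; [exact/holo_at_ccont/holo_at_id|exact: ccont_at_cst].
Qed.

Lemma cauchy_trB f h c r w : 0 <= r -> nc (w - c) != r ->
  (forall z, nc (z - c) = r -> ccont_at f z) -> (forall z, nc (z - c) = r -> ccont_at h z) ->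
  cauchy_tr (fun z => f z - h z) c r w = cauchy_tr f c r w - cauchy_tr h c r w.
Proof.
move=> r0 wr cf ch.
have zw z : nc (z - c) = r -> z != w by move=> zr; apply: (@neq_of_dist _ c); rewrite zr eq_sym.
have k1 z (zr : nc (z - c) = r) := ccont_at_pole (cf z zr) (zw z zr).
have k2 z (zr : nc (z - c) = r) := ccont_at_pole (ch z zr) (zw z zr).
have k3 z (zr : nc (z - c) = r) := ccont_atM (ccont_at_cst (-1) z) (k2 z zr).
rewrite /cauchy_tr -mulrBr; congr (_ * _).
rewrite -mulN1r -(circle_intZ (-1) r0 k2) -(circle_intD r0 k1 k3).
by apply: eq_circle_int => // z _; rewrite mulrBl mulN1r.
Qed.

Lemma eq_cauchy_tr f h c r w : 0 <= r -> (forall z, nc (z - c) = r -> f z = h z) ->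
  cauchy_tr f c r w = cauchy_tr h c r w.
Proof.
by move=> r0 fh; congr (_ * _); apply: eq_circle_int => // z zr; rewrite fh.
Qed.

(** Shrink the circle to its centre: the pole at [w] stays outside. *)
Lemma cauchy_tr_inner0 f c r w : 0 <= r -> r < nc (w - c) ->
  (forall z, nc (z - c) <= r -> holo_at f z) -> cauchy_tr f c r w = 0.
Proof.
move=> r0 rw hf; rewrite /cauchy_tr -(circle_int_eq (p := 0)) ?lexx ?r0 //.
  by rewrite circle_int0 mulr0.
move=> z /andP[_ zr]; apply: holo_at_pole; first exact: hf.
by apply: (@neq_of_dist _ c); rewrite lt_eqF // (le_lt_trans zr).
Qed.

(** Let the circle grow: the integrand decays like the inverse square of the radius,
    faster than the length of the circle increases. *)
Lemma cauchy_tr_outer0 f c r w M s : 0 <= r -> nc (w - c) < r -> s < r -> 0 <= M ->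
  (forall z, r <= nc (z - c) -> holo_at f z) ->
  (forall z, r <= nc (z - c) -> nc (f z) <= M / (nc (z - c) - s)) ->
  cauchy_tr f c r w = 0.
Proof.
move=> r0 wr sr M0 hf hM; rewrite /cauchy_tr.
suff -> : circle_int (fun z => f z * (z - w)^-1) c r = 0 by rewrite mulr0.
apply/eqP; rewrite -[_ == 0]negbK -nc_gt0 -leNgt; apply/ler_addgt0Pl => e e0; rewrite addr0.
set u := nc (w - c) in wr *; have u0 : 0 <= u by exact: nc_ge0.
have p0 : 0 < 2 * pi :> R by rewrite mulr_gt0 // pi_gt0.
pose L := r / (r - u); have L0 : 0 <= L by rewrite divr_ge0 // subr_ge0 ltW.
(* [L] bounds [Q / (Q - u)] for every [Q >= r]. *)
pose Q := Num.max r (s + 2 * pi * M * L / e).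
have rQ : r <= Q by rewrite le_max lexx.
have sQ : s < Q by exact: lt_le_trans rQ.
have uQ : u < Q by exact: lt_le_trans rQ.
have Q0 : 0 <= Q by exact: le_trans rQ.
have hz z : r <= nc (z - c) -> holo_at (fun z => f z * (z - w)^-1) z.
  move=> zr; apply: holo_at_pole; first exact: hf.
  by apply: (@neq_of_dist _ c); rewrite gt_eqF // (lt_le_trans wr).
rewrite (circle_int_eq (q := Q)) ?r0 //; last by move=> z /andP[zr _]; exact: hz.
apply: le_trans (circle_int_bound (M := M / (Q - s) * (Q - u)^-1) Q0 _ _) _.
- by move=> z zQ; apply/holo_at_ccont/hz; rewrite zQ.
- move=> t _; have zQ := nc_circ c t Q0; set z := circ c Q t in zQ *.
  rewrite Normc.normcM Normc.normcV; apply: ler_pM; rewrite ?nc_ge0 ?invr_ge0 ?nc_ge0 //.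
    by rewrite -{1}zQ; apply: hM; rewrite zQ.
  have h : Q - u <= nc (z - w) by exact: nc_dist_gt.
  by rewrite lef_pV2 ?posrE ?subr_gt0 // (lt_le_trans _ h) // subr_gt0.
have hL : Q / (Q - u) <= L.
  rewrite /L ler_pdivrMr ?subr_gt0 // mulrAC ler_pdivlMr ?subr_gt0 //.
  by have : u * r <= u * Q by [rewrite ler_wpM2l]; lra.
have -> : 2 * pi * (M / (Q - s) * (Q - u)^-1 * Q) = (2 * pi * M / (Q - s)) * (Q / (Q - u)) by ring.
apply: (@le_trans _ _ (2 * pi * M / (Q - s) * L)).
  by rewrite ler_wpM2l // divr_ge0 ?mulr_ge0 ?pi_ge0 // subr_ge0 ltW.
rewrite mulrAC ler_pdivrMr ?subr_gt0 //.
have : 2 * pi * M * L / e <= Q - s by rewrite lerBrDl /Q le_max lexx orbT.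
by rewrite ler_pdivrMr // mulrC [leRHS]mulrC.
Qed.

Section Holes.
Variables (a : nat -> R[i]) (rho r q : nat -> R) (R0 R1 : R).

(** Hole [j] has radius [rho j]; the integrals run over the circle of radius [r j], and
    the discs of radius [q j] are disjoint, so that each circle has a collar free of
    other holes. *)
Definition separated_holes n :=
  [/\ 0 < R1 < R0,
      forall j, (j < n)%N -> 0 <= rho j /\ rho j < r j < q j,
      forall j, (j < n)%N -> nc (a j) + q j < R1 &
      forall i j, (i < n)%N -> (j < n)%N -> i != j -> q i + q j < nc (a i - a j)].

(** Laurent decomposition over all the holes at once, by induction on their number:
    once the last hole is filled, the principal part that was removed has vanishing
    transforms over the outer circle and over the circles around the other holes. *)
Lemma cauchy_holes n f : separated_holes n ->
  (forall z, nc z < R0 -> (forall j, (j < n)%N -> rho j < nc (z - a j)) -> holo_at f z) ->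
  forall w, nc w < R1 -> (forall j, (j < n)%N -> r j < nc (w - a j)) ->
  f w = cauchy_tr f 0 R1 w - \sum_(j < n) cauchy_tr f (a j) (r j) w.
Proof.
elim: n f => [|n ih] f [/andP[R10 R1R0] hr inR disj] hf w wR1 wr.
  rewrite big_ord0 subr0 cauchy_disc ?subr0 // => z; rewrite subr0 => zR.
  by apply: hf => //; exact: le_lt_trans R1R0.
have hr' j (jn : (j < n)%N) := hr j (ltnW jn).
have [rn0 /andP[rrn rqn]] := hr n (ltnSn n).
have rn : 0 <= r n by exact: le_trans (ltW rrn).
have inn := inR n (ltnSn n).
pose U := [set z : R[i] | nc z < R0 /\ forall j, (j < n)%N -> rho j < nc (z - a j)].
have qU z : nc (z - a n) <= q n -> U z.
  move=> zq; split.
    by have := ncD (z - a n) (a n); rewrite subrK; move: zq inn R1R0; lra.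
  move=> j jn; have [_ /andP[h1 h2]] := hr' j jn.
  have := disj n j (ltnSn n) (ltnW jn); rewrite gtn_eqF // => /(_ isT).
  by have := nc_distD z (a n) (a j); rewrite (ncBC (a n) z); move: zq rn rqn h1 h2; lra.
have [|h hh hE] := @fill_hole U f (a n) _ _ _ rn0 (hr n (ltnSn n)).2 qU.
  move=> z [zR zj] zn; apply: hf => // j; rewrite ltnS leq_eqVlt => /predU1P[->//|]; exact: zj.
have cfn z : nc (z - a n) = r n -> ccont_at f z.
  move=> zr; apply/holo_at_ccont; have [z1 z2] : U z by apply: qU; rewrite zr ltW.
  by apply: hf => // j; rewrite ltnS leq_eqVlt => /predU1P[->|/z2//]; rewrite zr.
pose P := cauchy_tr f (a n) (r n).
have hP z : r n < nc (z - a n) -> holo_at P z.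
  by move=> rz; apply: cauchy_tr_holo => //; rewrite gt_eqF.
have hfP z : r n < nc (z - a n) -> f z = h z - P z by move=> rz; rewrite hE // addrK.
have sepn : separated_holes n.
  split; first by rewrite R10.
  - by move=> j jn; exact: hr'.
  - by move=> j jn; apply: inR; exact: ltnW.
  - by move=> i j ni nj; apply: disj; exact: ltnW.
have hh' z : nc z < R0 -> (forall j, (j < n)%N -> rho j < nc (z - a j)) -> holo_at h z.
  by move=> z1 z2; apply: hh.
have wrn : r n < nc (w - a n) by exact: wr.
rewrite (hfP _ wrn) (ih h sepn hh' w wR1) => [|j jn]; last by apply: wr; exact: ltnW.
rewrite big_ord_recr /= -/(P w) opprD addrA; congr (_ - _).
have wR1' : nc (w - 0) < R1 by rewrite subr0.
have out z : R1 <= nc z -> nc z - nc (a n) <= nc (z - a n) /\ r n < nc (z - a n).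
  move=> zR; have h1 := nc_sub_le z (a n); split=> //.
  by move: h1 zR inn rqn; lra.
have chj z : (forall j, (j < n)%N -> rho j < nc (z - a j)) -> nc z < R0 -> ccont_at h z.
  by move=> h1 h2; apply/holo_at_ccont/hh'.
congr (_ - _).
  have -> : cauchy_tr f 0 R1 w = cauchy_tr (fun z => h z - P z) 0 R1 w.
    apply: eq_cauchy_tr; first exact: ltW.
    by move=> z; rewrite subr0 => zR; apply: hfP; apply: (out z _).2; rewrite zR.
  rewrite cauchy_trB ?lt_eqF ?(ltW R10) //.
  - have [M M0 hM] := circle_bounded rn cfn.
    rewrite (@cauchy_tr_outer0 P 0 R1 w (M * r n) (nc (a n) + r n)) ?subr0 ?mulr_ge0 ?(ltW R10) //.
    + by move: inn rqn; lra.
    + by move=> z; rewrite subr0 => /out[_]; exact: hP.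
    move=> z; rewrite subr0 => zR; have [ga gb] := out z zR.
    apply: le_trans (cauchy_tr_bound rn gb cfn hM) _.
    rewrite ler_wpM2l ?mulr_ge0 // lef_pV2 ?posrE ?subr_gt0 //; move: ga zR inn rqn; lra.
  - move=> z; rewrite subr0 => zR; apply: chj; last by rewrite zR.
    move=> j jn; have [_ /andP[h1 h2]] := hr' j jn; have := inR j (ltnW jn).
    by have := nc_sub_le z (a j); rewrite zR; move: h1 h2; lra.
  - by move=> z; rewrite subr0 => zR; apply/holo_at_ccont/hP; apply: (out z _).2; rewrite zR.
apply: eq_bigr => j _; have jn := ltn_ord j.
have [rj0 /andP[rj rqj]] := hr' j jn; have rj' : 0 <= r j by exact: le_trans (ltW rj).
have dj : q n + q j < nc (a n - a j) by apply: (disj n j (ltnSn n) (ltnW jn)); rewrite gtn_eqF.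
have wrj : r j < nc (w - a j) by apply: wr; exact: ltnW.
have farn z : nc (z - a j) <= r j -> r n < nc (z - a n).
  by move=> zj; have := nc_distD z (a n) (a j); rewrite (ncBC (a n) z); move: zj dj rqn rqj; lra.
have -> : cauchy_tr f (a j) (r j) w = cauchy_tr (fun z => h z - P z) (a j) (r j) w.
  by apply: eq_cauchy_tr => // z zr; apply/hfP/farn; rewrite zr.
rewrite cauchy_trB ?gt_eqF //.
- by rewrite (@cauchy_tr_inner0 P) ?subr0 // => z /farn; exact: hP.
- move=> z zr; have zR : nc z < R0.
    by have := ncD (z - a j) (a j); rewrite subrK zr; have := inR j (ltnW jn); move: rqj R1R0; lra.
  apply: chj => // i ni; have [_ /andP[h1 h2]] := hr' i ni.
  have [->|ij] := eqVneq i j; first by rewrite zr.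
  have := disj i j (ltnW ni) (ltnW jn) ij.
  by have := nc_distD z (a i) (a j); rewrite (ncBC (a i) z) zr; move: h1 h2 rqj; lra.
- by move=> z zr; apply/holo_at_ccont/hP/farn; rewrite zr.
Qed.

(** The two kernels are subtracted before estimating, since their difference is
    [w / ((z - w) z)]; the absolute values allow the circle to be inside or outside. *)
Lemma cauchy_tr_diff_bound f c s w : 0 < s -> nc (w - c) != s -> nc c != s ->
  (forall z, nc (z - c) = s -> ccont_at f z) -> (forall z, nc (z - c) = s -> nc (f z) <= 1) ->
  nc (cauchy_tr f c s w - cauchy_tr f c s 0) <=
    nc w * s / (`|nc (w - c) - s| * `|nc c - s|).
Proof.
move=> s0 ws cs cf hf; have s0' := ltW s0.
have d1 : 0 < `|nc (w - c) - s| by rewrite normr_gt0 subr_eq0.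
have d2 : 0 < `|nc c - s| by rewrite normr_gt0 subr_eq0.
have f1 z : nc (z - c) = s -> `|nc (w - c) - s| <= nc (z - w).
  move=> zr; have h1 := nc_dist_gt w zr; have h2 := nc_dist_gt_inner w zr.
  by rewrite ler_norml; apply/andP; split; lra.
have f2 z : nc (z - c) = s -> `|nc c - s| <= nc z.
  move=> zr; have h1 := nc_dist_gt 0 zr; have h2 := nc_dist_gt_inner 0 zr.
  by move: h1 h2; rewrite subr0 sub0r normcN => h1 h2; rewrite ler_norml; apply/andP; split; lra.
have z1 z : nc (z - c) = s -> z != w by move=> zr; rewrite -subr_eq0 -nc_gt0 (lt_le_trans d1 (f1 z zr)).
have z2 z : nc (z - c) = s -> z != 0 by move=> zr; rewrite -nc_gt0 (lt_le_trans d2 (f2 z zr)).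
have k1 z (zr : nc (z - c) = s) := ccont_at_pole (cf z zr) (z1 z zr).
have k2 z (zr : nc (z - c) = s) := ccont_at_pole (cf z zr) (z2 z zr).
have k3 z (zr : nc (z - c) = s) := ccont_atM (ccont_at_cst (-1) z) (k2 z zr).
rewrite /cauchy_tr -mulrBr -mulN1r -(circle_intZ (-1) s0' k2) -(circle_intD s0' k1 k3).
have p0 : 0 < 2 * pi :> R by rewrite mulr_gt0 // pi_gt0.
rewrite Normc.normcM nc_real ger0_norm ?invr_ge0 ?(ltW p0) // ler_pdivrMl //.
have -> : nc w * s / (`|nc (w - c) - s| * `|nc c - s|) =
   1 * (nc w * (`|nc (w - c) - s|^-1 * `|nc c - s|^-1)) * s by rewrite invfM; ring.
apply: circle_int_bound => // [z zr|t ht]; first exact: ccont_atD (k1 z zr) (k3 z zr).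
have zr := nc_circ c t s0'; set z := circ c s t in zr *.
have -> : f z / (z - w) + -1 * (f z / (z - 0)) = f z * (w * ((z - w)^-1 * z^-1)).
  by rewrite subr0; field; rewrite (z2 z zr) subr_eq0 (z1 z zr).
rewrite !Normc.normcM !Normc.normcV.
apply: ler_pM; rewrite ?mulr_ge0 ?invr_ge0 ?nc_ge0 ?hf //.
rewrite ler_wpM2l ?nc_ge0 // ler_pM ?invr_ge0 ?nc_ge0 //.
  by rewrite lef_pV2 ?posrE ?f1 // (lt_le_trans d1 (f1 z zr)).
by rewrite lef_pV2 ?posrE ?f2 // (lt_le_trans d2 (f2 z zr)).
Qed.

(** The quantitative consequence used for the upper bounds: a hole contributes at
    most its radius divided by the distances to the two points. *)
Lemma bounded_holo_estimate n f w : separated_holes n ->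
  (forall z, nc z < R0 -> (forall j, (j < n)%N -> rho j < nc (z - a j)) ->
     holo_at f z /\ nc (f z) <= 1) -> f 0 = 0 ->
  nc w < R1 -> (forall j, (j < n)%N -> r j < nc (w - a j) /\ r j < nc (a j)) ->
  nc (f w) <= nc w / (R1 - nc w) +
    \sum_(j < n) nc w * r j / ((nc (w - a j) - r j) * (nc (a j) - r j)).
Proof.
move=> sep hf f0 wR wr; have [/andP[R10 R1R0] hr inR disj] := sep.
have hf' z : nc z < R0 -> (forall j, (j < n)%N -> rho j < nc (z - a j)) -> holo_at f z.
  by move=> h1 h2; case: (hf z h1 h2).
have -> : f w = f w - f 0 by rewrite f0 subr0.
rewrite (cauchy_holes sep hf' wR (fun j jn => (wr j jn).1)).
rewrite (cauchy_holes sep hf' (w := 0)) ?Normc.normc0 //; last first.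
  by move=> j jn; rewrite sub0r normcN; exact: (wr j jn).2.
have E (x y u v : R[i]) : x - u - (y - v) = (x - y) + (v - u) by ring.
rewrite E -sumrB.
have c0 z : nc z = R1 -> holo_at f z /\ nc (f z) <= 1.
  move=> zR; apply: hf; first by rewrite zR.
  move=> j jn; have [_ /andP[h1 h2]] := hr j jn; have := inR j jn.
  by have := nc_sub_le z (a j); rewrite zR; move: h1 h2; lra.
have cj j z : (j < n)%N -> nc (z - a j) = r j -> holo_at f z /\ nc (f z) <= 1.
  move=> jn zr; have [_ /andP[h1 h2]] := hr j jn.
  apply: hf.
    by have := ncD (z - a j) (a j); rewrite subrK zr; have := inR j jn; move: h2 R1R0; lra.
  move=> i ni; have [_ /andP[h3 h4]] := hr i ni.
  have [->|ij] := eqVneq i j; first by rewrite zr.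
  have := disj i j ni jn ij.
  by have := nc_distD z (a i) (a j); rewrite (ncBC (a i) z) zr; move: h3 h4 h2; lra.
apply: le_trans (ncD _ _) _; apply: lerD.
  apply: le_trans (cauchy_tr_diff_bound R10 _ _ _ _) _; rewrite ?subr0 ?Normc.normc0 ?lt_eqF //.
  - by move=> z; rewrite subr0 => /c0[/holo_at_ccont].
  - by move=> z; rewrite subr0 => /c0[].
  rewrite ltr0_norm ?subr_lt0 // opprB sub0r normrN gtr0_norm //.
  by rewrite -mulf_div divff ?mulr1 // gt_eqF.
apply: le_trans (nc_sum _ _ _) _; apply: ler_sum => j _; have jn := ltn_ord j.
have [w1 w2] := wr j jn; have [r0 /andP[h1 h2]] := hr j jn.
have w1' : nc (w - a j) != r j by rewrite gt_eqF.
have w2' : nc (a j) != r j by rewrite gt_eqF.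
have := cauchy_tr_diff_bound (le_lt_trans r0 h1) w1' w2'
  (fun z zr => holo_at_ccont (cj j z jn zr).1) (fun z zr => (cj j z jn zr).2).
by rewrite ncBC !gtr0_norm ?subr_gt0.
Qed.

End Holes.
End Laurent.

(** * The Moebius pseudodistance *)

Section Differentiability.
Context {R : realType} {V : normedModType R[i]}.

Lemma derivable_holo (F : V -> R[i]) (x v : V) :
  derivable F x v -> holo_at (fun l : R[i] => F (l *: v + x)) 0.
Proof.
move=> /cvg_ex[D /cvg_ncP hD]; exists D => e e0.
have := hD e e0; rewrite near_withinE => /nbhs_ncP[d d0 hd].
exists d => // l ld; have [->|l0] := eqVneq l 0.
  by rewrite !subrr mulr0 subr0 Normc.normc0 mulr0.
have := hd l ld l0; rewrite /= scale0r add0r subr0 => h.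
have -> : F (l *: v + x) - F x - D * l = l * (l^-1 *: (F (l *: v + x) - F x) - D).
  by rewrite mulrBr [l * (_ *: _)]mulrA divff // mul1r [D * l]mulrC.
by rewrite Normc.normcM mulrC ler_wpM2r ?nc_ge0 // ltW.
Qed.

Lemma holo_at_shift (f : R[i] -> R[i]) z : holo_at (fun l => f (l + z)) 0 -> holo_at f z.
Proof.
move=> [D hD]; exists D => e /hD[d d0 hd]; exists d => // w wd.
by have := hd (w - z); rewrite subr0 subrK add0r => /(_ wd).
Qed.

(** Complex lines are the only way in which differentiability on the normed space is
    used: every estimate takes place in one complex variable. *)
Lemma holo_at_line (F : V -> R[i]) (x v : V) (l : R[i]) :
  differentiable F (x + l *: v) -> holo_at (fun k => F (x + k *: v)) l.
Proof.
move=> /diff_derivable => /(_ v)/derivable_holo h; apply: holo_at_shift.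
apply: holo_at_near h; near=> k; by rewrite scalerDl addrCA.
Unshelve. all: by end_near. Qed.

End Differentiability.

Section DifferentiablePlane.
Context {R : realType}.

Lemma differentiable_holo (f : R[i] -> R[i]) z : differentiable f z -> holo_at f z.
Proof.
move=> df; have := @holo_at_line R R[i] f 0 1 z.
rewrite add0r /GRing.scale /= mulr1 => /(_ df).
by apply: holo_at_near; near=> k; rewrite add0r mulr1.
Unshelve. all: by end_near. Qed.

Lemma holo_differentiable (f : R[i] -> R[i]) z : holo_at f z -> differentiable f z.
Proof.
move=> [D hD]; apply/derivable1_diffP; apply/cvg_ex; exists D.
apply/cvg_ncP => e e0; have e2 : 0 < e / 2 by rewrite divr_gt0.
have [d d0 hd] := hD _ e2.
rewrite near_withinE; apply/nbhs_ncP; exists d => // l; rewrite subr0 => ld l0.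
have := hd (l + z); rewrite addrK => /(_ ld) h.
rewrite /= [l *: 1]mulr1.
have -> : l^-1 *: (f (l + z) - f z) - D = l^-1 * (f (l + z) - f z - D * l).
  by rewrite mulrBr [D * l]mulrC mulrA mulVf // mul1r.
rewrite Normc.normcM Normc.normcV mulrC ltr_pdivrMr ?nc_gt0 //.
by apply: le_lt_trans h _; rewrite ltr_pM2r ?nc_gt0 //; lra.
Qed.

End DifferentiablePlane.

Section SchwarzPick.
Context {R : realType}.
Implicit Types (a b z w : R[i]).

Lemma nc_sqr_mobius a b :
  nc (1 - a^*%C * b) ^+ 2 - nc (b - a) ^+ 2 = (1 - nc a ^+ 2) * (1 - nc b ^+ 2).
Proof.
rewrite !nc_sqr; case: a => a1 a2; case: b => b1 b2 /=; ring.
Qed.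

Lemma nc_conj a : nc a^*%C = nc a.
Proof. by case: a => x y /=; rewrite sqrrN. Qed.

Lemma mobius_denom_neq0 a b : nc a < 1 -> nc b < 1 -> 1 - a^*%C * b != 0.
Proof.
move=> a1 b1; rewrite -nc_gt0; have := nc_sub_le 1 (a^*%C * b).
rewrite Normc.normc1 Normc.normcM nc_conj; apply: lt_le_trans.
rewrite subr_gt0; apply: le_lt_trans b1; rewrite ler_piMl ?nc_ge0 // ltW //.
Qed.

(** A quantitative Schwarz-Pick lemma, obtained by moving the value at the centre to
    zero with a disc automorphism. *)
Lemma disc_step (g : R[i] -> R[i]) m : 0 <= m < 1 ->
  (forall l, nc l < 4 -> holo_at g l /\ nc (g l) < 1) -> nc (g 0) <= m ->
  nc (g 1) <= 1 - 3 * (1 - m) / 16.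
Proof.
move=> /andP[m0 m1] hg gm; set a := g 0 in gm *.
have a1 : nc a < 1 by exact: le_lt_trans m1.
pose phi l := (g l - a) * (1 - a^*%C * g l)^-1.
have den l : nc l < 4 -> 1 - a^*%C * g l != 0.
  by move=> /hg[_ gl]; exact: mobius_denom_neq0.
have hphi l : nc l < 4 -> holo_at phi l /\ nc (phi l) <= 1.
  move=> l4; have [hgl gl] := hg l l4; split.
    apply: holo_atM; first by apply: holo_atD => //; exact: holo_at_cst.
    apply: holo_atV; first exact: den.
    apply: holo_atD; first exact: holo_at_cst.
    by apply: holo_atN; apply: holo_atM => //; exact: holo_at_cst.
  rewrite Normc.normcM Normc.normcV ler_pdivrMr ?nc_gt0 ?den // mul1r.
  rewrite -ler_sqr ?nnegrE ?nc_ge0 // -subr_ge0 nc_sqr_mobius.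
  by rewrite mulr_ge0 // subr_ge0 expr_le1 ?nc_ge0 // ltW.
have phi0 : phi 0 = 0 by rewrite /phi -/a subrr mul0r.
(* The estimate without holes, over the circle of radius [3], gives [1 / (3 - 1)]. *)
have phi1 : nc (phi 1) <= 1 / 2.
  have := @bounded_holo_estimate R (fun=> 0) (fun=> 0) (fun=> 0) (fun=> 0) 4 3 0 phi 1 _ _ phi0 _ _.
  rewrite Normc.normc1 big_ord0 addr0 => h; apply: le_trans (h _ _ _ _) _ => //.
  - by split=> //; lra.
  - by move=> z z4 _; exact: hphi.
  - by lra.
  - by have -> : 3 - 1 = 2 :> R by ring.
have one4 : nc (1 : R[i]) < 4 by rewrite Normc.normc1; lra.
have [_ g1] := hg 1 one4; have d1 := den 1 one4.
move: phi1; rewrite /phi Normc.normcM Normc.normcV ler_pdivrMr ?nc_gt0 // => h.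
have low : 1 - nc a <= nc (1 - a^*%C * g 1).
  have := nc_sub_le 1 (a^*%C * g 1); rewrite Normc.normc1 Normc.normcM nc_conj.
  apply: le_trans; rewrite lerD2l lerN2 ler_piMr ?nc_ge0 // ltW //.
have := nc_sqr_mobius a (g 1).
move: (nc (1 - _)) (nc (g 1 - a)) (nc (g 1)) (nc a) h low g1 gm a1
  (nc_ge0 (1 - a^*%C * g 1)) (nc_ge0 (g 1 - a)) (nc_ge0 (g 1)) (nc_ge0 a)
  => D N G A h low g1 gm a1 D0 N0 G0 A0 E.
have h1 : N ^+ 2 <= D ^+ 2 / 4.
  have -> : D ^+ 2 / 4 = (1 / 2 * D) ^+ 2 by field.
  by rewrite lerXn2r ?nnegrE // mulr_ge0.
have h2 : 3 / 4 * (1 - A) ^+ 2 <= (1 - A ^+ 2) * (1 - G ^+ 2).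
  have : (1 - A) ^+ 2 <= D ^+ 2 by rewrite lerXn2r ?nnegrE ?subr_ge0 // ltW.
  by rewrite -E; lra.
have h3 : 3 / 4 * (1 - A) <= (1 + A) * (1 - G ^+ 2).
  have A10 : 0 < 1 - A by rewrite subr_gt0.
  rewrite -(ler_pM2l A10).
  have -> : (1 - A) * (3 / 4 * (1 - A)) = 3 / 4 * (1 - A) ^+ 2 by ring.
  by have -> : (1 - A) * ((1 + A) * (1 - G ^+ 2)) = (1 - A ^+ 2) * (1 - G ^+ 2) by ring.
have h4 : 3 / 8 * (1 - m) <= 1 - G ^+ 2.
  have G1 : 0 <= 1 - G ^+ 2 by rewrite subr_ge0 expr_le1 // ltW.
  have : (1 + A) * (1 - G ^+ 2) <= 2 * (1 - G ^+ 2) by rewrite ler_wpM2r //; lra.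
  by lra.
have G2 : G ^+ 2 >= 2 * G - 1 by have := sqr_ge0 (G - 1); rewrite sqrrB expr1n mulr1; lra.
lra.
Qed.

End SchwarzPick.

Section NormedSpace.
Context {R : realType} {V : normedModType R[i]}.
Implicit Types (x y v : V).

Definition rnorm v : R := complex.Re `|v|.

Lemma rnormE v : `|v| = (rnorm v)%:C.
Proof. by rewrite /rnorm; have := normr_ge0 v => /ger0_real/RRe_real. Qed.

Lemma rnorm_ge0 v : 0 <= rnorm v.
Proof. by have := normr_ge0 v; rewrite rnormE lecR. Qed.

Lemma rnormD v w : rnorm (v + w) <= rnorm v + rnorm w.
Proof. by have := ler_normD v w; rewrite !rnormE -rmorphD lecR. Qed.

Lemma rnormZ (l : R[i]) v : rnorm (l *: v) = nc l * rnorm v.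
Proof. by have := normrZ l v; rewrite !rnormE normr_nc -rmorphM => /complexI. Qed.

Lemma nbhs_rnormP x (A : set V) :
  nbhs x A <-> exists2 e, 0 < e & forall y, rnorm (y - x) < e -> A y.
Proof.
split.
  move=> /nbhs_normP [e /= e0 eA].
  have [re ie] : 0 < complex.Re e /\ e = (complex.Re e)%:C.
    by move: e0; rewrite ltcE /= => /andP[/eqP i r]; split => //;
      case: e i {eA r} => a b /= ->.
  exists (complex.Re e) => // w wz; apply: eA => /=.
  by rewrite /ball_ /= distrC ie rnormE ltcR.
move=> [e e0 eA]; apply/nbhs_normP; exists e%:C; first by rewrite /= ltcR.
move=> w /=; rewrite /ball_ /= distrC rnormE ltcR; exact: eA.
Qed.

End NormedSpace.

Section MobiusPseudodistance.
Context {R : realType} {V : normedModType R[i]}.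
Implicit Types (G : set V) (x y v z a : V) (m : R).

Definition admissible G a : set (V -> R[i]) :=
  [set f | holomorphic_to_disk G f /\ f a = 0].

Lemma admissible0 G a : admissible G a (fun=> 0).
Proof.
split=> //; split=> [z Gz|z Gz]; last by rewrite Normc.normc0.
exact: differentiable_cst.
Qed.

Lemma mobius_ge G a z f : G z -> admissible G a f -> nc (f z) <= mobius_pdist G z a.
Proof.
move=> Gz hf; apply: ub_le_sup; last by exists f.
by exists 1 => _ [h [[_ hh] _] <-]; apply/ltW/hh.
Qed.

Lemma mobius_le G a z m : (forall f, admissible G a f -> nc (f z) <= m) ->
  mobius_pdist G z a <= m.
Proof.
move=> h; apply: ge_sup; first by exists (nc (0 : R[i])); exists (fun=> 0) => //; exact: admissible0.
by move=> _ [f hf <-]; exact: h.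
Qed.

Lemma mobius_ge0 G a z : G z -> 0 <= mobius_pdist G z a.
Proof.
by move=> Gz; have := mobius_ge Gz (admissible0 G a); rewrite Normc.normc0.
Qed.

Lemma mobius_refl G a : G a -> mobius_pdist G a a = 0.
Proof.
move=> Ga; apply/le_anti; rewrite mobius_ge0 // andbT; apply: mobius_le.
by move=> f [_ ->]; rewrite Normc.normc0.
Qed.

Lemma mobius_step G a x v : (forall l : R[i], nc l < 4 -> G (x + l *: v)) ->
  mobius_pdist G x a < 1 -> mobius_pdist G (x + v) a < 1.
Proof.
move=> hl x1; set m := mobius_pdist G x a in x1 *.
have Gx : G x by have := hl 0; rewrite Normc.normc0 scale0r addr0; apply; lra.
have m0 : 0 <= m by exact: mobius_ge0.
apply: (@le_lt_trans _ _ (1 - 3 * (1 - m) / 16)); last by lra.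
apply: mobius_le => f hf; have [[hol hlt] fa] := hf.
have := @disc_step R (fun l => f (x + l *: v)) m.
rewrite m0 x1 scale1r scale0r addr0 => /(_ isT); apply; last exact: mobius_ge.
by move=> l l4; split; [apply/holo_at_line/hol/hl|apply/hlt/hl].
Qed.

(** The points at pseudodistance less than [1] form an open and closed subset of [G]:
    [mobius_step] carries the strict inequality across small discs, with uniform bounds
    over all competing functions. Beyond this bound [artanh] has no meaning. *)
Lemma mobius_lt1 G a z : is_domain G -> G a -> G z -> mobius_pdist G z a < 1.
Proof.
move=> [oG cG _] Ga Gz.
have loc x : G x -> exists2 e, 0 < e & forall y y', rnorm (y - x) < e -> rnorm (y' - x) < e ->
    mobius_pdist G y a < 1 -> G y' /\ mobius_pdist G y' a < 1.
  move=> Gx; have /nbhs_rnormP[e e0 he] : nbhs x G by exact: open_nbhs_nbhs.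
  exists (e / 16); first by rewrite divr_gt0.
  have sym (u u' : V) : rnorm (u - u') = rnorm (u' - u).
    by rewrite -opprB -scaleN1r rnormZ normcN Normc.normc1 mul1r.
  move=> y y' hy hy' m1; split; first by apply: he; lra.
  rewrite -(subrK y y') addrC; apply: mobius_step => // l l4; apply: he.
  have -> : y + l *: (y' - y) - x = (y - x) + l *: ((y' - x) + (x - y)).
    by rewrite addrA subrK addrAC.
  apply: le_lt_trans (rnormD _ _) _; rewrite rnormZ.
  have h : rnorm (y' - x + (x - y)) <= e / 8.
    apply: le_trans (rnormD _ _) _; rewrite (sym x); lra.
  have : nc l * rnorm (y' - x + (x - y)) <= 4 * (e / 8).
    by apply: ler_pM; rewrite ?nc_ge0 ?rnorm_ge0 // ltW.
  by lra.
pose S := [set x | G x /\ mobius_pdist G x a < 1].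
suff SG : S = G by have : S z by [rewrite SG]; case.
apply: cG.
- by exists a; split=> //; rewrite mobius_refl.
- exists S; last by apply/seteqP; split=> x // [].
  rewrite openE => x [Gx mx]; have [e e0 he] := loc x Gx.
  apply/nbhs_rnormP; exists e => // y hy; apply: (he x y) => //.
  by rewrite subrr /rnorm normr0.
- exists (closure S); first exact: closed_closure.
  apply/seteqP; split=> [x Sx|x [Gx cx]]; first by split; [case: Sx|exact: subset_closure].
  have [e e0 he] := loc x Gx.
  have [y [[Gy my] hy]] : (S `&` [set y | rnorm (y - x) < e]) !=set0.
    by apply: cx; apply/nbhs_rnormP; exists e.
  by apply: (he y x) => //; rewrite subrr /rnorm normr0.
Qed.

(** A supremum of continuous functions is lower semicontinuous. *)
Lemma mobius_sublevel_closed G a m z :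
  closure [set y | G y /\ mobius_pdist G y a <= m] z -> G z -> mobius_pdist G z a <= m.
Proof.
move=> cz Gz; apply: mobius_le => f hf; rewrite leNgt; apply/negP => mf.
have [[hol _] _] := hf.
have cf : ccont_at f z by apply/ccont_atP; exact/differentiable_continuous/hol.
have near_gt : \forall y \near z, m < nc (f y).
  have := cf (nc (f z) - m); rewrite subr_gt0 => /(_ mf); apply: filterS => y.
  by have := nc_sub_le (f z) (f y); rewrite ncBC; lra.
have [y [[Gy my] /= hy]] : ([set y | G y /\ mobius_pdist G y a <= m] `&`
    [set y | m < nc (f y)]) !=set0.
  exact: cz.
by have := mobius_ge Gy hf; lra.
Qed.

End MobiusPseudodistance.

Section Artanh.
Context {R : realType}.
Implicit Types x y : R.

Lemma artanh_lt x y : -1 < x < 1 -> -1 < y < 1 -> (artanh x < artanh y) = (x < y).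
Proof.
move=> /andP[x0 x1] /andP[y0 y1]; rewrite /artanh ltr_pM2r ?invr_gt0 //.
have hx : 0 < 1 - x by lra. have hy : 0 < 1 - y by lra.
have hx' : 0 < 1 + x by lra. have hy' : 0 < 1 + y by lra.
rewrite ltr_ln ?posrE ?divr_gt0 // ltr_pdivrMr // mulrAC ltr_pdivlMr //.
by apply/idP/idP; lra.
Qed.

Lemma artanh_le x y : -1 < x < 1 -> -1 < y < 1 -> (artanh x <= artanh y) = (x <= y).
Proof. by move=> hx hy; rewrite !leNgt artanh_lt. Qed.

Lemma artanh0 : artanh 0 = 0 :> R.
Proof. by rewrite /artanh addr0 subr0 divr1 ln1 mul0r. Qed.

End Artanh.

Section CaratheodoryBalls.
Context {R : realType} {V : normedModType R[i]}.
Variables (G : set V) (a : V).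
Hypotheses (domG : is_domain G) (Ga : G a).

Let itv z : G z -> -1 < mobius_pdist G z a < 1.
Proof.
by move=> Gz; rewrite mobius_lt1 // andbT (lt_le_trans _ (mobius_ge0 a Gz)).
Qed.

Lemma open_cballE m : 0 <= m < 1 ->
  open_cball G a (artanh m) = [set z | G z /\ mobius_pdist G z a < m].
Proof.
move=> /andP[m0 m1]; apply/seteqP; split=> z [Gz h]; split=> //; move: h;
  by rewrite /caratheodory_pdist artanh_lt ?itv // m1 (lt_le_trans _ m0).
Qed.

Lemma closed_cballE m : 0 <= m < 1 ->
  closed_cball G a (artanh m) = [set z | G z /\ mobius_pdist G z a <= m].
Proof.
move=> /andP[m0 m1]; apply/seteqP; split=> z [Gz h]; split=> //; move: h;
  by rewrite /caratheodory_pdist artanh_le ?itv // m1 (lt_le_trans _ m0).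
Qed.

End CaratheodoryBalls.

(** * Balls at a potential well; discs with holes *)

Section Well.
Context {R : realType} {V : normedModType R[i]}.
Implicit Types (G W K : set V) (a p z : V) (m b : R).

Lemma relatively_compactW G K (A : set V) : compact K -> K `<=` G -> A `<=` K ->
  relatively_compact_in G A.
Proof.
move=> cK KG AK; split; first exact: subset_trans KG.
have clK : closure A `<=` K.
  have /closure_id -> : closed K by apply: compact_closed => //; exact: norm_hausdorff.
  exact: closure_subset.
have -> : closure_in G A = closure A.
  by apply/seteqP; split=> [z [] //|z cz]; split=> //; exact/KG/clK.
exact: subclosed_compact (@closed_closure _ _) cK clK.
Qed.

(** A potential well of the Moebius pseudodistance away from the base point makes a
    ball disconnected, and the radius at its bottom is one where the closed ball is
    larger than the closure of the open ball. *)
Lemma well_balls G a Wo Wc p m b K : is_domain G -> G a ->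
  open Wo -> closed Wc -> Wo `<=` Wc -> ~ Wc a ->
  (forall z, G z -> Wc z -> ~ Wo z -> b <= mobius_pdist G z a) ->
  (forall z, G z -> Wo z -> m <= mobius_pdist G z a) ->
  G p -> Wo p -> mobius_pdist G p a <= m -> 0 < m -> m < b -> b < 1 ->
  compact K -> K `<=` G -> (forall z, G z -> mobius_pdist G z a < b -> K z) ->
  [/\ 0 < artanh m < artanh b,
      ~ connected (open_cball G a (artanh b)),
      relatively_compact_in G (open_cball G a (artanh b)) &
      closure_in G (open_cball G a (artanh m)) `<` closed_cball G a (artanh m)].
Proof.
move=> dG Ga oWo cWc WoWc Wa bar low Gp Wop pm m0 mb b1 cK KG sub.
have m1 : m < 1 by exact: lt_trans b1.
have b0 : 0 < b by exact: lt_trans mb.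
have mI : 0 <= m < 1 by rewrite ltW.
have bI : 0 <= b < 1 by rewrite ltW.
rewrite !open_cballE // closed_cballE //; split.
- by rewrite -{1}artanh0 !artanh_lt ?m0 ?mb //; lra.
- move=> /(_ [set z | (G z /\ mobius_pdist G z a < b) /\ Wo z]) h.
  have : [set z | (G z /\ mobius_pdist G z a < b) /\ Wo z] = [set z | G z /\ mobius_pdist G z a < b].
    apply: h.
    + by exists p; split=> //; split=> //; exact: le_lt_trans mb.
    + by exists Wo => //; apply/seteqP; split=> z [].
    + exists Wc => //; apply/seteqP; split=> z [[Gz zb] Wz]; split=> //.
        exact: WoWc.
      by apply: contrapT => /(bar z Gz Wz); rewrite leNgt zb.
  move=> /seteqP[_ /(_ a)] /=; case; first by rewrite mobius_refl.
  by move=> _ /WoWc.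
- by apply: (relatively_compactW cK KG) => z [Gz /(sub z Gz)].
- split; first by move=> z [cz Gz]; split=> //; apply: (mobius_sublevel_closed _ Gz);
    apply: closure_subset cz => y [Gy /ltW].
  move=> /(_ p (conj Gp pm)) [cp _].
  have [z [[Gz zm] Woz]] := cp Wo (open_nbhs_nbhs (conj oWo Wop)).
  by have := low z Gz Woz; rewrite leNgt zm.
Qed.

(** The Moebius pseudodistance is lower semicontinuous, as a supremum of continuous
    functions, so it attains its minimum on compact sets. *)
Lemma mobius_min G a W : compact W -> W `<=` G -> W !=set0 ->
  exists2 p, W p & forall z, W z -> mobius_pdist G p a <= mobius_pdist G z a.
Proof.
move=> cW WG [w0 Ww0].
pose S := [set mobius_pdist G z a | z in W]; pose m := inf S.
have hS : has_inf S.
  split; first by exists (mobius_pdist G w0 a); exists w0.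
  by exists 0 => _ [z Wz <-]; apply/mobius_ge0/WG.
have pick (n : nat) : {w | W w /\ mobius_pdist G w a < m + n.+1%:R^-1}.
  apply: cid; have e0 : 0 < n.+1%:R^-1 :> R by rewrite invr_gt0.
  by have [_ [w Ww <-] h] := inf_adherent e0 hS; exists w.
pose w n := sval (pick n).
have Ww n : W (w n) by rewrite /w; case: (pick n) => ? [].
have mw n : mobius_pdist G (w n) a < m + n.+1%:R^-1 by rewrite /w; case: (pick n) => ? [].
have [|p [Wp clp]] := cW (w @ \oo) _; first by exists 0%N => // n _; exact: Ww.
exists p => // z Wz; apply: (@le_trans _ _ m); last by apply: ge_inf; [exact: hS.2|exists z].
apply: mobius_le => f hf; rewrite leNgt; apply/negP => mf; have [[hol _] _] := hf.
pose e := (nc (f p) - m) / 2; have e0 : 0 < e by rewrite /e divr_gt0 // subr_gt0.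
have cf : ccont_at f p by apply/ccont_atP; exact/differentiable_continuous/hol/WG.
have near_gt : \forall y \near p, m + e < nc (f y).
  have := cf e e0; apply: filterS => y.
  by have := nc_sub_le (f p) (f y); rewrite ncBC /e; lra.
have tail : (w @ \oo) [set y | W y /\ mobius_pdist G y a < m + e].
  have [N _ hN] := near_infty_natSinv_lt (PosNum e0).
  by exists N => // n Nn; split=> //; apply: lt_trans (mw n) _; rewrite ltrD2l; exact: hN.
have [y [[Wy my] /= fy]] := clp _ _ tail near_gt.
by have := mobius_ge (WG y Wy) hf; lra.
Qed.

End Well.

Section PlaneCompact.
Context {R : realType}.
Implicit Types (z : R[i]) (r : R).

Lemma compact_disc r : compact [set z : R[i] | nc z <= r].
Proof.
pose S : set (R * R) := `[- r, r] `*` `[- r, r].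
pose F (x : R * R) : R[i] := x.1 +i* x.2.
have cF : continuous F.
  by move=> x; apply: cvg_complex; [exact: cvg_fst|exact: cvg_snd].
have cS : compact S by apply: compact_setX; exact: segment_compact.
have cI : compact (F @` S) by apply: continuous_compact => //; exact: continuous_subspaceT.
apply: subclosed_compact cI _.
  have -> : [set z : R[i] | nc z <= r] = (@Normc.normc R) @^-1` [set x | x <= r] by [].
  apply: preimage_closed; first by move=> z _; exact: continuous_nc.
  exact: closed_le.
move=> z zr; exists (complex.Re z, complex.Im z); last by case: z {zr}.
have h1 := Re_le_nc z; have h2 := Im_le_nc z.
by split=> /=; rewrite in_itv /= -ler_norml; [apply: le_trans h1 _|apply: le_trans h2 _].
Qed.

Lemma continuous_nc_dist (a : R[i]) : continuous (fun z : R[i] => nc (z - a)).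
Proof.
by move=> z; have /holo_at_ccont/ccont_at_nc := holo_atD (holo_at_id z) (holo_at_cst (- a) z).
Qed.

Lemma closed_nc_ge (a : R[i]) r : closed [set z : R[i] | r <= nc (z - a)].
Proof.
have -> : [set z : R[i] | r <= nc (z - a)] = (fun z => nc (z - a)) @^-1` [set x | r <= x] by [].
by apply: preimage_closed; [move=> z _; exact: continuous_nc_dist|exact: closed_ge].
Qed.

Lemma closed_nc_le (a : R[i]) r : closed [set z : R[i] | nc (z - a) <= r].
Proof.
have -> : [set z : R[i] | nc (z - a) <= r] = (fun z => nc (z - a)) @^-1` [set x | x <= r] by [].
by apply: preimage_closed; [move=> z _; exact: continuous_nc_dist|exact: closed_le].
Qed.

Lemma open_nc_lt (a : R[i]) r : open [set z : R[i] | nc (z - a) < r].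
Proof. by rewrite openE => z zr; exact: near_nc_lt. Qed.

Lemma open_nc_gt (a : R[i]) r : open [set z : R[i] | r < nc (z - a)].
Proof. by rewrite openE => z zr; exact: near_nc_gt. Qed.

Definition holed_disc (R0 : R) (n : nat) (a : nat -> R[i]) (rho : nat -> R) : set R[i] :=
  [set z | nc z < R0 /\ forall j, (j < n)%N -> rho j < nc (z - a j)].

(** The compact subset where [nc z / R0] and all the [rho j / nc (z - a j)] are at
    most [m]; one of these quantities tends to [1] at the boundary of the holed disc. *)
Definition holed_core (R0 : R) (n : nat) (a : nat -> R[i]) (rho : nat -> R) (m : R) : set R[i] :=
  [set z | nc z <= R0 * m /\ forall j, (j < n)%N -> rho j / m <= nc (z - a j)].

Lemma open_forall_lt (T : topologicalType) (P : nat -> set T) n :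
  (forall j, open (P j)) -> open [set z | forall j, (j < n)%N -> P j z].
Proof.
move=> oP; elim: n => [|n ih].
  by rewrite (_ : [set z | _] = setT); [exact: openT|apply/seteqP; split].
rewrite (_ : [set z | _] = [set z | forall j, (j < n)%N -> P j z] `&` P n); first exact: openI.
apply/seteqP; split=> [z h|z [h1 h2] j].
  by split=> [j jn|]; apply: h => //; exact: ltnW.
by rewrite ltnS leq_eqVlt => /predU1P[->|/h1].
Qed.

Lemma open_holed_disc R0 n a rho : open (holed_disc R0 n a rho).
Proof.
apply: openI.
  by have := @open_nc_lt 0 R0; under eq_set do rewrite subr0.
by apply: open_forall_lt => j; exact: open_nc_gt.
Qed.

Lemma compact_holed_core R0 n a rho m : compact (holed_core R0 n a rho m).
Proof.
have -> : holed_core R0 n a rho m = [set z | forall j, (j < n)%N -> rho j / m <= nc (z - a j)] `&`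
    [set z | nc z <= R0 * m] by apply/seteqP; split=> z [].
rewrite setIC; apply: compact_closedI; first exact: compact_disc.
elim: n => [|n ih].
  by rewrite (_ : [set z | _] = setT); [exact: closedT|apply/seteqP; split].
rewrite (_ : [set z | _] = [set z | forall j, (j < n)%N -> rho j / m <= nc (z - a j)] `&`
   [set z | rho n / m <= nc (z - a n)]); first by apply: closedI => //; exact: closed_nc_ge.
apply/seteqP; split=> [z h|z [h1 h2] j].
  by split=> [j jn|]; apply: h => //; exact: ltnW.
by rewrite ltnS leq_eqVlt => /predU1P[->|/h1].
Qed.

Lemma holed_core_sub R0 n a rho m : 0 < R0 -> (forall j, (j < n)%N -> 0 < rho j) ->
  0 < m < 1 -> holed_core R0 n a rho m `<=` holed_disc R0 n a rho.
Proof.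
move=> R00 rho0 /andP[m0 m1] z [zR zj]; split.
  by apply: le_lt_trans zR _; rewrite gtr_pMr.
move=> j jn; apply: lt_le_trans (zj j jn); rewrite ltr_pdivlMr //.
by rewrite gtr_pMr // rho0.
Qed.

End PlaneCompact.

(** * Connectedness and connectivity of discs with holes *)

Section ConnectedTools.
Context {R : realType} {T : topologicalType}.

Lemma connected_star (S : set T) x0 :
  (forall z, S z -> exists A, [/\ connected A, A `<=` S, A x0 & A z]) -> connected S.
Proof.
move=> h; have -> : S = connected_component S x0; last exact: component_connected.
apply/seteqP; split; last exact: connected_component_sub.
by move=> z /h[A [cA AS A0 Az]]; exists A.
Qed.

Lemma connected_path (g : R -> T) a b : continuous g -> connected (g @` `[a, b]).
Proof.
move=> cg; apply: connected_continuous_connected; first exact: segment_connected.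
exact: continuous_subspaceT.
Qed.

Lemma component_clopen (X E O F : set T) x : E x -> E `<=` X -> connected E ->
  open O -> closed F -> E = X `&` O -> E = X `&` F -> connected_component X x = E.
Proof.
move=> Ex EX cE oO cF EO EF; apply/seteqP; split; last by move=> y Ey; exists E.
move=> y [C [Cx CX cC] Cy].
have -> // : E = C `|` E; last by left.
apply/seteqP; split=> [z|z]; first by right.
move=> [Cz|//]; suff CE : C `&` E = C by move: Cz; rewrite -CE => -[].
apply: cC; first by exists x.
- exists O => //; rewrite EO setIA; congr (_ `&` _); exact: setIidl.
- exists F => //; rewrite EF setIA; congr (_ `&` _); exact: setIidl.
Qed.

End ConnectedTools.

Section PlaneConnected.
Context {R : realType}.
Implicit Types (a z : R[i]) (p q r : R).

Lemma ccont_continuous (T : topologicalType) (F : T -> R[i]) : ccont F -> continuous F.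
Proof. by move=> cF x; apply/ccont_atP; exact: cF. Qed.

Lemma connected_star_shaped a (S : set R[i]) : S a ->
  (forall z, S z -> forall t, 0 <= t <= 1 -> S (a + t%:C * (z - a))) -> connected S.
Proof.
move=> Sa star; apply: (@connected_star _ S a) => z Sz.
exists ((fun t : R => a + t%:C * (z - a)) @` `[0, 1]); split.
- apply: connected_path; apply: ccont_continuous => t.
  apply: (ccont_atD (F := fun=> a)); first exact: ccont_at_cst.
  by apply: (ccont_atM (G := fun=> z - a)); [exact: ccont_real|exact: ccont_at_cst].
- by move=> _ [t t01 <-]; apply: star => //; move: t01; rewrite /= in_itv.
- by exists 0; rewrite ?mul0r ?addr0 //= in_itv /= lexx ler01.
- by exists 1; rewrite ?mul1r 1?addrC ?subrK //= in_itv /= lexx ler01.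
Qed.

Lemma polar_form z : nc z = 1 -> exists t, z = cis t.
Proof.
move=> z1; have := nc_sqr z; rewrite z1 expr1n; case: z {z1} => x y /= xy.
have x1 : -1 <= x <= 1.
  by rewrite -ler_norml -[_ <= _](@expr_le1 _ 2) // real_normK ?num_real //; have := sqr_ge0 y; lra.
have sa : sin (acos x) = `|y|.
  by rewrite sin_acos // -sqrtr_sqr; congr Num.sqrt; lra.
have [y0|y0] := leP 0 y.
  by exists (acos x); rewrite /cis acosK ?in_itv //= sa ger0_norm.
by exists (- acos x); rewrite /cis cosN sinN acosK ?in_itv //= sa ltr0_norm // opprK.
Qed.

Lemma polar_form_at a z : z != a -> exists t, z = circ a (nc (z - a)) t.
Proof.
rewrite -subr_eq0 => za; have n0 : nc (z - a) != 0 by rewrite gt_eqF // nc_gt0.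
have [|t ht] := @polar_form ((nc (z - a))^-1%:C * (z - a)).
  by rewrite Normc.normcM nc_real ger0_norm ?invr_ge0 ?nc_ge0 // mulVf.
exists t; rewrite /circ -ht mulrA -rmorphM /= divff // mul1r addrC subrK //.
Qed.

(** Any point is joined to a fixed one by an arc followed by a radial segment. *)
Lemma connected_annulus a p q : 0 <= p < q -> connected [set z | p < nc (z - a) < q].
Proof.
move=> /andP[p0 pq]; set S := [set z | _]; pose m := (p + q) / 2.
have [pm mq] : p < m /\ m < q by rewrite /m; split; lra.
have m0 : 0 <= m by exact: le_trans (ltW pm).
apply: (@connected_star _ S (circ a m 0)) => z /andP[pz zq].
have [t zt] : exists t, z = circ a (nc (z - a)) t.
  by apply: polar_form_at; rewrite -subr_eq0 -nc_gt0 (le_lt_trans p0).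
pose lo := Num.min m (nc (z - a)); pose hi := Num.max m (nc (z - a)).
pose tl := Num.min 0 t; pose th := Num.max 0 t.
exists (circ a m @` `[tl, th] `|` (fun r => circ a r t) @` `[lo, hi]); split.
- apply: connectedU.
  + exists (circ a m t); split; [exists t|exists m] => //=; rewrite in_itv /=.
      by rewrite /tl /th ge_min le_max lexx !orbT.
    by rewrite /lo /hi ge_min le_max lexx.
  + by apply: connected_path; apply: ccont_continuous; exact: ccont_circ.
  + by apply: connected_path; apply: ccont_continuous; exact: ccont_circ_r.
- move=> y [[s _ <-]|[r hr <-]]; first by rewrite /S /= nc_circ // pm mq.
  move: hr; rewrite /= in_itv /= /lo /hi ge_min le_max => /andP[h1 h2].
  have r0 : p < r < q.
    by apply/andP; split; [case/orP: h1|case/orP: h2] => h;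
      [exact: lt_le_trans h|exact: lt_le_trans h|exact: le_lt_trans h _|exact: le_lt_trans h _].
  by case/andP: (r0) => pr _; rewrite /S /= nc_circ // (le_trans p0) // ltW.
- by left; exists 0 => //=; rewrite in_itv /= /tl /th ge_min le_max lexx.
- by right; exists (nc (z - a)); rewrite -?zt //= in_itv /= /lo /hi ge_min le_max lexx !orbT.
Qed.

(** Removing a closed disc from an open connected set keeps it connected, because a
    connected collar surrounds the disc. *)
Lemma connected_remove_disc (U : set R[i]) a p q : connected U -> open U -> 0 <= p < q ->
  (forall z, nc (z - a) < q -> U z) -> connected (U `&` [set z | p < nc (z - a)]).
Proof.
move=> cU oU /andP[p0 pq] qU B; set A := U `&` _; move=> B0 [Q opQ BQ] [F cF BF].
have oA : open A by apply: openI => //; exact: open_nc_gt.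
pose C := [set z | p < nc (z - a) < q].
have CA : C `<=` A by move=> z /andP[pz zq]; split=> //; exact: qU.
have cC : connected C by apply: connected_annulus; rewrite p0.
have oB : open B by rewrite BQ; exact: openI.
have BA : B `<=` A by rewrite BQ => z [].
have [BC0|] := eqVneq (B `&` C) set0.
  have BU : B = U.
    apply: cU => //; first by exists B => //; apply/seteqP; split=> [z Bz|z []//]; split=> //; case: (BA z Bz).
    exists (F `&` [set z | q <= nc (z - a)]); first by apply: closedI => //; exact: closed_nc_ge.
    apply/seteqP; split=> [z Bz|z [Uz [Fz qz]]].
      have [Uz pz] := BA z Bz; split=> //; split; first by move: Bz; rewrite BF => -[].
      rewrite /= leNgt; apply/negP => zq.
      have : (B `&` C) z by split=> //; rewrite /C /= pz.
      by rewrite BC0.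
    by rewrite BF; split=> //; split=> //; exact: lt_le_trans qz.
  have /andP[m1 m2] : p < (p + q) / 2 < q by lra.
  have m0 : 0 <= (p + q) / 2 by lra.
  have Cm : C (circ a ((p + q) / 2) 0) by rewrite /C /= nc_circ // m1 m2.
  have : (B `&` C) (circ a ((p + q) / 2) 0).
    by split=> //; rewrite BU; apply: qU; rewrite nc_circ.
  by rewrite BC0.
move=> /set0P BCn.
have CB : C `<=` B.
  have <- : B `&` C = C; last by move=> z [].
  apply: cC => //.
    by exists Q => //; rewrite BQ; apply/seteqP; split=> [z [[_ h] Cz] //|z [Cz Oz]]; split=> //; split=> //; exact: CA.
  by exists F => //; rewrite BF; apply/seteqP; split=> [z [[_ h] Cz] //|z [Cz Oz]]; split=> //; split=> //; exact: CA.
pose D := [set z : R[i] | nc (z - a) < q].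
have BDU : B `|` D = U.
  apply: cU.
  - by case: B0 => z Bz; exists z; left.
  - exists (B `|` D); first by apply: openU => //; exact: open_nc_lt.
    apply/seteqP; split=> [z h|z []//]; split=> //.
    by case: h => [/BA[]//|]; exact: qU.
  - exists (F `|` [set z | nc (z - a) <= p]); first by apply: closedU => //; exact: closed_nc_le.
    apply/seteqP; split=> [z [Bz|Dz]|z [Uz h]].
    + by split; [case: (BA z Bz)|left; move: Bz; rewrite BF => -[]].
    + split; first exact: qU.
      have [zp|pz] := leP (nc (z - a)) p; first by right.
      by left; have : B z by [apply: CB; rewrite /C /= pz]; rewrite BF => -[].
    + have [zp|pz] := leP (nc (z - a)) p; first by right; exact: le_lt_trans pq.
      case: h => [Fz|]; first by left; rewrite BF.
      by rewrite /= leNgt pz.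
apply/seteqP; split=> // z [Uz pz].
have : (B `|` D) z by rewrite BDU.
by case=> // Dz; apply: CB; rewrite /C /= pz.
Qed.

Lemma connected_holed_disc (a : nat -> R[i]) (rho r q : nat -> R) (R0 R1 : R) n :
  separated_holes a rho r q R0 R1 n -> connected (holed_disc R0 n a rho).
Proof.
elim: n => [|n ih] [/andP[R10 R1R0] hr inR disj].
  apply: (@connected_star_shaped 0); first by split=> //; rewrite Normc.normc0 (lt_trans R10).
  move=> z [zR _] t /andP[t0 t1]; split=> //; rewrite add0r subr0 Normc.normcM nc_real ger0_norm //.
  by apply: le_lt_trans zR; rewrite ler_piMl ?nc_ge0.
have [rn0 /andP[rrn rqn]] := hr n (ltnSn n).
have -> : holed_disc R0 n.+1 a rho = holed_disc R0 n a rho `&` [set z | rho n < nc (z - a n)].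
  apply/seteqP; split=> [z [zR zj]|z [[zR zj] zn]]; split=> //.
  - by split=> // j jn; apply: zj; exact: ltnW.
  - exact: zj.
  - by move=> j; rewrite ltnS leq_eqVlt => /predU1P[->|/zj].
apply: (@connected_remove_disc _ _ _ (q n)).
- apply: ih; split; first by rewrite R10.
  + by move=> j jn; apply: hr; exact: ltnW.
  + by move=> j jn; apply: inR; exact: ltnW.
  + by move=> i j ni nj; apply: disj; exact: ltnW.
- exact: open_holed_disc.
- by rewrite rn0 (lt_trans rrn).
move=> z zq; split.
  by have := ncD (z - a n) (a n); rewrite subrK; have := inR n (ltnSn n); lra.
move=> j jn; have [_ /andP[h1 h2]] := hr j (ltnW jn).
have := disj n j (ltnSn n) (ltnW jn); rewrite gtn_eqF // => /(_ isT).
by have := nc_distD z (a n) (a j); rewrite (ncBC (a n) z); move: zq h1 h2 rrn rqn rn0; lra.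
Qed.

End PlaneConnected.

Section Compactification.
Context {R : realType}.
Local Notation opc := (one_point_compactification R[i]).
Implicit Types (a z : R[i]).

Lemma nbhs_infty_ncP (A : set opc) :
  nbhs (None : opc) A <-> exists2 M : R, 0 < M & (A None /\ forall z, M < nc z -> A (Some z)).
Proof.
split.
  move=> [V [cV clV] VA].
  have cN : compact (@Normc.normc R @` V).
    apply: continuous_compact => //; apply: continuous_subspaceT; exact: continuous_nc.
  have [M [Mr hM]] := compact_bounded cN.
  exists (Num.max 1 (M + 1)); first by rewrite lt_max ltr01.
  split; first by apply: VA; right.
  move=> z; rewrite gt_max => /andP[z1 Mz]; apply: VA; left; exists z => // Vz.
  have := hM (M + 1); rewrite ltrDl => /(_ ltr01 (nc z)).
  rewrite /= ger0_norm ?nc_ge0 // => h.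
  by have : nc z <= M + 1 by [apply: h; exists z]; rewrite leNgt Mz.
move=> [M M0 [AN AM]].
exists [set z : R[i] | nc z <= M].
  split; first exact: compact_disc.
  by have := @closed_nc_le R 0 M; under eq_set do rewrite subr0.
move=> x [[z /= zM <-]|->//]; apply: AM; by rewrite ltNge; apply/negP.
Qed.

(** Distances to [a] blow up at infinity, while their inverses extend continuously to
    the sphere; level sets of these functions cut out the components. *)
Definition proximity a (x : opc) : R := if x is Some z then (1 + nc (z - a))^-1 else 0.

Lemma proximity_continuous a : continuous (proximity a).
Proof.
case=> [z|].
  have cz : {for z, continuous (fun z => (1 + nc (z - a))^-1)}.
    apply: (@continuous_comp _ _ _ (fun z => 1 + nc (z - a)) (fun x => x^-1)).
      apply: (@continuous_comp _ _ _ (fun z => nc (z - a)) (fun x => 1 + x)).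
        exact: continuous_nc_dist.
      by apply: cvgD; [exact: cvg_cst|exact: cvg_id].
    by apply: inv_continuous; rewrite gt_eqF // ltr_pwDl ?nc_ge0.
  by move=> A hA; have := cz A hA.
apply/(@cvgrPdist_lt _ _ _ (nbhs (None : opc)) (nbhs_filter _)) => e e0.
apply/nbhs_infty_ncP; exists (e^-1 + nc a).
  by rewrite ltr_pwDl ?nc_ge0 // invr_gt0.
split=> [|z hz] /=; first by rewrite subrr normr0.
have h : e^-1 < 1 + nc (z - a) by have := nc_sub_le z a; move: hz; lra.
have ei : 0 < e^-1 by rewrite invr_gt0.
rewrite sub0r normrN ger0_norm ?invr_ge0 ?addr_ge0 ?nc_ge0 //.
by rewrite -[ltRHS]invrK ltf_pV2 ?posrE // (lt_trans ei h).
Qed.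

(** The ray from [z] to infinity, parametrised so that infinity is at [0]. *)
Definition ray z (s : R) : opc := if s == 0 then None else Some (z * (s%:C)^-1).

Lemma ray_continuous z : z != 0 -> continuous (ray z).
Proof.
move=> z0 s; rewrite /ray; have [->|s0] := eqVneq s 0.
  move=> A; rewrite /= eqxx => /nbhs_infty_ncP[M M0 [AN AM]].
  apply/nbhs_realP; exists (nc z / M); first by rewrite divr_gt0 // nc_gt0.
  move=> t; rewrite subr0 /= => ht; case: eqVneq => // t0; apply: AM.
  rewrite Normc.normcM Normc.normcV nc_real ltr_pdivlMr ?normr_gt0 //.
  by rewrite mulrC -ltr_pdivlMr.
have c1 : ccont_at (fun t : R => z * (t%:C)^-1) s.
  apply: (ccont_atM (F := fun=> z) (G := fun t : R => (t%:C)^-1)); first exact: ccont_at_cst.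
  apply: (ccont_atV (F := fun t : R => t%:C)); last exact: ccont_real.
  by rewrite -(inj_eq (@complexI R)) in s0.
move=> A; rewrite /= (negbTE s0) => hA.
have /nbhs_realP[d d0 hd] : \forall t \near s, A (Some (z * (t%:C)^-1)).
  by move/ccont_atP: c1 => /(_ (Some @^-1` A)); apply.
apply/nbhs_realP; exists (Num.min d `|s|); first by rewrite lt_min d0 normr_gt0.
move=> t; rewrite lt_min => /andP[/hd h ts] /=; case: eqVneq => // t0.
by move: ts; rewrite t0 sub0r normrN ltxx.
Qed.

(** The components of the complement are the [n] closed holes and the outside of the
    large disc together with infinity. Each is connected, by radii or by rays, and is
    separated from the others by the distance to its centre. *)
Lemma has_connectivity_holed_disc (a : nat -> R[i]) (rho r q : nat -> R) (R0 R1 : R) n :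
  separated_holes a rho r q R0 R1 n -> has_connectivity (holed_disc R0 n a rho) n.+1.
Proof.
move=> [/andP[R10 R1R0] hr inR disj]; set Om := holed_disc _ _ _ _.
have R00 : 0 < R0 by exact: lt_trans R1R0.
pose X := extended_complement Om.
pose E (k : nat) : set opc := if k is j.+1 then [set x | if x is Some z then nc (z - a j) <= rho j else False]
  else [set x | if x is Some z then R0 <= nc z else True].
have XP x : X x -> exists2 k, (k < n.+1)%N & E k x.
  case: x => [z|]; last by exists 0%N.
  move=> h; have [zR|zR] := leP R0 (nc z); first by exists 0%N.
  have [[j [jn hj]]|nj] := pselect (exists j, (j < n)%N /\ nc (z - a j) <= rho j).
    by exists j.+1.
  exfalso; apply: h; exists z => //; split=> // j jn.
  by rewrite ltNge; apply/negP => hj; apply: nj; exists j.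
have EX k : (k < n.+1)%N -> E k `<=` X.
  case: k => [_|j jn] [z|] //= h; rewrite /X /extended_complement /= => -[w [wR wj]] //.
    by move=> [wz]; move: wR; rewrite wz ltNge h.
  by move=> [wz]; have := wj j jn; rewrite wz ltNge h.
pose wit k : opc := if k is j.+1 then Some (a j) else None.
have Ew k : (k < n.+1)%N -> E k (wit k).
  by case: k => [_|j jn] //=; rewrite subrr Normc.normc0; case: (hr j jn).
have far i j z : (i < n)%N -> (j < n)%N -> nc (z - a i) <= q i -> nc (z - a j) <= q j -> i = j.
  move=> ni nj h1 h2; have [//|ij] := eqVneq i j; exfalso.
  by have := disj i j ni nj ij; have := nc_distD z (a i) (a j); rewrite (ncBC (a i) z); lra.
have rq j : (j < n)%N -> rho j <= q j by move=> jn; have [_ /andP[h1 h2]] := hr j jn; lra.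
have inq j z : (j < n)%N -> nc (z - a j) <= q j -> nc z < R1.
  by move=> jn h; have := inR j jn; have := nc_sub_le z (a j); lra.
have disjE i j x : (i < n.+1)%N -> (j < n.+1)%N -> E i x -> E j x -> i = j.
  case: i j x => [|i] [|j] [z|] //= ni nj h1 h2.
  + by exfalso; have := inq j z nj (le_trans h2 (rq j nj)); lra.
  + by exfalso; have := inq i z ni (le_trans h1 (rq i ni)); lra.
  + by congr _.+1; apply: (far i j z ni nj); [exact: le_trans (rq i ni)|exact: le_trans (rq j nj)].
have pinv (u v : R) : 0 <= u -> 0 <= v -> ((1 + u)^-1 <= (1 + v)^-1) = (v <= u).
  by move=> u0 v0; rewrite lef_pV2 ?lerD2l // posrE ltr_pwDl.
have pinv' (u v : R) : 0 <= u -> 0 <= v -> ((1 + u)^-1 < (1 + v)^-1) = (v < u).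
  by move=> u0 v0; rewrite ltf_pV2 ?ltrD2l // posrE ltr_pwDl.
have cE k : (k < n.+1)%N -> connected (E k).
  case: k => [_|j jn].
    apply: (@connected_star opc (E 0%N) None) => -[z zR|_]; last first.
      by exists [set None]; split=> //; [exact: connected1|move=> _ ->].
    have z0 : z != 0 by rewrite -nc_gt0; exact: lt_le_trans zR.
    exists (ray z @` `[0, 1]); split.
    - by apply: connected_path; exact: ray_continuous.
    - move=> y [s]; rewrite /= in_itv /= => /andP[s0 s1] <-; rewrite /ray; case: eqVneq => // sn.
      rewrite /= Normc.normcM Normc.normcV nc_real ger0_norm // ler_pdivlMr ?lt_neqAle 1?eq_sym ?sn //.
      by apply: le_trans zR; rewrite ler_piMr // ltW.
    - by exists 0; rewrite /ray ?eqxx //= in_itv /= lexx ler01.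
    - by exists 1; rewrite /ray ?oner_eq0 ?invr1 ?mulr1 //= in_itv /= lexx ler01.
  have -> : E j.+1 = Some @` [set z | nc (z - a j) <= rho j].
    by apply/seteqP; split=> [[z|] //= h|y [z /= h <-] //]; exists z.
  apply: connected_continuous_connected; last first.
    by apply: continuous_subspaceT; exact: one_point_compactification_some_continuous.
  apply: (@connected_star_shaped _ (a j)) => [|z zr t /andP[t0 t1]] /=.
    by rewrite subrr Normc.normc0; case: (hr j jn).
  rewrite addrAC subrr add0r Normc.normcM nc_real ger0_norm //.
  by apply: le_trans zr; rewrite ler_piMl ?nc_ge0.
have comp k x : (k < n.+1)%N -> E k x -> connected_component X x = E k.
  case: k => [_|j jn] Ex.
    apply: (@component_clopen _ X (E 0%N) (proximity 0 @^-1` [set y | y < (1 + R1)^-1])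
       (proximity 0 @^-1` [set y | y <= (1 + R0)^-1])) => //.
    - exact: EX.
    - exact: cE.
    - by apply: open_comp; [move=> y _; exact: proximity_continuous|exact: open_lt].
    - by apply: preimage_closed; [move=> y _; exact: proximity_continuous|exact: closed_le].
    - apply/seteqP; split=> [y Ey|y [Xy]].
        split; first exact: (EX 0%N).
        case: y Ey => [z|_] /=; last by rewrite invr_gt0 ltr_pwDl // ltW.
        by move=> zR; rewrite pinv' ?nc_ge0 ?subr0 ?(ltW R10) // (lt_le_trans R1R0).
      have [[|i] ni Ey] := XP y Xy => //.
      case: y Ey {Xy} => [z|//] /= zi; rewrite pinv' ?nc_ge0 ?(ltW R10) // subr0.
      by have := inq i z ni (le_trans zi (rq i ni)); lra.
    - apply/seteqP; split=> [y Ey|y [Xy]].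
        split; first exact: (EX 0%N).
        case: y Ey => [z|_] /=; last by rewrite invr_ge0 addr_ge0 // ltW.
        by move=> zR; rewrite pinv ?nc_ge0 ?subr0 ?(ltW R00).
      by case: y {Xy} => [z|//] /=; rewrite pinv ?nc_ge0 ?(ltW R00) // subr0.
  have rho0 : 0 <= rho j by case: (hr j jn).
  have q0 : 0 <= q j by exact: le_trans (rq j jn).
  apply: (@component_clopen _ X (E j.+1) (proximity (a j) @^-1` [set y | (1 + q j)^-1 < y])
       (proximity (a j) @^-1` [set y | (1 + rho j)^-1 <= y])) => //.
  - exact: EX.
  - exact: cE.
  - by apply: open_comp; [move=> y _; exact: proximity_continuous|exact: open_gt].
  - by apply: preimage_closed; [move=> y _; exact: proximity_continuous|exact: closed_ge].
  - apply/seteqP; split=> [y Ey|y [Xy]].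
      split; first exact: (EX j.+1).
      case: y Ey => [z|//] /= zr; rewrite pinv' ?nc_ge0 //.
      by have [_ /andP[h1 h2]] := hr j jn; lra.
    have [k nk Ey] := XP y Xy.
    case: y Ey {Xy} => [z|] /= Ey; last by rewrite ltNge invr_ge0 addr_ge0.
    rewrite pinv' ?nc_ge0 // => zq; case: k nk Ey => [_ /= zR|i ni /= zi].
      by have := inq j z jn (ltW zq); lra.
    by rewrite -(far i j z ni jn (le_trans zi (rq i ni)) (ltW zq)).
  - apply/seteqP; split=> [y Ey|y [Xy]].
      split; first exact: (EX j.+1).
      by case: y Ey => [z|//] /= zr; rewrite pinv ?nc_ge0.
    case: y {Xy} => [z|] /=; first by rewrite pinv ?nc_ge0.
    by rewrite leNgt invr_gt0 ltr_pwDl.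
rewrite /has_connectivity -/X.
have -> : [set connected_component X x | x in X] = E @` `I_n.+1.
  apply/seteqP; split=> [_ [x Xx <-]|_ [k nk <-]].
    by have [k nk Ex] := XP x Xx; exists k => //; rewrite (comp k x nk Ex).
  by exists (wit k); [exact/EX/Ew|exact/comp/Ew].
apply: inj_card_eq => i j; rewrite !inE /= => ni nj Eij.
by apply: (disjE i j (wit i) ni nj); [exact: Ew|rewrite -Eij; exact: Ew].
Qed.

End Compactification.

(** * The model domain and its potential *)

Section WellInequalities.
Context {R : realType}.
Implicit Types d m x y : R.

(** A lower bound for the reciprocal of [d] that is rational in [d ^+ 2], hence in the
    coordinates, and sharp at [d = m]. *)
Lemma inv_ge_harmonic d m : 0 < d -> 0 < m -> 2 * m / (d ^+ 2 + m ^+ 2) <= d^-1.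
Proof.
move=> d0 m0; have s0 : 0 < d ^+ 2 + m ^+ 2 by rewrite addr_gt0 // exprn_gt0.
rewrite ler_pdivrMr // -(ler_pM2l d0) mulVKf ?gt_eqF //.
by have := sqr_ge0 (d - m); rewrite sqrrB; lra.
Qed.

Lemma ler_add_fracs (k a b D0 D1 : R) : 0 < D0 -> 0 < D1 ->
  k * (D0 * D1) <= a * D1 + b * D0 -> k <= a / D0 + b / D1.
Proof.
move=> d0 d1 h; have -> : a / D0 + b / D1 = (a * D1 + b * D0) / (D0 * D1).
  by field; rewrite ?gt_eqF.
by rewrite ler_pdivlMr // mulr_gt0.
Qed.

(** At the middle of the left side both distances are close to [28 / 25], where
    [inv_ge_harmonic] is sharp; the same choice is good enough along the whole side. *)
Lemma well_left y : -1 / 2 <= y <= 1 / 2 ->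
  178 / 100 + 13 / (100 * 100) <= 2 * (28 / 25) / ((1 / 2) ^+ 2 + (y - 1) ^+ 2 + (28 / 25) ^+ 2) +
   2 * (28 / 25) / ((1 / 2) ^+ 2 + (y + 1) ^+ 2 + (28 / 25) ^+ 2).
Proof.
move=> yI; have Y : y ^+ 2 <= 1 / 4 by nra.
have Y0 := sqr_ge0 y.
apply: ler_add_fracs.
- by have := sqr_ge0 (y - 1); lra.
- by have := sqr_ge0 (y + 1); lra.
have : 0 <= y ^+ 2 * (1 / 4 - y ^+ 2) by rewrite mulr_ge0 //; lra.
lra.
Qed.

(** At the middle of the right side both distances are close to [9 / 5]. *)
Lemma well_right y : -1 / 2 <= y <= 1 / 2 ->
  108 / 100 <= 2 * (9 / 5) / ((3 / 2) ^+ 2 + (y - 1) ^+ 2 + (9 / 5) ^+ 2) +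
   2 * (9 / 5) / ((3 / 2) ^+ 2 + (y + 1) ^+ 2 + (9 / 5) ^+ 2).
Proof.
move=> yI; have Y : y ^+ 2 <= 1 / 4 by nra.
have Y0 := sqr_ge0 y.
apply: ler_add_fracs.
- by have := sqr_ge0 (y - 1); lra.
- by have := sqr_ge0 (y + 1); lra.
nra.
Qed.

(** On the upper side the holes are at distances of about [13 / 10] and [19 / 10]; the
    margin is small, and polynomial positivity has to be certified on each half. *)
Lemma well_top x : 1 / 2 <= x <= 3 / 2 ->
  2 * 100 + 2 + 16 / 25 <= (16 + x) * (21 / 2 +
     2 * (13 / 10) / (x ^+ 2 + (1 / 2) ^+ 2 + (13 / 10) ^+ 2) +
     2 * (19 / 10) / (x ^+ 2 + (3 / 2) ^+ 2 + (19 / 10) ^+ 2)).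
Proof.
move=> /andP[x1 x2].
have X0 := sqr_ge0 x.
set D0 := x ^+ 2 + (1 / 2) ^+ 2 + _; set D1 := x ^+ 2 + (3 / 2) ^+ 2 + _.
suff : 2 * 100 + 2 + 16 / 25 - (16 + x) * (21 / 2) <=
    (16 + x) * (2 * (13 / 10)) / D0 + (16 + x) * (2 * (19 / 10)) / D1.
  by set u := D0^-1; set v := D1^-1; clearbody u v; lra.
rewrite /D0 /D1; apply: ler_add_fracs; [by lra|by lra|].
(* Both halves are sums of nonnegative Bernstein monomials of degree five. *)
have B (a b : R) (i j : nat) : 0 <= a -> 0 <= b -> 0 <= a ^+ i * b ^+ j.
  by move=> a0 b0; rewrite mulr_ge0 // exprn_ge0.
have [h|h] := leP x 1.
  have l0 : 0 <= x - 1 / 2 by lra. have l1 : 0 <= 1 - x by lra.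
  have := B _ _ 0%N 5%N l0 l1; have := B _ _ 1%N 4%N l0 l1; have := B _ _ 2%N 3%N l0 l1.
  have := B _ _ 3%N 2%N l0 l1; have := B _ _ 4%N 1%N l0 l1; have := B _ _ 5%N 0%N l0 l1.
  clear; lra.
have l0 : 0 <= x - 1 by lra. have l1 : 0 <= 3 / 2 - x by lra.
have := B _ _ 0%N 5%N l0 l1; have := B _ _ 1%N 4%N l0 l1; have := B _ _ 2%N 3%N l0 l1.
have := B _ _ 3%N 2%N l0 l1; have := B _ _ 4%N 1%N l0 l1; have := B _ _ 5%N 0%N l0 l1.
clear; lra.
Qed.

End WellInequalities.

Section Model.
Context {R : realType} (g : nat).
Implicit Types (z w : R[i]) (x y : R).

Variable sigma : R.
Hypothesis sigma_gt0 : 0 < sigma.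
Hypothesis sigma_small : 10 * 100 * 100 * 100 * sigma <= 1.

(** The two main holes sit at [16 + i] and [16 - i]; the others only serve to reach the
    prescribed connectivity, and lie on the negative axis far from the well. *)
Definition ctr (j : nat) : R[i] :=
  match j with
  | 0 => 16 +i* 1
  | 1 => 16 +i* -1
  | _ => (- (16 + 16 * (j%:R / g%:R)))%:C
  end.

Definition main_mod : R := nc (ctr 0).

(** A main hole of radius [sigma * main_mod] contributes [sigma] times
    [nc w / nc (w - ctr j)] to the pseudodistance. The radii [hole_rad1] and [hole_rad2]
    are those of the circle of integration around a hole and of its collar. *)
Definition hole_rad (j : nat) : R := if (j < 2)%N then sigma * main_mod else sigma / (20 * g%:R).
Definition hole_rad1 (j : nat) : R := if (j < 2)%N then (1 + sigma) * (sigma * main_mod) else sigma / (10 * g%:R).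
Definition hole_rad2 (j : nat) : R := if (j < 2)%N then 2 * (sigma * main_mod) else sigma / (5 * g%:R).

(** The outer circle contributes [nc w / Rout], which is [21 / 2 * sigma * nc w]; the
    ratio to the main holes is tuned so that the potential has a well. *)
Definition Rout : R := 2 / (21 * sigma).

Definition model : set R[i] := holed_disc Rout g ctr hole_rad.

Lemma main_mod_sqr : main_mod ^+ 2 = 257.
Proof. by rewrite /main_mod nc_sqr /=; lra. Qed.

Lemma main_mod_bounds : 16 < main_mod < 17.
Proof. by have := main_mod_sqr; have : 0 <= main_mod by [exact: nc_ge0]; move: main_mod => L; nra. Qed.

Lemma nc_ctr1 : nc (ctr 1) = main_mod.
Proof. by rewrite /main_mod /ctr /= sqrrN. Qed.

Lemma Rout_eq : 21 * (sigma * Rout) = 2.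
Proof. by rewrite /Rout; field; rewrite gt_eqF // sigma_gt0. Qed.

Lemma Rout_big : 100 * 100 < Rout.
Proof.
rewrite /Rout ltr_pdivlMr ?mulr_gt0 ?sigma_gt0 //; have := sigma_small; have := sigma_gt0; lra.
Qed.

Hypothesis hg : (2 <= g)%N.

Lemma g_gt0 : 0 < g%:R :> R.
Proof. by rewrite ltr0n (ltn_trans _ hg). Qed.

Lemma frac_bounds (j : nat) : (j < g)%N -> 0 <= (j%:R / g%:R : R) <= 1.
Proof.
move=> jg; rewrite divr_ge0 ?ler0n //= ler_pdivrMr ?g_gt0 // mul1r ler_nat.
exact: ltnW.
Qed.

Lemma nc_ctr (j : nat) : (j < g)%N -> 16 <= nc (ctr j) <= 32.
Proof.
have hL := main_mod_bounds; case: j => [|[|j]] jg; rewrite -/main_mod ?nc_ctr1; try by lra.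
by have := frac_bounds jg; rewrite nc_real normrN; set u : R := j.+2%:R / g%:R => hu; rewrite ger0_norm; lra.
Qed.

Lemma sigma_g (c : R) : 1 <= c -> 0 < sigma / (c * g%:R) <= sigma.
Proof.
move=> c1; have c0 : 0 < c by lra.
have cg : 1 <= c * g%:R by rewrite mulr_ege1 // ler1n (ltn_trans _ hg).
have cg0 : 0 < c * g%:R by lra.
by rewrite divr_gt0 ?sigma_gt0 //= ler_pdivrMr // ler_peMr // ltW // sigma_gt0.
Qed.

Lemma hole_rad_bounds j : 0 < hole_rad j /\ hole_rad j < hole_rad1 j < hole_rad2 j /\ hole_rad2 j <= 34 * sigma.
Proof.
have s0 := sigma_gt0; have s1 := sigma_small; have := main_mod_bounds => hL.
rewrite /hole_rad /hole_rad1 /hole_rad2; case: ifP => _.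
  have sL : 0 < sigma * main_mod by rewrite mulr_gt0 //; lra.
  have sL2 : sigma * main_mod <= sigma * 17 by rewrite ler_wpM2l //; lra.
  have ssL : 0 < sigma * (sigma * main_mod) by rewrite mulr_gt0.
  have ssL2 : sigma * (sigma * main_mod) < 1 * (sigma * main_mod) by rewrite ltr_pM2r //; lra.
  by move: sL sL2 ssL ssL2; move: (sigma * (sigma * main_mod)) (sigma * main_mod) => u v; lra.
have [_ h20] := andP (@sigma_g 20 ltac:(lra)).
have /andP[h10 h10'] : 0 < sigma / (20 * g%:R) <= sigma by apply: sigma_g; lra.
have g0 := g_gt0.
have -> : sigma / (10 * g%:R) = 2 * (sigma / (20 * g%:R)) by field; rewrite gt_eqF.
have -> : sigma / (5 * g%:R) = 4 * (sigma / (20 * g%:R)) by field; rewrite gt_eqF.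
lra.
Qed.

Lemma ctr_apart i j : (i < g)%N -> (j < g)%N -> i != j -> hole_rad2 i + hole_rad2 j < nc (ctr i - ctr j).
Proof.
move=> ig jg; wlog ij : i j ig jg / (i < j)%N => [h|_].
  by rewrite neq_ltn => /orP[ij|ji]; [|rewrite ncBC addrC]; apply: h; rewrite ?ltn_eqF //.
have s0 := sigma_gt0; have s1 := sigma_small.
have [_ [_ hi]] := hole_rad_bounds i; have [_ [_ hj]] := hole_rad_bounds j.
case: i ig ij hi => [|[|i]] ig; case: j jg hj => [|[|j]] jg // hj ij hi.
- apply: lt_le_trans (Im_le_nc _); rewrite /ctr /= opprK ger0_norm; lra.
- apply: lt_le_trans (Re_le_nc _); rewrite /ctr /= opprK.
  by have := frac_bounds jg; move: (_ / _) => u hu; rewrite ger0_norm; lra.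
- apply: lt_le_trans (Re_le_nc _); rewrite /ctr /= opprK.
  by have := frac_bounds jg; move: (_ / _) => u hu; rewrite ger0_norm; lra.
apply: lt_le_trans (Re_le_nc _); rewrite /hole_rad2 /= /ctr /=.
have v0 : 0 < (g%:R)^-1 :> R by rewrite invr_gt0 g_gt0.
have ijR : i.+2%:R + 1 <= j.+2%:R :> R by rewrite natr1 ler_nat.
rewrite opprK ltr_normr; apply/orP; left.
apply: (@lt_le_trans _ _ (16 * (g%:R)^-1)).
  by rewrite invfM; move: v0 s1 s0; move: (_^-1) => v v0; nra.
have : (i.+2%:R + 1) * (g%:R)^-1 <= j.+2%:R * (g%:R)^-1 :> R by rewrite ler_wpM2r // ltW.
move: (j.+2%:R) (i.+2%:R) => x y; lra.
Qed.

Lemma model_separated : separated_holes ctr hole_rad hole_rad1 hole_rad2 Rout (Rout - 1) g.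
Proof.
have s0 := sigma_gt0; have s1 := sigma_small; have hR := Rout_big.
split.
- by lra.
- by move=> j _; have [h1 [h2 _]] := hole_rad_bounds j; split=> //; exact: ltW.
- by move=> j jg; have [_ [_ h]] := hole_rad_bounds j; have := nc_ctr jg; lra.
- exact: ctr_apart.
Qed.

Lemma model0 : model 0.
Proof.
have s0 := sigma_gt0; have s1 := sigma_small; have hR := Rout_big.
split; first by rewrite Normc.normc0; lra.
move=> j jg; rewrite sub0r normcN.
by have [h0 [/andP[h1 h2] h3]] := hole_rad_bounds j; have := nc_ctr jg; lra.
Qed.

Lemma model_domain : is_domain model.
Proof.
split; [exact: open_holed_disc|exact: connected_holed_disc model_separated|].
by exists 0; exact: model0.
Qed.

Lemma model_neq j z : model z -> (j < g)%N -> z != ctr j.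
Proof.
move=> [_ h] jg; rewrite -subr_eq0 -nc_gt0; apply: lt_trans (h j jg).
by have [] := hole_rad_bounds j.
Qed.

(** Together with [admissible_hole], this function has modulus about [1/2] or more near
    the boundary, which keeps small balls inside a compact set. *)
Lemma admissible_scale : admissible model 0 (fun z => Rout^-1%:C * z).
Proof.
have hR := Rout_big; have R0 : 0 < Rout by lra.
split; last by rewrite mulr0.
split=> [z _|z [zR _]].
  by apply/holo_differentiable/holo_atM; [exact: holo_at_cst|exact: holo_at_id].
rewrite Normc.normcM nc_real ger0_norm ?invr_ge0 ?(ltW R0) //.
by rewrite mulrC ltr_pdivrMr // mul1r.
Qed.

Lemma admissible_hole j : (j < g)%N -> admissible model 0
  (fun z => (hole_rad j / 2)%:C * ((z - ctr j)^-1 + (ctr j)^-1)).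
Proof.
move=> jg; have [r0 [/andP[r1 r2] r3]] := hole_rad_bounds j; have s0 := sigma_gt0; have s1 := sigma_small.
have hc := nc_ctr jg.
split; last by rewrite sub0r invrN addrC subrr mulr0.
split=> [z mz|z mz].
  apply/holo_differentiable; apply: (holo_atM (f := fun=> (hole_rad j / 2)%:C)); first exact: holo_at_cst.
  apply: (holo_atD (f := fun z => (z - ctr j)^-1)); last exact: holo_at_cst.
  apply: (holo_atV (f := fun z => z - ctr j)); first by rewrite subr_eq0 (model_neq mz).
  by apply: (holo_atD (f := id)); [exact: holo_at_id|exact: holo_at_cst].
have [_ /(_ j jg) zj] := mz.
have d0 : 0 < nc (z - ctr j) by exact: lt_trans zj.
rewrite Normc.normcM nc_real ger0_norm ?divr_ge0 ?(ltW r0) //.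
apply: (@le_lt_trans _ _ (hole_rad j / 2 * ((nc (z - ctr j))^-1 + (nc (ctr j))^-1))).
  by rewrite ler_wpM2l ?divr_ge0 ?(ltW r0) // -!Normc.normcV ncD.
have h1 : hole_rad j * (nc (z - ctr j))^-1 < 1 by rewrite ltr_pdivrMr // mul1r.
have h2 : hole_rad j * (nc (ctr j))^-1 <= 1 by rewrite ler_pdivrMr; lra.
by move: h1 h2; move: (_^-1) (_^-1) => u v; lra.
Qed.

(** What [mobius_potential] gives from the lower bound of the potential on the rim of the
    well. *)
Definition rim_level : R := sigma / (1 + 3 * 100 * sigma) * (2 * 100 + 2 + 16 / 25).

Lemma rim_level_bounds : 0 < rim_level < 1 / 10.
Proof.
have s0 := sigma_gt0; have s1 := sigma_small.
have h : 0 < 1 + 3 * 100 * sigma by lra.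
have -> : rim_level = sigma * (2 * 100 + 2 + 16 / 25) / (1 + 3 * 100 * sigma) by rewrite /rim_level; ring.
by rewrite divr_gt0 ?ltr_pdivrMr //=; lra.
Qed.

(** Near the outer circle or near a hole one of the test functions has modulus well
    above [rim_level], which is of the order of [sigma]. *)
Lemma mobius_core z : model z -> mobius_pdist model z 0 < rim_level -> holed_core Rout g ctr hole_rad (1 / 2) z.
Proof.
move=> mz mb; have hb := rim_level_bounds; have hR := Rout_big; have R0 : 0 < Rout by lra.
have s0 := sigma_gt0; have s1 := sigma_small.
split.
  rewrite leNgt; apply/negP => zR.
  have := mobius_ge mz admissible_scale; rewrite Normc.normcM nc_real ger0_norm ?invr_ge0 ?(ltW R0) //.
  have : 1 / 2 < Rout^-1 * nc z by rewrite -(ltr_pM2l R0) mulVKf ?gt_eqF.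
  by lra.
move=> j jg; rewrite leNgt; apply/negP => zj.
have [r0 [/andP[r1 r2] r3]] := hole_rad_bounds j; have hc := nc_ctr jg.
have := mobius_ge mz (admissible_hole jg).
rewrite Normc.normcM nc_real ger0_norm ?divr_ge0 ?(ltW r0) //.
have [_ /(_ j jg) zj'] := mz.
have d0 : 0 < nc (z - ctr j) by exact: lt_trans zj'.
have h3 : (nc (z - ctr j))^-1 - (nc (ctr j))^-1 <= nc ((z - ctr j)^-1 + (ctr j)^-1).
  by rewrite -!Normc.normcV -[X in _ <= nc (_ + X)]opprK -(normcN (ctr j)^-1) nc_sub_le.
have h1 : 1 / 2 < hole_rad j * (nc (z - ctr j))^-1.
  by rewrite ltr_pdivlMr //; move: zj; rewrite invf_div divr1; lra.
have h2 : hole_rad j * (nc (ctr j))^-1 <= 1 / 4 by rewrite ler_pdivrMr; lra.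
have : hole_rad j * ((nc (z - ctr j))^-1 - (nc (ctr j))^-1) <= hole_rad j * nc ((z - ctr j)^-1 + (ctr j)^-1).
  by rewrite ler_wpM2l // ltW.
set T := nc ((z - ctr j)^-1 + _); have -> : hole_rad j / 2 * T = hole_rad j * T / 2 by ring.
rewrite mulrBr; move: h1 h2 (proj2 (andP hb)) mb.
set u := hole_rad j / _; set v := hole_rad j / _; set X := hole_rad j * T; set m := mobius_pdist _ _ _.
clearbody u v X m; clear; lra.
Qed.

(** Up to the factor [sigma], nearly the pseudodistance to [0]: the small holes and the
    terms of second order in [sigma] are left out. *)
Definition potential z : R := nc z * (21 / 2 + (nc (z - ctr 0))^-1 + (nc (z - ctr 1))^-1).

(** The test function is [z (21/2 + b0 / (z - ctr 0) + b1 / (z - ctr 1))], with unimodular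
    [b0] and [b1] that align the three terms at [w]. The normalising factor bounds its
    modulus: each term is at most [1] up to [O(sigma)], and the three bounds are never
    nearly attained together, because at most one main hole is close to [z], and close
    to a hole [z] is far from the outer circle. *)
Lemma mobius_potential w : model w -> sigma / (1 + 3 * 100 * sigma) * potential w <= mobius_pdist model w 0.
Proof.
move=> mw; have s0 := sigma_gt0; have s1 := sigma_small; have hR := Rout_big; have hL := main_mod_bounds.
have g0 : (0 < g)%N by exact: ltn_trans hg.
have N0 : 0 < 1 + 3 * 100 * sigma by lra.
(* The phases that make the terms of [f w] positive multiples of one another. *)
pose be j := (w - ctr j) / (nc (w - ctr j))%:C.
have d0 j z : (j < g)%N -> model z -> 0 < nc (z - ctr j).
  by move=> jg mz; rewrite nc_gt0 subr_eq0 (model_neq mz).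
have nbe j : (j < g)%N -> nc (be j) = 1.
  move=> jg; rewrite /be Normc.normcM Normc.normcV nc_real ger0_norm ?nc_ge0 // divff //.
  by rewrite gt_eqF // d0.
pose f z := (sigma / (1 + 3 * 100 * sigma))%:C * (z * ((21 / 2)%:C + be 0%N * (z - ctr 0)^-1 + be 1%N * (z - ctr 1)^-1)).
have hpole j z : (j < g)%N -> model z -> holo_at (fun z => be j * (z - ctr j)^-1) z.
  move=> jg mz; apply: (holo_at_pole (f := fun=> be j)); first exact: holo_at_cst.
  exact: model_neq mz jg.
have adm : admissible model 0 f.
  split; last by rewrite /f mul0r mulr0.
  split=> [z mz|z mz].
    apply/holo_differentiable/holo_atM; first exact: holo_at_cst.
    apply: holo_atM; first exact: holo_at_id.
    apply: holo_atD; last exact: hpole.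
    by apply: holo_atD; [exact: holo_at_cst|exact: hpole].
  have D0 := d0 0%N z g0 mz; have D1 := d0 1%N z hg mz; have [zR zj] := mz.
  have S0 : sigma * main_mod < nc (z - ctr 0) := zj 0%N g0.
  have S1 : sigma * main_mod < nc (z - ctr 1) := zj 1%N hg.
  rewrite Normc.normcM nc_real ger0_norm; last by rewrite divr_ge0 // ltW.
  rewrite mulrAC ltr_pdivrMr // mul1r Normc.normcM.
  have B : nc ((21 / 2)%:C + be 0%N * (z - ctr 0)^-1 + be 1%N * (z - ctr 1)^-1) <=
      21 / 2 + (nc (z - ctr 0))^-1 + (nc (z - ctr 1))^-1.
    apply: le_trans (ncD _ _) _; apply: lerD; last by rewrite Normc.normcM nbe // mul1r Normc.normcV.
    apply: le_trans (ncD _ _) _; apply: lerD; last by rewrite Normc.normcM nbe // mul1r Normc.normcV.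
    by rewrite nc_real ger0_norm //; lra.
  apply: le_lt_trans (ler_wpM2l (ltW s0) (ler_wpM2l (nc_ge0 z) B)) _.
  have q c : 0 < nc (z - c) -> nc c = main_mod -> nc z * (nc (z - c))^-1 <= 1 + main_mod * (nc (z - c))^-1.
    move=> d cL; rewrite -(ler_pM2r d) mulrDl -!mulrA mulVf ?gt_eqF // !mulr1 mul1r -cL.
    by have := ncD (z - c) c; rewrite subrK.
  have Q0 := q _ D0 erefl; have Q1 := q _ D1 nc_ctr1.
  have sR : sigma * (21 / 2 * nc z) < 1.
    have : sigma * nc z < sigma * Rout by rewrite ltr_pM2l.
    have := Rout_eq; lra.
  have apart : 2 <= nc (z - ctr 0) + nc (z - ctr 1).
    have := nc_distD z (ctr 0) (ctr 1); rewrite (ncBC (ctr 0) z).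
    have := Im_le_nc (ctr 0 - ctr 1); rewrite /ctr /= opprK ger0_norm; lra.
  have T0 : sigma * main_mod * (nc (z - ctr 0))^-1 < 1 by rewrite ltr_pdivrMr // mul1r.
  have T1 : sigma * main_mod * (nc (z - ctr 1))^-1 < 1 by rewrite ltr_pdivrMr // mul1r.
  have far c : 1 <= nc (z - c) -> sigma * main_mod * (nc (z - c))^-1 <= 17 * sigma.
    move=> h; have d : 0 < nc (z - c) by lra.
    rewrite ler_pdivrMr //; apply: (@le_trans _ _ (17 * sigma * 1)); first by nra.
    by rewrite ler_wpM2l //; lra.
  have near c : nc (z - c) < 1 -> nc c = main_mod -> sigma * nc z <= 18 * sigma.
    move=> h cL; rewrite mulrC ler_wpM2r ?(ltW s0) //.
    by have := ncD (z - c) c; rewrite subrK cL; lra.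
  have sQ0 : sigma * (nc z * (nc (z - ctr 0))^-1) <= sigma * (1 + main_mod * (nc (z - ctr 0))^-1) by rewrite ler_wpM2l // ltW.
  have sQ1 : sigma * (nc z * (nc (z - ctr 1))^-1) <= sigma * (1 + main_mod * (nc (z - ctr 1))^-1) by rewrite ler_wpM2l // ltW.
  have [c0|c0] := ltP (nc (z - ctr 0)) 1.
    have F1 : sigma * main_mod * (nc (z - ctr 1))^-1 <= 17 * sigma by apply: far; lra.
    have F0 := near _ c0 erefl.
    move: sQ0 sQ1 T0 F1 F0; move: (nc (z - ctr 0))^-1 (nc (z - ctr 1))^-1 => u v; lra.
  have F0 := far _ c0.
  have [c1|c1] := ltP (nc (z - ctr 1)) 1.
    have F1 := near _ c1 nc_ctr1.
    move: sQ0 sQ1 T1 F1 F0; move: (nc (z - ctr 0))^-1 (nc (z - ctr 1))^-1 => u v; lra.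
  have F1 := far _ c1.
  move: sQ0 sQ1 F1 F0; move: (nc (z - ctr 0))^-1 (nc (z - ctr 1))^-1 => u v; lra.
apply: le_trans (mobius_ge mw adm).
have bew j : (j < g)%N -> be j * (w - ctr j)^-1 = ((nc (w - ctr j))^-1)%:C.
  move=> jg; have := model_neq mw jg; rewrite -subr_eq0 => wj.
  by rewrite /be mulrAC divff // mul1r fmorphV.
rewrite /f !bew // -!rmorphD /= Normc.normcM (Normc.normcM w) !nc_real.
rewrite /potential ger0_norm; last by rewrite divr_ge0 // ltW.
rewrite ger0_norm // !addr_ge0 ?invr_ge0 ?nc_ge0 //; lra.
Qed.

End Model.

(** * The well of the potential *)

Section ModelWell.
Context {R : realType} (g : nat).
Implicit Types (z w : R[i]) (x y : R).
Variable sigma : R.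
Hypothesis sigma_gt0 : 0 < sigma.
Hypothesis sigma_small : 10 * 100 * 100 * 100 * sigma <= 1.
Hypothesis hg : (2 <= g)%N.

Local Notation Omega := (model g sigma).
Local Notation cen := (ctr g).
Local Notation rho1 := (hole_rad1 g sigma).
Local Notation R0 := (Rout sigma).

(** [17] lies between the two main holes and a little to their right; the potential has
    a local minimum close to it. *)
Definition well : set R[i] :=
  [set z | `|complex.Re z - 17| <= 1 / 2 /\ `|complex.Im z| <= 1 / 2].
Definition well_int : set R[i] :=
  [set z | `|complex.Re z - 17| < 1 / 2 /\ `|complex.Im z| < 1 / 2].

Lemma nc_ctr_dist0 z : nc (z - cen 0) ^+ 2 = (complex.Re z - 16) ^+ 2 + (complex.Im z - 1) ^+ 2.
Proof. by rewrite nc_sqr; case: z. Qed.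

Lemma nc_ctr_dist1 z : nc (z - cen 1) ^+ 2 = (complex.Re z - 16) ^+ 2 + (complex.Im z + 1) ^+ 2.
Proof. by rewrite nc_sqr; case: z => a b /=; rewrite opprK. Qed.

Lemma well_Re z : well z -> 33 / 2 <= complex.Re z <= 35 / 2 /\ - 1 / 2 <= complex.Im z <= 1 / 2.
Proof. by case; rewrite !ler_norml => /andP[h1 h2] /andP[h3 h4]; lra. Qed.

Lemma well_dist0 z : well z -> 1 / 2 <= nc (z - cen 0).
Proof.
move=> /well_Re[hx _]; apply: le_trans (Re_le_nc _).
by case: z hx => a b /=; rewrite ler_normr => hx; apply/orP; left; lra.
Qed.

Lemma well_dist1 z : well z -> 1 / 2 <= nc (z - cen 1).
Proof.
move=> /well_Re[hx _]; apply: le_trans (Re_le_nc _).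
by case: z hx => a b /=; rewrite ler_normr => hx; apply/orP; left; lra.
Qed.

Lemma well_far (j : nat) z : (j.+2 < g)%N -> well z -> 32 <= nc (z - cen j.+2).
Proof.
move=> jg /well_Re[hx _]; apply: le_trans (Re_le_nc _).
have := @frac_bounds R _ hg _ jg; case: z hx => a b /=; set u : R := j.+2%:R / g%:R => hx hu.
by rewrite ler_normr; apply/orP; left; lra.
Qed.

Lemma well_model : well `<=` Omega.
Proof.
move=> z wz; have hR := Rout_big sigma_gt0 sigma_small; split.
  apply: le_lt_trans (nc_le_ReIm _) _.
  have [hx hy] := well_Re wz; rewrite (ger0_norm (_ : 0 <= complex.Re z)); last by lra.
  by case: wz => _; lra.
move=> j jg; have [_ [h1 h2]] := hole_rad_bounds sigma_gt0 sigma_small hg j.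
have s1 := sigma_small; case: j jg h1 h2 => [|[|j]] jg h1 h2.
- by have := well_dist0 wz; lra.
- by have := well_dist1 wz; lra.
- by have := well_far jg wz; lra.
Qed.

Lemma well0 : ~ well 0.
Proof. by move=> /well_Re[]; rewrite /=; lra. Qed.

Lemma potential_ge z (m0 m1 : R) : well z -> 0 < m0 -> 0 < m1 ->
  complex.Re z * (21 / 2 + 2 * m0 / ((complex.Re z - 16) ^+ 2 + (complex.Im z - 1) ^+ 2 + m0 ^+ 2)
     + 2 * m1 / ((complex.Re z - 16) ^+ 2 + (complex.Im z + 1) ^+ 2 + m1 ^+ 2)) <= potential g z.
Proof.
move=> wz m00 m10; have [hx _] := well_Re wz.
have h0 := well_dist0 wz; have h1 := well_dist1 wz.
rewrite /potential -nc_ctr_dist0 -nc_ctr_dist1.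
have i0 := @inv_ge_harmonic _ (nc (z - cen 0)) m0 ltac:(lra) m00.
have i1 := @inv_ge_harmonic _ (nc (z - cen 1)) m1 ltac:(lra) m10.
have p m d : 0 < m -> 0 <= 2 * m / (d ^+ 2 + m ^+ 2) :> R.
  by move=> mp; rewrite divr_ge0 ?addr_ge0 ?sqr_ge0 // mulr_ge0 // ltW.
have p0 := p m0 (nc (z - cen 0)) m00; have p1 := p m1 (nc (z - cen 1)) m10.
apply: ler_pM; [by lra|by lra| |by lra].
by apply: le_trans (Re_le_nc z); rewrite ler_norm.
Qed.

(** The four sides of the square: to the left both main holes are closer, above and below
    one of them is, and to the right the factor [nc z] is larger. *)
Lemma potential_rim z : well z -> ~ well_int z -> 2 * 100 + 2 + 16 / 25 <= potential g z.
Proof.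
move=> wz nz; have [hx hy] := well_Re wz.
have : complex.Re z = 33 / 2 \/ complex.Re z = 35 / 2 \/
  complex.Im z = 1 / 2 \/ complex.Im z = - 1 / 2.
  have [h1|h1] := ltP `|complex.Re z - 17| (1 / 2); last first.
    by move: h1; rewrite ler_normr => /orP[] h1; [right; left|left]; lra.
  have [h2|h2] := ltP `|complex.Im z| (1 / 2); first by case: nz.
  by right; right; move: h2; rewrite ler_normr => /orP[] h2; [left|right]; lra.
move=> [e|[e|[e|e]]].
- have := @potential_ge z (28 / 25) (28 / 25) wz ltac:(lra) ltac:(lra).
  rewrite e (_ : 33 / 2 - 16 = 1 / 2 :> R); last by lra.
  have := well_left hy; set u := _ / (_ + (_ - 1) ^+ 2 + _); set v := _ / (_ + (_ + 1) ^+ 2 + _).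
  by clearbody u v; lra.
- have := @potential_ge z (9 / 5) (9 / 5) wz ltac:(lra) ltac:(lra).
  rewrite e (_ : 35 / 2 - 16 = 3 / 2 :> R); last by lra.
  have := well_right hy; set u := _ / (_ + (_ - 1) ^+ 2 + _); set v := _ / (_ + (_ + 1) ^+ 2 + _).
  by clearbody u v; lra.
- apply: le_trans (potential_ge wz _ _); last 2 first.
  + by instantiate (1 := 13 / 10); lra.
  + by instantiate (1 := 19 / 10); lra.
  have := @well_top _ (complex.Re z - 16) ltac:(lra).
  rewrite e (_ : (1 / 2 - 1) ^+ 2 = (1 / 2) ^+ 2 :> R); last by lra.
  by rewrite (_ : 1 / 2 + 1 = 3 / 2 :> R) ?[16 + _]addrC ?subrK //; lra.
- apply: le_trans (potential_ge wz _ _); last 2 first.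
  + by instantiate (1 := 19 / 10); lra.
  + by instantiate (1 := 13 / 10); lra.
  have := @well_top _ (complex.Re z - 16) ltac:(lra).
  rewrite e (_ : (- 1 / 2 - 1) ^+ 2 = (3 / 2) ^+ 2 :> R); last by lra.
  rewrite (_ : - 1 / 2 + 1 = 1 / 2 :> R); last by lra.
  by rewrite [16 + _]addrC subrK (addrAC (21 / 2)).
Qed.

Lemma mobius_rim z : well z -> ~ well_int z -> rim_level sigma <= mobius_pdist Omega z 0.
Proof.
move=> wz nz; have s0 := sigma_gt0.
apply: le_trans (mobius_potential sigma_gt0 sigma_small hg (well_model wz)).
rewrite /rim_level ler_wpM2l ?potential_rim // divr_ge0 ?(ltW s0) //; lra.
Qed.

Lemma well_centre : well_int 17.
Proof.
have -> : (17 : R[i]) = 17%:C by rewrite rmorph_nat.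
by rewrite /well_int /= subrr normr0; lra.
Qed.

(** At [17] the distance to a main hole is the square root of [2]. *)
Lemma main_hole_term c : nc c = main_mod g -> nc (17 - c) ^+ 2 = 2 ->
  17 * ((1 + sigma) * (sigma * main_mod g)) /
    ((nc (17 - c) - (1 + sigma) * (sigma * main_mod g)) * (nc c - (1 + sigma) * (sigma * main_mod g)))
   <= (12 + 22 / (10 * 100)) * sigma.
Proof.
have s0 := sigma_gt0; have s1 := sigma_small; have := @main_mod_bounds R g; move=> hL cL.
have d0 := nc_ge0 (17 - c); move=> d2; rewrite cL.
have d1 : 141 / 100 + 42 / (100 * 100) <= nc (17 - c) by rewrite leNgt; apply/negP => h; nra.
move: (nc _) (main_mod _) d1 hL {cL d0 d2} => d L d1 hL.
have -> : (1 + sigma) * (sigma * L) = ((1 + sigma) * sigma) * L by rewrite mulrA.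
have t1 : (1 + sigma) * sigma <= 2 * sigma by rewrite ler_wpM2r; lra.
have t0 : 0 < (1 + sigma) * sigma by rewrite mulr_gt0; lra.
set t := (1 + sigma) * sigma in t0 t1 *.
have Et : t = (1 + sigma) * sigma by [].
clearbody t; clear sigma_gt0 sigma_small.
have tL : t * L <= 34 * sigma by nra.
have -> : L - t * L = L * (1 - t) by ring.
have D0 : 0 < (d - t * L) * (L * (1 - t)) by rewrite !mulr_gt0 //; clear -s0 s1 t0 t1 tL d1 hL; lra.
rewrite ler_pdivrMr //.
have h : 17 * (1 + sigma) <= (12 + 22 / (10 * 100)) * ((d - t * L) * (1 - t)).
  have : (141 / 100 + 42 / (100 * 100) - 34 * sigma) * (1 - 2 * sigma) <= (d - t * L) * (1 - t).
    by apply: ler_pM; clear -s0 s1 t0 t1 tL d1; lra.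
  nra.
have : 0 < sigma * L by rewrite mulr_gt0 //; lra.
move=> sL; have := ler_wpM2l (ltW sL) h.
rewrite Et; lra.
Qed.

Lemma outer_term : 17 / (R0 - 1 - 17) <= (178 + 51 / 100) * sigma.
Proof.
have s0 := sigma_gt0; have s1 := sigma_small; have hR := Rout_big s0 s1; have eR := @Rout_eq R _ s0.
rewrite ler_pdivrMr; last by lra.
nra.
Qed.

Lemma extra_hole_term (j : nat) : (j.+2 < g)%N ->
  17 * rho1 j.+2 / ((nc (17 - cen j.+2) - rho1 j.+2) * (nc (cen j.+2) - rho1 j.+2))
    <= sigma / 100 / g%:R.
Proof.
move=> jg; have s0 := sigma_gt0; have s1 := sigma_small.
have g0 := @g_gt0 R _ hg.
have h17 : well 17 by have := well_centre; case=> /ltW a /ltW b.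
have h1 := well_far jg h17; have h2 := @nc_ctr R _ hg _ jg.
have /andP[r0 r1] : 0 < sigma / (10 * g%:R) <= sigma by apply: sigma_g => //; lra.
have -> : rho1 j.+2 = sigma / (10 * g%:R) by [].
have -> : sigma / 100 / g%:R = sigma / (10 * g%:R) / 10 by field; rewrite gt_eqF.
set r := sigma / (10 * g%:R) in r0 r1 *.
have D : 200 <= (nc (17 - cen j.+2) - r) * (nc (cen j.+2) - r).
  by apply: (@le_trans _ _ (31 * 15)); [lra|apply: ler_pM; lra].
rewrite ler_pdivrMr; last by lra.
nra.
Qed.

(** The Cauchy estimate at [17] gives less than [202.57 * sigma], of which about
    [178.5 * sigma] comes from the outer circle and [12.02 * sigma] from each main hole,
    whereas [rim_level] is about [202.64 * sigma]. *)
Lemma mobius_centre : mobius_pdist Omega 17 0 < rim_level sigma.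
Proof.
have s0 := sigma_gt0; have s1 := sigma_small; have hR := Rout_big s0 s1.
have hL := @main_mod_bounds R g; have g0 := @g_gt0 R _ hg.
have h17 : well 17 by have := well_centre; case=> /ltW a /ltW b.
have n17 : nc (17 : R[i]) = 17.
  by have -> : (17 : R[i]) = 17%:C by [rewrite rmorph_nat]; rewrite nc_real ger0_norm.
have e17 : (17 : R[i]) = 17 +i* 0 by rewrite -[LHS](rmorph_nat (real_complex R)).
apply: (@le_lt_trans _ _ ((202 + 57 / 100) * sigma)); last first.
  have D : 0 < 1 + 3 * 100 * sigma by lra.
  rewrite /rim_level mulrAC ltr_pdivlMr //; nra.
apply: mobius_le => f [[hf f1] f0].
apply: le_trans (bounded_holo_estimate (w := 17) (model_separated s0 s1 hg) _ f0 _ _) _.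
- move=> z zR zj; have mz : Omega z by split.
  by split; [exact/differentiable_holo/hf|exact/ltW/f1].
- by rewrite n17; lra.
- move=> j jg; have [_ [/andP[_ h1] h2]] := hole_rad_bounds s0 s1 hg j; have h3 := @nc_ctr R _ hg _ jg.
  split; last by lra.
  by case: j jg h1 h2 h3 => [|[|j]] jg h1 h2 h3;
    [have := well_dist0 h17|have := well_dist1 h17|have := well_far jg h17]; lra.
rewrite n17 -(big_mkord xpredT (fun j => 17 * rho1 j /
   ((nc (17 - cen j) - rho1 j) * (nc (cen j) - rho1 j)))).
rewrite big_ltn; last exact: ltn_trans hg.
rewrite big_ltn //.
have T0 := @main_hole_term (cen 0) erefl; have T1 := @main_hole_term (cen 1) (@nc_ctr1 R g).
have E0 : (complex.Re (17 : R[i]) - 16) ^+ 2 + (complex.Im (17 : R[i]) - 1) ^+ 2 = 2.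
  by rewrite e17 /=; lra.
have E1 : (complex.Re (17 : R[i]) - 16) ^+ 2 + (complex.Im (17 : R[i]) + 1) ^+ 2 = 2.
  by rewrite e17 /=; lra.
have {}T0 := T0 (etrans (nc_ctr_dist0 17) E0); have {}T1 := T1 (etrans (nc_ctr_dist1 17) E1); have T2 := outer_term.
have T3 : \sum_(2 <= j < g) 17 * rho1 j / ((nc (17 - cen j) - rho1 j) * (nc (cen j) - rho1 j)) <= sigma / 100.
  apply: (@le_trans _ _ (\sum_(2 <= j < g) sigma / 100 / g%:R)).
    rewrite big_nat_cond [leRHS]big_nat_cond; apply: ler_sum => -[|[|j]] //; rewrite andbT => /andP[_ jg].
    exact: extra_hole_term.
  rewrite sumr_const_nat -[_ *+ _]mulr_natr -mulrA -[leRHS]mulr1 ler_wpM2l //; first by lra.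
  by rewrite mulrC ler_pdivrMr // mul1r ler_nat leq_subr.
have E2 : rho1 0 = (1 + sigma) * (sigma * main_mod g) by [].
have E3 : rho1 1 = (1 + sigma) * (sigma * main_mod g) by [].
move: T0 T1 T2 T3; rewrite -{1 2 3}E2 -E3.
set a0 := 17 / _; set a1 := 17 * _ / _; set a2 := 17 * _ / _; set a3 := \sum_(_ <= _ < _) _.
clearbody a0 a1 a2 a3; lra.
Qed.

Lemma closed_well : closed well.
Proof.
have cA (f : R[i] -> R) c : continuous f -> closed [set z : R[i] | `|f z - c| <= 1 / 2].
  move=> cf; apply: (@preimage_closed _ _ (fun z => `|f z - c|) [set x | x <= 1 / 2]).
    move=> z _; apply: (@cvg_comp _ _ _ (fun z => f z - c) _ (nbhs z) (nbhs (f z - c))).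
      by apply: cvgB; [exact: cf|exact: cvg_cst].
    exact: norm_continuous.
  exact: closed_le.
have := closedI (cA _ 17 continuous_Re) (cA _ 0 continuous_Im).
by congr closed; apply/seteqP; split=> z [h1]; rewrite /= subr0.
Qed.

Lemma open_well_int : open well_int.
Proof.
have oA (f : R[i] -> R) c : continuous f -> open [set z : R[i] | `|f z - c| < 1 / 2].
  move=> cf; apply: (@open_comp _ _ (fun z => `|f z - c|) [set x | x < 1 / 2]).
    move=> z _; apply: (@cvg_comp _ _ _ (fun z => f z - c) _ (nbhs z) (nbhs (f z - c))).
      by apply: cvgB; [exact: cf|exact: cvg_cst].
    exact: norm_continuous.
  exact: open_lt.
have := openI (oA _ 17 continuous_Re) (oA _ 0 continuous_Im).
by congr open; apply/seteqP; split=> z [h1]; rewrite /= subr0.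
Qed.

Lemma well_int_sub : well_int `<=` well.
Proof. by move=> z [/ltW ? /ltW ?]. Qed.

Lemma compact_well : compact well.
Proof.
apply: (subclosed_compact closed_well (@compact_disc R 20)) => z wz.
have [hx hy] := well_Re wz; apply: le_trans (nc_le_ReIm _) _.
rewrite (ger0_norm (_ : 0 <= complex.Re z)); last by lra.
by case: wz => _; lra.
Qed.

Lemma well_bottom : exists2 p, well_int p &
  0 < mobius_pdist Omega p 0 < rim_level sigma /\
  forall z, well_int z -> mobius_pdist Omega p 0 <= mobius_pdist Omega z 0.
Proof.
have [p wp pm] := mobius_min 0 compact_well well_model (ex_intro _ 17 (well_int_sub well_centre)).
have pb : mobius_pdist Omega p 0 < rim_level sigma.
  exact: le_lt_trans (pm _ (well_int_sub well_centre)) mobius_centre.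
exists p; first by apply: contrapT => /(mobius_rim wp); rewrite leNgt pb.
split; last by move=> z /well_int_sub /pm.
rewrite pb andbT.
apply: lt_le_trans (mobius_ge (well_model wp) (admissible_scale g sigma_gt0 sigma_small)).
rewrite nc_gt0 mulf_neq0 //.
  by rewrite -nc_gt0 nc_real normr_gt0 invr_eq0; have := Rout_big sigma_gt0 sigma_small; lra.
by apply/eqP => p0; apply: well0; rewrite -p0.
Qed.

Lemma compact_core : compact (holed_core R0 g cen (hole_rad g sigma) (1 / 2)).
Proof. exact: compact_holed_core. Qed.

Lemma core_model (m : R) : 0 < m < 1 -> holed_core R0 g cen (hole_rad g sigma) m `<=` Omega.
Proof.
apply: holed_core_sub; first by have := Rout_big sigma_gt0 sigma_small; lra.
by move=> j _; have [] := hole_rad_bounds sigma_gt0 sigma_small hg j.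
Qed.

Lemma model_balls : exists (s1 s2 : R),
  [/\ 0 < s2 < s1, ~ connected (open_cball Omega 0 s1),
      relatively_compact_in Omega (open_cball Omega 0 s1) &
      closure_in Omega (open_cball Omega 0 s2) `<` closed_cball Omega 0 s2].
Proof.
have [p wp [/andP[p0 pb] pm]] := well_bottom.
have b1 : rim_level sigma < 1 by have := rim_level_bounds sigma_gt0 sigma_small; lra.
exists (artanh (rim_level sigma)), (artanh (mobius_pdist Omega p 0)).
apply: (well_balls (Wo := well_int) (Wc := well) (p := p) (K := holed_core R0 g cen (hole_rad g sigma) (1 / 2))) => //.
- exact: model_domain.
- exact: model0.
- exact: open_well_int.
- exact: closed_well.
- exact: well_int_sub.
- exact: well0.
- by move=> z _; exact: mobius_rim.
- by move=> z _; exact: pm.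
- exact/well_model/well_int_sub.
- exact: compact_core.
- by apply: core_model; lra.
- by move=> z; exact: mobius_core.
Qed.

End ModelWell.

(** * Products with a polydisc *)

Section Lines.
Context {R : realType} {V : normedModType R[i]}.

Lemma continuous_line (x v : V) : continuous (fun k : R[i] => x + k *: v).
Proof.
move=> k A /nbhs_rnormP[e e0 eA]; apply/nbhs_ncP.
have v1 : 0 < rnorm v + 1 by rewrite ltr_wpDl // rnorm_ge0.
exists (e / (rnorm v + 1)); first by rewrite divr_gt0.
move=> l; rewrite ltr_pdivlMr // => lk; apply: eA.
rewrite opprD addrACA subrr add0r -scalerBl rnormZ; apply: le_lt_trans lk.
by rewrite ler_wpM2l ?nc_ge0 // lerDl.
Qed.

Lemma continuous_real_line (x v : V) : continuous (fun t : R => x + t%:C *: v).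
Proof.
move=> t; apply: (@cvg_comp _ _ _ (fun t : R => t%:C : R[i]) (fun k => x + k *: v) _ (nbhs (t%:C : R[i]))).
  by have /ccont_atP := @ccont_real R t.
exact: continuous_line.
Qed.

End Lines.

Section Product.
Context {R : realType} (Omega : set R[i]) (n : nat).
Local Notation V := 'rV[R[i]]_n.+1.
Local Notation M := (prod_polydisk Omega n.+1).
Implicit Types (z : V) (w : R[i]).

Lemma polydiskP z : M z <->
  Omega (z ord0 ord0) /\ forall i : 'I_n.+1, i != ord0 -> nc (z ord0 i) < 1.
Proof.
split=> [h|[h0 h] i].
  by split=> [|i i0]; [have := h ord0|have := h i; rewrite ifN //].
case: ifP => [/eqP i0|/negbT i0]; last exact: h.
by have -> : i = ord0 by exact: val_inj.
Qed.

Definition slice w : V := w *: delta_mx ord0 ord0.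

Lemma slice_coord w i : slice w ord0 i = if i == ord0 then w else 0.
Proof. by rewrite /slice !mxE eqxx /=; case: eqP; rewrite ?mulr1 ?mulr0. Qed.

Lemma slice_polydisk w : Omega w -> M (slice w).
Proof.
move=> Ow; apply/polydiskP; split=> [|i i0]; first by rewrite slice_coord eqxx.
by rewrite slice_coord (negbTE i0) Normc.normc0.
Qed.

Lemma holo_coord i z : differentiable (fun z : V => z ord0 i : R[i]) z.
Proof. exact: (@differentiable_coord _ 1 n.+1 z ord0 i). Qed.

Lemma continuous_coord i : continuous (fun z : V => z ord0 i : R[i]).
Proof. by move=> z; exact: coord_continuous. Qed.

Lemma open_polydisk : open Omega -> open M.
Proof.
move=> oO; pose P (j : nat) : set V :=
  if j == 0%N then [set z | Omega (z ord0 (inord j))] else [set z | unit_disk (z ord0 (inord j))].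
have -> : M = [set z | forall j, (j < n.+1)%N -> P j z].
  apply/seteqP; split=> z h => [j jn|i].
    by have := h (inord j); rewrite /P inordK //; case: ifP.
  by have := h i (ltn_ord i); rewrite /P inord_val; case: ifP.
apply: open_forall_lt => j; rewrite /P; case: ifP => _.
  by apply: (open_comp _ oO) => z _; exact: continuous_coord.
apply: (@open_comp _ _ (fun z : V => z ord0 (inord j) : R[i]) unit_disk).
  by move=> z _; exact: continuous_coord.
by have := @open_nc_lt R 0 1; under eq_set do rewrite subr0.
Qed.

Lemma connected_polydisk : connected Omega -> Omega 0 -> connected M.
Proof.
move=> cO O0.
apply: (@connected_star _ M (slice 0)) => z Mz; have [z0 zi] := (polydiskP z).1 Mz.
pose L (t : R) : V := slice (z ord0 ord0) + t%:C *: (z - slice (z ord0 ord0)).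
have cL : continuous L by exact: continuous_real_line.
have cs : continuous slice.
  have -> : slice = (fun w => 0 + w *: delta_mx ord0 ord0) by apply/funext => w; rewrite add0r.
  exact: continuous_line.
exists (slice @` Omega `|` L @` `[0, 1]); split.
- apply: connectedU.
  + exists (slice (z ord0 ord0)); split; first by exists (z ord0 ord0).
    by exists 0; rewrite /= ?in_itv /= ?lexx ?ler01 // /L scale0r addr0.
  + by apply: connected_continuous_connected => //; exact: continuous_subspaceT.
  + exact: connected_path.
- have LE t i : L t ord0 i = slice (z ord0 ord0) ord0 i + t%:C * (z ord0 i - slice (z ord0 ord0) ord0 i).
    by rewrite /L; move: (slice _) => s; rewrite !mxE.
  move=> y [[w Ow <-]|[t]]; first exact: slice_polydisk.
  rewrite /= in_itv /= => /andP[t0 t1] <-; apply/polydiskP; split=> [|i i0].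
    by rewrite LE slice_coord eqxx subrr mulr0 addr0.
  rewrite LE slice_coord (negbTE i0) subr0 add0r.
  rewrite Normc.normcM nc_real ger0_norm //; have := zi i i0; have := nc_ge0 (z ord0 i); nra.
- by left; exists 0.
- by right; exists 1; rewrite /= ?in_itv /= ?lexx ?ler01 // /L scale1r addrC subrK.
Qed.

Lemma admissible_coord0 f : admissible Omega 0 f -> admissible M 0 (fun z : V => f (z ord0 ord0)).
Proof.
move=> [[hf f1] f0]; split; last by rewrite /= mxE.
split=> [z|z] /polydiskP[z0 _]; last exact: f1.
apply: (differentiable_comp (f := fun z : V => z ord0 ord0 : R[i])); first exact: holo_coord.
exact: hf.
Qed.

Lemma admissible_coord i : i != ord0 -> admissible M 0 (fun z : V => z ord0 i : R[i]).
Proof.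
move=> i0; split; last by rewrite /= mxE.
by split=> [z _|z /polydiskP[_ h]]; [exact: holo_coord|exact: h].
Qed.

Lemma mobius_polydisk_base z : M z -> mobius_pdist Omega (z ord0 ord0) 0 <= mobius_pdist M z 0.
Proof. by move=> Mz; apply: mobius_le => f /admissible_coord0 /(mobius_ge Mz). Qed.

Lemma mobius_polydisk_fibre z i : M z -> i != ord0 -> nc (z ord0 i) <= mobius_pdist M z 0.
Proof. by move=> Mz /admissible_coord /(mobius_ge Mz). Qed.

Lemma mobius_polydisk_slice w : Omega w -> mobius_pdist M (slice w) 0 <= mobius_pdist Omega w 0.
Proof.
move=> Ow; apply: mobius_le => F [[hF F1] F0].
have adm : admissible Omega 0 (F \o slice).
  split; last by rewrite /= /slice scale0r.
  split=> [x Ox|x Ox]; last exact/F1/slice_polydisk.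
  apply: holo_differentiable.
  have := @holo_at_line _ _ F 0 (delta_mx ord0 ord0) x.
  have -> : (fun k => F (0 + k *: delta_mx ord0 ord0)) = F \o slice.
    by apply/funext => k /=; rewrite add0r.
  by apply; rewrite add0r; apply: hF; exact: slice_polydisk.
exact: mobius_ge Ow adm.
Qed.

Lemma compact_polydisk (K : set R[i]) (m : R) : compact K ->
  compact [set z : V | forall i, (if i == ord0 then K else [set w | nc w <= m]) (z ord0 i)].
Proof.
move=> cK; apply: (@rV_compact _ n.+1 (fun i => if i == ord0 then K else [set w : R[i] | nc w <= m])) => i.
by case: ifP => _ //; exact: compact_disc.
Qed.

(** On the product the pseudodistance to [0] dominates that of the first coordinate and
    the moduli of the others, and on the slice through [0] it is at most that of the
    first coordinate. So a well of [Omega] times the polydisc is a well of the product,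
    with the same bottom and the same rim. *)
Lemma polydisk_balls Wo Wc p m b K : is_domain Omega -> Omega 0 ->
  open Wo -> closed Wc -> Wo `<=` Wc -> ~ Wc 0 ->
  (forall w, Omega w -> Wc w -> ~ Wo w -> b <= mobius_pdist Omega w 0) ->
  (forall w, Omega w -> Wo w -> m <= mobius_pdist Omega w 0) ->
  Omega p -> Wo p -> mobius_pdist Omega p 0 <= m -> 0 < m -> m < b -> b < 1 ->
  compact K -> K `<=` Omega -> (forall w, Omega w -> mobius_pdist Omega w 0 < b -> K w) ->
  [/\ 0 < artanh m < artanh b,
      ~ connected (open_cball M 0 (artanh b)),
      relatively_compact_in M (open_cball M 0 (artanh b)) &
      closure_in M (open_cball M 0 (artanh m)) `<` closed_cball M 0 (artanh m)].
Proof.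
move=> [oO cO _] O0 oWo cWc WoWc Wc0 bar low Op Wop pm m0 mb b1 cK KO sub.
have M0 : M 0 by apply/polydiskP; split=> [|i _]; rewrite mxE // Normc.normc0.
apply: (well_balls (Wo := [set z : V | Wo (z ord0 ord0)]) (Wc := [set z : V | Wc (z ord0 ord0)])
  (p := slice p) (K := [set z : V | forall i, (if i == ord0 then K else [set w | nc w <= b]) (z ord0 i)])) => //.
- by split; [exact: open_polydisk|exact: connected_polydisk|exists 0].
- by apply: (open_comp _ oWo) => z _; exact: continuous_coord.
- by apply: (preimage_closed _ cWc) => z _; exact: continuous_coord.
- by move=> z; exact: WoWc.
- by rewrite /= mxE.
- move=> z Mz Wcz Woz; apply: le_trans (mobius_polydisk_base Mz).
  by apply: bar => //; have [] := (polydiskP z).1 Mz.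
- move=> z Mz Woz; apply: le_trans (mobius_polydisk_base Mz).
  by apply: low => //; have [] := (polydiskP z).1 Mz.
- exact: slice_polydisk.
- by rewrite /= slice_coord eqxx.
- exact: le_trans (mobius_polydisk_slice Op) pm.
- exact: compact_polydisk.
- move=> z h; apply/polydiskP; split=> [|i i0]; first by apply: KO; have := h ord0.
  by have := h i; rewrite (negbTE i0) /= => /le_lt_trans; apply.
- move=> z Mz zb i; case: ifP => [/eqP ->|/negbT i0].
    apply: sub; first by have [] := (polydiskP z).1 Mz.
    exact: le_lt_trans (mobius_polydisk_base Mz) zb.
  by apply: ltW; exact: le_lt_trans (mobius_polydisk_fibre Mz i0) zb.
Qed.

End Product.

(** * A plurisubharmonic exhaustion *)

Section MeanValue.
Context {R : realType}.
Implicit Types (h : R -> R[i]) (phi : R -> R).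
Local Notation mu := (@lebesgue_measure R).

(** Cauchy's formula at the centre of the unit circle. *)
Lemma mean_value (H : R[i] -> R[i]) : (forall l, nc l <= 1 -> holo_at H l) ->
  cint 0 (2 * pi) (fun t => H (cis t)) = (2 * pi)%:C * H 0.
Proof.
move=> hH; have h0 : nc (0 - 0 : R[i]) < 1 by rewrite subr0 Normc.normc0.
have := @cauchy_disc _ H 0 1 0 h0; rewrite /cauchy_tr => <-; last by move=> z; rewrite subr0; exact: hH.
rewrite mulrA -rmorphM mulfV ?mul1r; last first.
  by rewrite mulf_neq0 // gt_eqF // pi_gt0.
apply: eq_cint => t _; rewrite /circ add0r !mul1r subr0 mulfVK //.
by rewrite -nc_gt0 nc_cis.
Qed.

Lemma submean_Re (phi : R -> R) h (s : R) : continuous phi -> ccont h ->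
  (forall t, s + complex.Re (h t) <= phi t) -> cint 0 (2 * pi) h = 0 ->
  2 * pi * s <= (\int[mu]_(t in `[0, 2 * pi]) phi t)%R.
Proof.
move=> cphi ch low h0.
have cR := ccont_Re ch; have iR := continuous_int (0 : R) (2 * pi) cR.
have ic : mu.-integrable `[0, 2 * pi] (EFin \o (fun=> s)).
  by apply: (@continuous_int _ (fun=> s)) => t; exact: cvg_cst.
apply: (@le_trans _ _ (\int[mu]_(t in `[0, 2 * pi]) (s + complex.Re (h t)))%R).
  rewrite RintegralD // Rintegral_cst //.
  have -> : (\int[mu]_(t in `[0, 2 * pi]) complex.Re (h t))%R = 0.
    by have := congr1 (@complex.Re R) h0.
  have -> : fine (mu `[0%R, 2 * pi]) = 2 * pi.
    by rewrite /= lebesgue_measure_itv /= lte_fin mulr_gt0 ?pi_gt0 //= subr0.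
  by rewrite addr0 mulrC.
apply: le_Rintegral => //.
  apply: (@continuous_int _ (fun t => s + complex.Re (h t))) => t.
  by apply: cvgD; [exact: cvg_cst|exact: cR].
exact: continuous_int.
Qed.

(** The convex function [s |-> (1 - s)^-1] lies above its tangents. *)
Lemma inv_tangent (s s0 : R) : s < 1 -> s0 < 1 ->
  (1 - s0)^-1 + (s - s0) / (1 - s0) ^+ 2 <= (1 - s)^-1.
Proof.
move=> s1 s01; have a0 : 0 < 1 - s by lra. have b0 : 0 < 1 - s0 by lra.
rewrite -subr_ge0.
have -> : (1 - s)^-1 - ((1 - s0)^-1 + (s - s0) / (1 - s0) ^+ 2) =
  (s - s0) ^+ 2 / ((1 - s) * (1 - s0) ^+ 2).
  by field; rewrite !gt_eqF.
by rewrite divr_ge0 ?sqr_ge0 // mulr_ge0 ?exprn_ge0 ?(ltW a0) ?(ltW b0).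
Qed.

End MeanValue.

Section Exhaustion.
Context {R : realType} {V : normedModType R[i]}.
Variables (G : set V) (I : finType) (g : I -> V -> R[i]).
Hypothesis hg : forall k, holomorphic_to_disk G (g k).
Implicit Types (z a b : V).

(** A sum of convex increasing functions of moduli of holomorphic functions: it is
    plurisubharmonic and blows up where one of the moduli tends to [1]. *)
Definition exhaustion z : R := \sum_(k : I) (1 - nc (g k z))^-1.

Lemma exhaustion_continuous z : G z -> {for z, continuous exhaustion}.
Proof.
move=> Gz; rewrite /exhaustion.
have term k : (fun y => (1 - nc (g k y))^-1) @ z --> (1 - nc (g k z))^-1.
  apply: cvgV; first by rewrite subr_eq0 eq_sym lt_eqF // (proj2 (hg k)).
  apply: cvgB; first exact: cvg_cst.
  apply: ccont_at_nc; apply/ccont_atP.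
  by apply: differentiable_continuous; exact: (proj1 (hg k)).
rewrite /index_enum; elim: (Finite.enum _) => [|k r ih].
  rewrite /prop_for /continuous_at big_nil; under eq_fun do rewrite big_nil; exact: cvg_cst.
rewrite /prop_for /continuous_at big_cons; under eq_fun do rewrite big_cons; exact: cvgD.
Qed.

(** Replace each convex term by its tangent at the value over [a], and each modulus by the
    real part of a rotation that agrees with it at [a]. This bounds the function from
    below by the real part of a holomorphic one, with equality at the centre. *)
Lemma exhaustion_submean a b : (forall l, nc l <= 1 -> G (a + l *: b)) ->
  ((exhaustion a)%:E <= circle_mean (EFin \o exhaustion) a b)%E.
Proof.
move=> hl; have Ga : G a by have := hl 0; rewrite scale0r addr0 Normc.normc0; apply.
have [e e1 ec] : exists2 e : I -> R[i], forall k, nc (e k) = 1 & forall k, e k * g k a = (nc (g k a))%:C.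
  have h k := cid2 (rotate_to_real (g k a)).
  by exists (fun k => s2val (h k)) => k; case: (h k).
pose w k : R := ((1 - nc (g k a)) ^+ 2)^-1.
pose H (l : R[i]) := \sum_(k : I) (w k)%:C * e k * (g k (a + l *: b) - g k a).
have hH l : nc l <= 1 -> holo_at H l.
  move=> l1; rewrite /H /index_enum; elim: (Finite.enum _) => [|k r ih].
    rewrite (_ : (fun _ => _) = fun=> 0); first exact: holo_at_cst.
    by apply/funext => x; rewrite big_nil.
  rewrite (_ : (fun _ => _) = fun x => (w k)%:C * e k * (g k (a + x *: b) - g k a) +
     \sum_(i <- r) (w i)%:C * e i * (g i (a + x *: b) - g i a)); last first.
    by apply/funext => x; rewrite big_cons.
  apply: holo_atD ih; apply: (holo_atM (f := fun=> (w k)%:C * e k)); first exact: holo_at_cst.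
  apply: (holo_atD (f := fun x => g k (a + x *: b))); last exact: holo_at_cst.
  by apply: holo_at_line; exact/(proj1 (hg k))/hl.
have H0 : H 0 = 0.
  by rewrite /H big1 // => k _; rewrite scale0r addr0 subrr mulr0.
have low l : nc l <= 1 -> exhaustion a + complex.Re (H l) <= exhaustion (a + l *: b).
  move=> l1; have Gl := hl l l1.
  rewrite /H raddf_sum /= -big_split /=; apply: ler_sum => k _.
  have g1 := proj2 (hg k) _ Gl; have g0 := proj2 (hg k) _ Ga.
  apply: le_trans (inv_tangent g1 g0); rewrite lerD2l -mulrA Re_mul mul0r subr0 mulrBr ec.
  rewrite raddfB /= /w mulrC ler_wpM2r ?invr_ge0 ?sqr_ge0 // lerD2r.
  apply: le_trans (ler_norm _) _; apply: le_trans (Re_le_nc _) _.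
  by rewrite Normc.normcM e1 mul1r.
have cphi : continuous (fun t => exhaustion (a + cis t *: b)).
  move=> t; have Gt : G (a + cis t *: b) by apply: hl; rewrite nc_cis.
  apply: (@continuous_comp _ _ _ (fun t => a + cis t *: b) exhaustion t); last exact: exhaustion_continuous.
  apply: (@continuous_comp _ _ _ cis (fun l => a + l *: b) t); last exact: continuous_line.
  by have /ccont_atP := ccont_cis t.
have ch : ccont (fun t => H (cis t)).
  move=> t; apply: (ccont_at_ccomp (F := H)); first exact: ccont_cis.
  by apply: holo_at_ccont; apply: hH; rewrite nc_cis.
have := submean_Re (s := exhaustion a) cphi ch.
rewrite mean_value // H0 mulr0 => /(_ _ erefl).
have -> : circle_mean (EFin \o exhaustion) a b =
    ((2 * pi)^-1 * \int[@lebesgue_measure R]_(t in `[0, 2 * pi]) exhaustion (a + cis t *: b))%:E.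
  rewrite /circle_mean EFinM /Rintegral fineK //.
  by apply: integrable_fin_num => //; exact: continuous_int cphi.
move=> h; rewrite lee_fin ler_pdivlMl ?mulr_gt0 ?pi_gt0 //; apply: h => t.
by apply: low; rewrite nc_cis.
Qed.

Lemma exhaustion_pseudoconvex :
  (forall m : R, 0 < m < 1 -> exists K, [/\ compact K, K `<=` G &
     forall z, G z -> (forall k, nc (g k z) <= m) -> K z]) ->
  pseudoconvex G.
Proof.
move=> hK; exists exhaustion; split.
- by apply: continuous_in_subspaceT => z; rewrite inE; exact: exhaustion_continuous.
- split=> [z _|z Gz c /=|a b hl]; first exact: ltey.
    rewrite lte_fin => zc; have := cvgr_lt _ (exhaustion_continuous Gz) _ zc => /(_ (nbhs_filter z)).
    by apply: filterS => y; rewrite lte_fin.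
  exact: exhaustion_submean.
- move=> c.
  (* [d] is at least [2] so that [1 - d^-1] is a level between [0] and [1]. *)
  pose d := Num.max c 2; have d2 : 2 <= d by rewrite /d le_max lexx orbT.
  have d0 : 0 < d by lra.
  have d1 : d^-1 <= 1 / 2 by rewrite div1r lef_pV2 ?posrE //; lra.
  have [|K [cK KG hKz]] := hK (1 - d^-1).
    by have : 0 < d^-1 by [rewrite invr_gt0]; lra.
  apply: (relatively_compactW cK KG) => z [Gz zc]; apply: hKz => // k.
  have pos i : 0 < 1 - nc (g i z) by rewrite subr_gt0; exact: (proj2 (hg i)).
  have : (1 - nc (g k z))^-1 < d.
    apply: le_lt_trans (_ : exhaustion z < d); last by rewrite lt_max zc.
    rewrite /exhaustion (bigD1 k) //= lerDl sumr_ge0 // => i _.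
    by rewrite invr_ge0 ltW.
  by rewrite -ltf_pV2 ?posrE ?invr_gt0 // invrK; lra.
Qed.

End Exhaustion.

(** * The product domain and the theorem *)

Section PolydiskOverHoledDisc.
Context {R : realType} (n : nat).
Variables (R0 : R) (N : nat) (a : nat -> R[i]) (rho : nat -> R).
Hypothesis R0_gt0 : 0 < R0.
Hypothesis rho_gt0 : forall j, (j < N)%N -> 0 < rho j.
Local Notation V := 'rV[R[i]]_n.+1.
Local Notation M := (prod_polydisk (holed_disc R0 N a rho) n.+1).
Implicit Types z : V.

(** These functions describe the product domain: each has modulus less than [1] inside,
    and at the boundary one of the moduli tends to [1]. *)
Definition defining_fun (k : 'I_n.+1 + 'I_N) : V -> R[i] :=
  match k with
  | inl i => if i == ord0 then fun z => R0^-1%:C * z ord0 ord0 else fun z => z ord0 i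
  | inr j => fun z => (rho j)%:C * (z ord0 ord0 - a j)^-1
  end.

Lemma coord0_comp (f : R[i] -> R[i]) z : holo_at f (z ord0 ord0) ->
  differentiable (fun z : V => f (z ord0 ord0)) z.
Proof.
move=> hf; apply: (differentiable_comp (f := fun z : V => z ord0 ord0 : R[i])); first exact: holo_coord.
exact: holo_differentiable.
Qed.

Lemma defining_fun_disk k : holomorphic_to_disk M (defining_fun k).
Proof.
case: k => [i|j] /=; split=> z /polydiskP[[zR zj] zi].
- case: ifP => _; last exact: holo_coord.
  apply: (coord0_comp (f := fun w => R0^-1%:C * w)).
  by apply: holo_atM; [exact: holo_at_cst|exact: holo_at_id].
- case: ifP => [_|/negbT]; last exact: zi.
  rewrite Normc.normcM nc_real ger0_norm ?invr_ge0 ?(ltW R0_gt0) //.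
  by rewrite mulrC ltr_pdivrMr // mul1r.
- have d0 : 0 < nc (z ord0 ord0 - a j) by apply: le_lt_trans (zj j _); rewrite ?(ltW (rho_gt0 _)).
  apply: (coord0_comp (f := fun w => (rho j)%:C * (w - a j)^-1)).
  apply: (holo_at_pole (f := fun=> (rho j)%:C)); first exact: holo_at_cst.
  by rewrite -subr_eq0 -nc_gt0.
have d0 : 0 < nc (z ord0 ord0 - a j) by apply: le_lt_trans (zj j _); rewrite ?(ltW (rho_gt0 _)).
rewrite Normc.normcM nc_real Normc.normcV ger0_norm ?(ltW (rho_gt0 _)) //.
by rewrite ltr_pdivrMr // mul1r zj.
Qed.

Lemma polydisk_pseudoconvex : pseudoconvex M.
Proof.
apply: (exhaustion_pseudoconvex (g := defining_fun)); first exact: defining_fun_disk.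
move=> m /andP[m0 m1].
exists [set z : V | forall i, (if i == ord0 then holed_core R0 N a rho m else [set w | nc w <= m]) (z ord0 i)].
split; first by apply: compact_polydisk; exact: compact_holed_core.
- move=> z h; apply/polydiskP; split=> [|i i0].
    by apply: (@holed_core_sub _ _ _ _ _ m) => //; [rewrite m0 m1|have := h ord0].
  by have := h i; rewrite (negbTE i0) /= => /le_lt_trans; apply.
- move=> z /polydiskP[[zR zj] zi] h i; have := h (inl i); rewrite /=; case: ifP => [/eqP ->|//].
  rewrite Normc.normcM nc_real ger0_norm ?invr_ge0 ?(ltW R0_gt0) // mulrC ler_pdivrMr // => hR.
  split=> [|j jN]; first by rewrite mulrC.
  have d0 : 0 < nc (z ord0 ord0 - a j) by apply: le_lt_trans (zj j _); rewrite ?(ltW (rho_gt0 _)).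
  have := h (inr (Ordinal jN)); rewrite /= Normc.normcM nc_real Normc.normcV ger0_norm ?(ltW (rho_gt0 _)) //.
  by rewrite ler_pdivrMr // ler_pdivrMr // mulrC.
Qed.

Lemma polydisk_bounded : bounded_set M.
Proof.
have B0 : 0 <= (R0 + 1)%:C by rewrite ler0c addr_ge0 // ltW.
exists (R0 + 1)%:C; split; first exact: ger0_real.
move=> B RB z /polydiskP[[zR _] zi] /=.
apply: le_trans (ltW RB); rewrite /Num.norm /=.
have [->|/mx_norm_neq0[[i j] ->] /=] := eqVneq (mx_norm z) 0; first exact: B0.
rewrite ord1 -/(Num.norm (z ord0 j)) normr_nc lecR.
have [->|j0] := eqVneq j ord0; first by lra.
by apply: ltW; apply: lt_trans (zi j j0) _; rewrite ltrDr.
Qed.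

End PolydiskOverHoledDisc.

Theorem corollary1p2 (R : realType) (g : nat) (hg : (2 <= g)%N) :
  exists Omega : set R[i],
    [/\ is_domain Omega,
        has_connectivity Omega g.+1,
        (exists (s1 s2 : R) (zeta0 : R[i]),
           [/\ 0 < s2 < s1, Omega zeta0,
               ~ connected (open_cball Omega zeta0 s1),
               relatively_compact_in Omega (open_cball Omega zeta0 s1) &
               closure_in Omega (open_cball Omega zeta0 s2)
                 `<` closed_cball Omega zeta0 s2]) &
        (forall n : nat, (2 <= n)%N ->
           let M := prod_polydisk Omega n in
           [/\ is_domain M, bounded_set M, pseudoconvex M &
             exists (r1 r2 : R) (z0 : 'rV[R[i]]_n),
               [/\ 0 < r2 < r1, M z0,
                   ~ connected (open_cball M z0 r1),
                   relatively_compact_in M (open_cball M z0 r1) &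
                   closure_in M (open_cball M z0 r2)
                     `<` closed_cball M z0 r2]])].
Proof.
pose sigma : R := (10 * 100 * 100 * 100)^-1.
have s0 : 0 < sigma by rewrite invr_gt0; lra.
have s1 : 10 * 100 * 100 * 100 * sigma <= 1 by rewrite mulfV //; apply: lt0r_neq0; lra.
have b1 : rim_level sigma < 1 by have := rim_level_bounds s0 s1; lra.
have R0 : 0 < Rout sigma by have := Rout_big s0 s1; lra.
have rp j : (j < g)%N -> 0 < hole_rad g sigma j by move=> _; have [] := hole_rad_bounds s0 s1 hg j.
have [p wp [/andP[p0 pb] pm]] := well_bottom s0 s1 hg.
have dO := model_domain s0 s1 hg; have O0 := @model0 _ _ _ s0 s1 hg; have [oO cO _] := dO.
exists (model g sigma); split=> //.
- exact: has_connectivity_holed_disc (model_separated s0 s1 hg).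
- have [r1 [r2 [h1 h2 h3 h4]]] := model_balls s0 s1 hg.
  by exists r1, r2, 0; split.
case=> [|n] // _ M.
have M0 : M 0 by apply/polydiskP; split=> [|i _]; rewrite mxE // Normc.normc0.
split; [|exact: polydisk_bounded|exact: polydisk_pseudoconvex|].
  by split; [exact: open_polydisk|exact: connected_polydisk|exists 0].
exists (artanh (rim_level sigma)), (artanh (mobius_pdist (model g sigma) p 0)), 0.
have [] // := @polydisk_balls _ _ n well_int well p (mobius_pdist (model g sigma) p 0) (rim_level sigma)
  (holed_core (Rout sigma) g (ctr g) (hole_rad g sigma) (1 / 2)) dO O0 open_well_int closed_well well_int_sub well0.
- by move=> w _; exact: mobius_rim.
- by move=> w _; exact: pm.
- exact/(well_model s0 s1 hg)/well_int_sub.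
- exact: compact_core.
- by apply: core_model => //; lra.
- by move=> w; exact: mobius_core.
Qed.
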